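(* There is a randomized algorithm that, given any real matrix $A \in \mathbb{R}^{m \times n}$, outputs a coloring $x \in \{-1,1\}^n$ satisfying $\|Ax\|_\infty = O(\lg n \cdot \lg^{3/2} m \cdot \operatorname{herdisc}(A))$, and runs in expected time $O(mn^2 \lg(2 + m/n) + n^3)$.
   Context: For a real matrix $A \in \mathbb{R}^{m \times n}$, its discrepancy is $\operatorname{disc}(A) = \min_{x \in \{-1,1\}^n} \|Ax\|_\infty$. The hereditary discrepancy $\operatorname{herdisc}(A)$ is the maximum of $\operatorname{disc}(A')$ over all submatrices $A'$ obtained from $A$ by deleting a subset of its columns. $\lg$ denotes the base-2 logarithm. The $O(\cdot)$ hides absolute constants.
   Formalization: The discrepancy bound is stated only for m, n ≥ 2: for m = 1 or n = 1 the bound is literally 0 since lg 1 = 0, and it fails for A = [1]. The time bound and the coloring output are stated for all m, n ≥ 1. *)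

(* Defs.v *)
From HB Require Import structures.
From mathcomp Require Import all_boot all_order all_algebra.
From mathcomp Require Import all_classical all_reals all_analysis.
Set Implicit Arguments.
Unset Strict Implicit.
Unset Printing Implicit Defensive.
Import Order.TTheory GRing.Theory Num.Theory.
Local Open Scope ring_scope.

Definition lg {R : realType} (x : R) : R := ln x / ln 2.

Definition linfty {R : realType} {m : nat} (v : 'cV[R]_m) : R :=
  \big[Num.max/0]_(i < m) `|v i 0|.

Definition coloring {R : realType} {n : nat} (b : {ffun 'I_n -> bool})
  : 'cV[R]_n := \col_j (-1) ^+ b j.

(* The seed of the iterated minimum is the value at one of the colorings. *)
Definition disc {R : realType} {m n : nat} (A : 'M[R]_(m, n)) : R :=
  \big[Num.min/linfty (A *m coloring [ffun=> false])]_(b : {ffun 'I_n -> bool})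
    linfty (A *m coloring b).

(* [S] is the set of columns that are kept. *)
Definition herdisc {R : realType} {m n : nat} (A : 'M[R]_(m, n)) : R :=
  \big[Num.max/0]_(S : {set 'I_n})
    disc (colsub (fun j : 'I_#|S| => enum_val j) A).

(* Model of computation: a randomized real RAM in structured form. It has a
   memory of machine words and a memory of real numbers, both randomly
   accessible at word addresses. Words are the integers below a bound [W],
   which is polynomial in the input dimensions (words of logarithmic length).
   Reals are exact; they support field operations, order tests and conversion
   from words, but no rounding and no conversion to words, and a program
   contains no real constant. The only source of randomness is fair coins. *)

Inductive wexp : Type :=
  | WLit of nat
  | WLoad of wexp
  | WAdd of wexp & wexp
  | WSub of wexp & wexp
  | WMul of wexp & wexp
  | WDiv of wexp & wexp.

Inductive rexp : Type :=
  | ROfWord of wexp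
  | RLoad of wexp
  | RAdd of rexp & rexp
  | RSub of rexp & rexp
  | RMul of rexp & rexp
  | RDiv of rexp & rexp.

Inductive test : Type :=
  | TWlt of wexp & wexp
  | TRlt of rexp & rexp
  | TNot of test
  | TAnd of test & test.

Inductive instr : Type :=
  | WStore of wexp & wexp (* address, value *)
  | RStore of wexp & rexp (* address, value *)
  | Flip of wexp          (* store a random bit at the address *)
  | If of test & seq instr & seq instr
  | While of test & seq instr.

Definition program : Type := seq instr.

Record state (R : realType) : Type :=
  State { words : nat -> nat; reals : nat -> R }.

Definition update {T : Type} (f : nat -> T) (a : nat) (v : T) : nat -> T :=
  fun a' => if a' == a then v else f a'.

(* Sums and products wrap around; subtraction is truncated at 0; a quotient by
   0 is 0. *)
Fixpoint weval {R : realType} (W : nat) (s : state R) (e : wexp) : nat :=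
  match e with
  | WLit k => (k %% W)%N
  | WLoad a => words s (weval W s a)
  | WAdd e1 e2 => ((weval W s e1 + weval W s e2) %% W)%N
  | WSub e1 e2 => (weval W s e1 - weval W s e2)%N
  | WMul e1 e2 => ((weval W s e1 * weval W s e2) %% W)%N
  | WDiv e1 e2 => (weval W s e1 %/ weval W s e2)%N
  end.

Fixpoint reval {R : realType} (W : nat) (s : state R) (e : rexp) : R :=
  match e with
  | ROfWord a => (weval W s a)%:R
  | RLoad a => reals s (weval W s a)
  | RAdd e1 e2 => reval W s e1 + reval W s e2
  | RSub e1 e2 => reval W s e1 - reval W s e2
  | RMul e1 e2 => reval W s e1 * reval W s e2
  | RDiv e1 e2 => reval W s e1 / reval W s e2
  end.

Fixpoint teval {R : realType} (W : nat) (s : state R) (t : test) : bool :=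
  match t with
  | TWlt e1 e2 => (weval W s e1 < weval W s e2)%N
  | TRlt e1 e2 => reval W s e1 < reval W s e2
  | TNot t1 => ~~ teval W s t1
  | TAnd t1 t2 => teval W s t1 && teval W s t2
  end.

(* What remains to be executed, and the memory. *)
Definition config (R : realType) : Type := (program * state R)%type.

(* Every step executes one assignment, one coin flip or one test, and is offered
   a fresh coin [c], which only [Flip] looks at. Expressions have a size bounded
   in terms of the program alone, so for a fixed program the number of steps is,
   up to a constant factor, the number of elementary operations. *)
Definition step {R : realType} (W : nat) (cf : config R) (c : bool)
  : config R :=
  let: (p, s) := cf in
  match p with
  | [::] => ([::], s)
  | WStore a e :: k =>
      (k, State (update (words s) (weval W s a) (weval W s e)) (reals s))
  | RStore a e :: k =>
      (k, State (words s) (update (reals s) (weval W s a) (reval W s e)))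
  | Flip a :: k =>
      (k, State (update (words s) (weval W s a) (nat_of_bool c)) (reals s))
  | If t p1 p2 :: k => ((if teval W s t then p1 else p2) ++ k, s)
  | While t p1 :: k => (if teval W s t then p1 ++ While t p1 :: k else k, s)
  end.

Definition run {R : realType} (W : nat) (cf : config R) (cs : seq bool)
  : config R := foldl (step W) cf cs.

Definition halted {R : realType} (cf : config R) : bool := nilp cf.1.

(* On the coins [cs] the running time is exactly [size cs]. *)
Definition halts_at {R : realType} (W : nat) (cf : config R) (cs : seq bool)
  : bool :=
  halted (run W cf cs) &&
  [forall k : 'I_(size cs), ~~ halted (run W cf (take k cs))].

(* The probability that the running time is [t]: this event is determined by
   the first [t] coins, which are uniformly distributed. *)
Definition time_prob {R : realType} (W : nat) (cf : config R) (t : nat) : R :=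
  #|[set cs : t.-tuple bool | halts_at W cf cs]|%:R / 2 ^+ t.

(* Infinite when the computation fails to halt with positive probability. *)
Definition expected_time {R : realType} (W : nat) (cf : config R) : \bar R :=
  if (\sum_(0 <= t <oo) (time_prob W cf t)%:E == 1)%E
  then (\sum_(0 <= t <oo) (t%:R * time_prob W cf t)%:E)%E
  else +oo%E.

(* [words] starts with the dimensions, [reals] with the entries of [A] in
   row-major order; all other cells are 0. *)
Definition input {R : realType} {m n : nat} (A : 'M[R]_(m, n)) : state R :=
  State (fun a => nth 0 [:: m; n] a)%N
        (fun a => match insub (a %/ n)%N, insub (a %% n)%N with
                  | Some i, Some j => A i j
                  | _, _ => 0
                  end).

(* The output is read from the first [n] real cells. *)
Definition output {R : realType} (n : nat) (s : state R) : 'cV[R]_n :=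
  \col_j reals s j.

(* Main.v *)
Require Import Defs.
From HB Require Import structures.
From mathcomp Require Import all_boot all_order all_algebra.
From mathcomp Require Import fingroup.perm.
From mathcomp Require Import all_classical all_reals all_analysis.
From mathcomp Require Import zify ring lra.
Set Implicit Arguments.
Unset Strict Implicit.
Unset Printing Implicit Defensive.
Import Order.TTheory GRing.Theory Num.Theory.
Local Open Scope ring_scope.

(* The algorithm is deterministic. In a phase with N active variables it sweeps
   out, N / 2 times, the row of A (restricted to the active columns) of largest
   residual norm. By Cauchy-Binet and the determinant lower bound for the
   hereditary discrepancy h, all residual norms are then at most 4 h. Next the
   fractional coloring walks inside the remaining subspace, always along the
   image of a unit vector, until some variable reaches 1 or -1 or a unit of time
   has passed; a variable that is hit is frozen. The direction is chosen so that
   the potential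

     sum_i (W+_i + W-_i) + beta * sum_p (1 - x_p^2)

   decreases, where W+ and W- are multiplied by 1 + z + z^2 and 1 - z + z^2,
   upper bounds for exp z and exp (- z), z being the scaled change of a row sum.
   On average over the directions the second-order part of the potential drops by
   the order of m / N, so O(N) steps freeze N / 4 variables, and the final bound
   4 m on the weights limits the change of every row sum to O(h ln m). The number
   of active variables shrinks by 3/4 in every phase.

   The determinant lower bound |det B| <= (2 h)^k is proved by counting: rounding
   binary digits one at a time shows that every residue class of Z^k modulo 2^r
   contains a z with |B z| <= 2^r h, and for an integer matrix these points,
   shifted by representatives of Z^k / B Z^k, are distinct points of a cube. Real
   matrices follow by approximation. *)

(** * Determinants and hereditary discrepancy *)

(** The machine has field operations and order tests but no [exp], no square root and no real-valued
    randomness. This shapes the walk: exponential weights become quadratic polynomials, which makes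
    the potential an exact quadratic in the step length; the scale is known only up to a factor 2; a
    random direction is replaced by averaging over the columns of a projector. Sweeping half of the
    variables balances two needs. Cauchy-Binet involves up to 2^N minors, a constant factor only
    after a root of order about N / 2. Yet the remaining subspace must keep dimension N / 2, of
    which freezing takes less than N / 4 while the walk runs, so that N / 4 directions are always
    available. Every change of subspace is a rank-one update of the matrix with blocks P and A P, of
    cost O((m + n) n). A phase makes O(N) of them, and as N shrinks geometrically the total is O((m
    + n) n^2), without any matrix multiplication. *)

Lemma det_mulmx_rowsub (R : comRingType) (k n : nat)
    (A : 'M[R]_(k, n)) (B : 'M[R]_(n, k)) :
  \det (A *m B) =
  \sum_(f : {ffun 'I_k -> 'I_n}) (\prod_i A i (f i)) * \det (rowsub f B).
Proof.
rewrite /determinant.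
under eq_bigr => s _.
  under eq_bigr => i _ do rewrite mxE.
  rewrite bigA_distr_bigA /= mulr_sumr.
  over.
rewrite exchange_big /=; apply: eq_bigr => f _; rewrite mulr_sumr.
apply: eq_bigr => s _; rewrite big_split /= mulrCA; congr (_ * (_ * _)).
by apply: eq_bigr => i _; rewrite mxE.
Qed.

(* Summing the expansion over all reorderings of the chosen columns turns the
   product of entries into a second determinant. *)
Lemma det_gram (R : comRingType) (k n : nat) (B : 'M[R]_(k, n)) :
  (k`!)%:R * \det (B *m B^T) =
  \sum_(f : {ffun 'I_k -> 'I_n}) \det (colsub f B) ^+ 2.
Proof.
have detE (f : {ffun 'I_k -> 'I_n}) :
    \det (rowsub f B^T) = \det (colsub f B).
  by rewrite -det_tr; congr (\det _); apply/matrixP => i j; rewrite !mxE.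
pose g (s : 'S_k) (f : {ffun 'I_k -> 'I_n}) := [ffun i => f (s i)].
have gE (s : 'S_k) : \det (B *m B^T) =
    \sum_(f : {ffun 'I_k -> 'I_n})
      (-1) ^+ s * (\prod_i B i (f (s i))) * \det (colsub f B).
  rewrite det_mulmx_rowsub (reindex (g s)) /=; last first.
    exists (g s^-1)%g => f _; apply/ffunP => i; rewrite !ffunE.
      by rewrite permKV.
    by rewrite permK.
  apply: eq_bigr => f _; rewrite detE.
  have -> : colsub (g s f) B = col_perm s (colsub f B).
    by apply/matrixP => i j; rewrite !mxE ffunE.
  rewrite col_permE det_mulmx det_perm odd_permV.
  under eq_bigr => i _ do rewrite ffunE.
  by rewrite mulrCA mulrC [X in X * _]mulrC.
have -> : (k`!)%:R = \sum_(s : 'S_k) 1 :> R.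
  rewrite sumr_const; congr (_%:R).
  rewrite -[k in LHS]card_ord -cardsT -card_perm; apply: eq_card => s.
  by rewrite unfold_in; apply/fintype.subsetP => i _; rewrite inE.
rewrite mulr_suml; under eq_bigr => s _ do rewrite mul1r (gE s).
rewrite exchange_big /=.
apply: eq_bigr => f _; rewrite -mulr_suml expr2; congr (_ * _).
by apply: eq_bigr => s _; congr (_ * _); apply: eq_bigr => i _; rewrite mxE.
Qed.

Lemma bin_le_exp2 (n k : nat) : ('C(n, k) <= 2 ^ n)%N.
Proof.
elim: n k => [|n IHn] [|k] //=; first by rewrite bin0 expn_gt0.
by rewrite binS expnS mul2n -addnn leq_add.
Qed.

(** A nonzero term needs an injective [f] with values in [T]: a column outside [T] vanishes and a
    repeated one kills the minor. There are C(#|T|, k) k! such [f]; the factorial cancels, and the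
    binomial is at most 2 ^ #|T|, which a later root of order k turns into a constant. *)
Lemma det_gram_le (R : realFieldType) (k n : nat) (B : 'M[R]_(k, n))
    (T : {set 'I_n}) (d : R) :
  (forall i j, j \notin T -> B i j = 0) ->
  (forall f : {ffun 'I_k -> 'I_n}, `|\det (colsub f B)| <= d) -> 0 <= d ->
  \det (B *m B^T) <= (2 ^ #|T|)%:R * d ^+ 2.
Proof.
move=> B0 Bd d0; rewrite -(@ler_pM2l _ (k`!)%:R) ?ltr0n ?fact_gt0// det_gram.
pose I := [set f : {ffun 'I_k -> 'I_n} in ffun_on (mem T) | injectiveb f].
rewrite (bigID (mem I)) /= [X in _ + X]big1 ?addr0; last first.
  move=> f; rewrite inE negb_and => /orP[fT | /injectivePn[i [j ij fij]]].
    have [i fiT] : exists i, f i \notin T.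
      apply/existsP; rewrite -negb_forall; apply: contra fT => /forallP fT.
      exact/ffun_onP.
    rewrite (expand_det_col _ i) big1 ?expr0n// => j _.
    by rewrite mxE B0 ?mul0r.
  rewrite -det_tr (determinant_alternate ij) ?expr0n// => l.
  by rewrite !mxE fij.
apply: (@le_trans _ _ (\sum_(f in I) d ^+ 2)).
  apply: ler_sum => f _; rewrite -(real_normK (num_real _)).
  by rewrite lerXn2r ?nnegrE.
rewrite sumr_const /I card_inj_ffuns_on /= card_ord -[leLHS]mulr_natl.
rewrite [leRHS](mulrA _ (2 ^ _)%:R) -natrM.
rewrite ler_wpM2r ?exprn_ge0// ler_nat -bin_ffact mulnC leq_mul2l.
by rewrite bin_le_exp2 orbT.
Qed.

(** Hereditary discrepancy at most [h], with deleted columns left out of the sums rather than out of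
    the matrix. No column is renumbered, so the passage to submatrices and to rounded matrices is
    direct. *)
Definition hereditarily_balanced (R : numDomainType) (m k : nat)
    (B : 'M[R]_(m, k)) (h : R) : Prop :=
  forall S : {set 'I_k}, exists b : 'I_k -> bool,
    forall i, `|\sum_(j in S) B i j * (-1) ^+ b j| <= h.

(* Rounding the binary digits of [z] from the least significant one upwards. *)
Lemma balanced_residue (R : numDomainType) (m k : nat) (B : 'M[R]_(m, k)) (h : R)
    (r : nat) (z : 'I_k -> int) : hereditarily_balanced B h ->
  exists2 z' : 'I_k -> int,
    forall j, exists q, z j = z' j + 2 ^+ r * q &
    forall i, `|\sum_j B i j * (z' j)%:~R| <= (2 ^+ r - 1) * h.
Proof.
move=> hB; elim: r z => [|r IHr] z.
  exists (fun=> 0) => [j|i]; first by exists (z j); rewrite add0r mul1r.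
  by rewrite subrr mul0r big1 ?normr0// => j _; rewrite mulr0.
(* A balanced sign vector makes the odd coordinates even, and the result is halved. Undoing this
   doubles the error of the higher digits and adds one balanced sum: 2 (2^r - 1) h + h = (2^(r+1) -
   1) h. *)
pose S := [set j | (z j %% 2)%Z == 1]; have [b hb] := hB S.
pose e j : int := if j \in S then (-1) ^+ b j else 0.
have [y' yP hy] := IHr (fun j => ((z j + e j) %/ 2)%Z).
exists (fun j => 2 * y' j - e j) => [j|i].
  have [q yE] := yP j; exists q.
  have : z j + e j = ((z j + e j) %/ 2)%Z * 2.
    by rewrite /e inE; case: eqP => ?; case: (b j); rewrite ?expr1 ?expr0; lia.
  by rewrite yE exprS; lia.
have -> : \sum_j B i j * (2 * y' j - e j)%:~R =
    2 * \sum_j B i j * (y' j)%:~R - \sum_(j in S) B i j * (-1) ^+ b j.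
  rewrite mulr_sumr [X in _ - X]big_mkcond -sumrB; apply: eq_bigr => j _.
  rewrite intrB intrM mulrBr mulrCA; congr (_ - _); rewrite /e.
  by case: ifP; rewrite ?mulr0// intr_sign.
rewrite (le_trans (ler_normB _ _))// normrM normr_nat.
have := lerD (ler_wpM2l (ler0n R 2) (hy i)) (hb i).
by rewrite exprS; congr (_ <= _); ring.
Qed.

Lemma normz_det_unit (k : nat) (L : 'M[int]_k) :
  L \in unitmx -> `|\det L|%N = 1%N.
Proof.
by rewrite unitmxE => /orP[]/eqP->.
Qed.

Lemma small_multiple (a b : nat) (e f : int) :
  (a < `|e|)%N -> (b < `|e|)%N -> e * f = a%:Z - b%:Z -> a = b.
Proof.
have [-> _ _|f0 ae be ef] := eqVneq f 0; first by lia.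
have : (`|e| <= `|(e * f)%R|)%N by rewrite abszM leq_pmulr ?absz_gt0.
by rewrite ef; lia.
Qed.

(* By the Smith normal form [B = L D U], the vectors [L t] with
   [0 <= t_i < |d_i|] are incongruent modulo the lattice spanned by [B]. *)
Lemma det_int_counting (k : nat) (B : 'M[int]_k) : exists c : nat,
  forall r M : nat,
    (forall z : 'I_k -> int, exists2 z' : 'I_k -> int,
       forall j, exists q, z j = z' j + 2 ^+ r * q &
       forall i, (`|(\sum_j B i j * z' j)%R| <= M)%N) ->
  ((2 ^ r) ^ k * `|\det B| <= (2 * (M + c) + 1) ^ k)%N.
Proof.
have [L uL [U uU [d _ BE]]] := int_Smith_normal_form B.
pose D : 'M[int]_k := \matrix_(i, j) (d`_i *+ (i == j :> nat)).
have detD : \det D = \prod_i d`_(nat_of_ord (i : 'I_k)).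
  rewrite (_ : D = diag_mx (\row_i d`_i)); last first.
    by apply/matrixP => i j; rewrite !mxE.
  by rewrite det_diag; apply: eq_bigr => i _; rewrite mxE.
have detB : `|\det B|%N = (\prod_(i < k) `|(d`_i)%R|)%N.
  rewrite BE !det_mulmx !abszM (normz_det_unit uL) (normz_det_unit uU) mul1n muln1 detD.
  by apply: (big_morph _ abszM).
pose T := {dffun forall i : 'I_k, 'I_(`|(d`_i)%R|%N)}.
pose Lt (t : T) i := \sum_j L i j * (t j : nat)%:Z.
(* A crude bound for all coordinates of all representatives suffices: it depends on [B] only, so it
   vanishes against 2^r in the limit. *)
exists (\sum_(t : T) \sum_i `|Lt t i|)%N => r M hM.
set c := (\sum_(t : T) \sum_i `|Lt t i|)%N.
have Ltc t i : (`|Lt t i| <= c)%N.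
  by rewrite /c (bigD1 t)//= (bigD1 i)//= -addnA leq_addr.
have [D0|D0] := eqVneq (\det B) 0; first by rewrite D0 muln0.
have [z' z'z z'M] := fin_all_exists2
  (fun z : {ffun 'I_k -> 'I_(2 ^ r)} => hM (fun j => (z j : nat)%:Z)).
(* There are 2^(r k) |det B| pairs of a residue class and a representative; their points lie in the
   cube of radius M + c. *)
pose pt (zt : {ffun 'I_k -> 'I_(2 ^ r)} * T) i :=
  \sum_j B i j * z' zt.1 j + Lt zt.2 i.
have ptM zt i : (`|pt zt i| <= M + c)%N.
  have := z'M zt.1 i; have := Ltc zt.2 i; rewrite /pt.
  by move: (\sum_j _) (Lt _ _) => a b; lia.
pose F zt : {ffun 'I_k -> 'I_(2 * (M + c)).+1} :=
  [ffun i => inord `|pt zt i + (M + c)%:Z|].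
have F_inj : injective F.
  move=> [z t] [y s] /ffunP eF.
  have {eF}ept i : pt (z, t) i = pt (y, s) i.
    have := ptM (z, t) i; have := ptM (y, s) i.
    have := congr1 val (eF i); rewrite !ffunE.
    move: (pt _ i) (pt _ i) => a b; rewrite /= => + ha hb.
    by rewrite !inordK//; lia.
  pose zc (z : {ffun 'I_k -> 'I_(2 ^ r)}) := \col_j z' z j : 'cV[int]_k.
  pose tc (t : T) := \col_j (t j : nat)%:Z : 'cV[int]_k.
  have ecol : B *m (zc z - zc y) = L *m (tc s - tc t).
    apply/colP => i; have := ept i; rewrite /pt /Lt /= !mxE.
    have sumB (K : 'M[int]_k) (f g : 'I_k -> int) :
        \sum_j K i j * (\col_l f l - \col_l g l) j 0 =
        \sum_j K i j * f j - \sum_j K i j * g j.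
      by rewrite -sumrB; apply: eq_bigr => j _; rewrite !mxE mulrBr.
    rewrite (sumB B) (sumB L) .
    move: (\sum_j _) (\sum_j _) (\sum_j _) (\sum_j _) => a b e f; lia.
  (* In these coordinates entry i says that d_i divides s_i - t_i, while both terms are below
     |d_i|. *)
  have edu : D *m (U *m (zc z - zc y)) = tc s - tc t.
    by rewrite -[RHS](mulKmx uL) -ecol BE !mulmxA mulVmx// mul1mx.
  have est : s = t.
    apply/ffunP => i; apply/val_inj => /=.
    have := congr1 (fun v : 'cV_k => v i 0) edu; rewrite /tc !mxE.
    rewrite (bigD1 i)//= big1 ?addr0 => [|j ji]; last first.
      by rewrite mxE val_eqE eq_sym (negPf ji) mulr0n mul0r.
    rewrite mxE eqxx mulr1n => e.
    exact: small_multiple (ltn_ord (s i)) (ltn_ord (t i)) e.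
  have ezy : zc z = zc y.
    apply/eqP; rewrite -subr_eq0; move: ecol; rewrite est subrr mulmx0.
    (* Over the integers the adjugate replaces the inverse: it cancels [B] up to the nonzero
       determinant. *)
    move/(congr1 (mulmx (\adj B))); rewrite mulmxA mul_adj_mx mulmx0.
    rewrite mul_scalar_mx => /eqP; rewrite scalemx_eq0 (negPf D0).
    by [].
  rewrite est; congr pair; apply/ffunP => j; apply/val_inj => /=.
  have [q zq] := z'z z j; have [p yp] := z'z y j.
  have := congr1 (fun v : 'cV_k => v j 0) ezy; rewrite !mxE => ez'.
  apply: (@small_multiple _ _ (2 ^+ r) (q - p)).
  - by rewrite abszX ltn_ord.
  - by rewrite abszX ltn_ord.
  - by rewrite mulrBr zq yp ez'; ring.
have := leq_card F F_inj.
rewrite card_prod !card_ffun !card_ord card_dep_ffun /= addn1.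
rewrite detB foldrE big_map big_enum /=.
by under eq_bigr => i _ do rewrite card_ord.
Qed.

(** * Limit arguments for the determinant lower bound *)

Section Limits.
Import numFieldNormedType.Exports.
Local Open Scope classical_set_scope.

Lemma cvg_affine_pow (R : realType) (b c : R) (k : nat) (u : R ^nat) :
  u @ \oo --> 0 -> (fun r => (b + c * u r) ^+ k) @ \oo --> b ^+ k.
Proof.
move=> u0; have -> : b ^+ k = (b + c * 0) ^+ k by rewrite mulr0 addr0.
apply: (@cvg_comp _ _ _ (fun r => b + c * u r) (fun x => x ^+ k)); last first.
  exact: exprn_continuous.
by apply: cvgD; [exact: cvg_cst | apply: cvgM => //; exact: cvg_cst].
Qed.

(** The counting bound applies with M the integer part of 2^r h. Division by 2^(r k) leaves (2 h +
    (2 c + 1) / 2^r)^k, and r tends to infinity. *)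
Lemma det_int_le (R : realType) (k : nat) (B : 'M[int]_k) (h : R) : 0 <= h ->
  hereditarily_balanced (map_mx intr B) h ->
  (`|\det B|%N)%:R <= (2 * h) ^+ k :> R.
Proof.
move=> h0 hB; have [c cP] := det_int_counting B.
have le_r r : (`|\det B|%N)%:R <=
    (2 * h + (2 * c%:R + 1) * (2 ^+ r)^-1) ^+ k :> R.
  have r2 : 0 < 2 ^+ r :> R by rewrite exprn_gt0.
  set M := Num.truncn (2 ^+ r * h).
  have ME : M%:R <= 2 ^+ r * h by rewrite truncn_le// mulr_ge0// ltW.
  rewrite -(@ler_pM2l _ ((2 ^+ r) ^+ k)) ?exprn_gt0// -exprMn.
  have -> : 2 ^+ r * (2 * h + (2 * c%:R + 1) / 2 ^+ r) =
      2 * (2 ^+ r * h + c%:R) + 1 :> R by field; rewrite lt0r_neq0.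
  apply: le_trans (_ : (2 * (M%:R + c%:R) + 1) ^+ k <= _); last first.
    by rewrite lerXn2r ?nnegrE ?lerD2r ?ler_pM2l ?lerD2r//;
      rewrite addr_ge0// mulr_ge0// addr_ge0// mulr_ge0// ltW.
  have := cP r M; rewrite -(ler_nat R) !(natrM, natrX, natrD).
  apply=> z; have [z' zz' hz'] := balanced_residue r z hB.
  exists z' => // i; have := hz' i.
  under eq_bigr => j _ do rewrite mxE -intrM.
  rewrite -rmorph_sum -intr_norm -natr_absz => {}hz'.
  rewrite truncn_ge_nat ?mulr_ge0 ?exprn_ge0//.
  by apply: le_trans hz' _; rewrite ler_wpM2r// gerBl.
have cv : (fun r => (2 ^+ r)^-1) @ \oo --> (0 : R).
  under eq_fun => r do rewrite -exprVn.
  by apply: cvg_expr; rewrite ger0_norm ?invr_ge0// invf_lt1 ?ltr1n.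
have {}cv := @cvg_affine_pow R (2 * h) (2 * c%:R + 1) k _ cv.
by apply: cvgr_to_ge cv _; exact: nearW.
Qed.

Lemma cvg_det (R : realType) (k : nat) (X : nat -> 'M[R]_k) (B : 'M[R]_k) :
  (forall i j, (fun N => X N i j) @ \oo --> B i j) ->
  (fun N => \det (X N)) @ \oo --> \det B.
Proof.
move=> XB; rewrite /determinant; apply: cvg_big => [|s _]; first exact: add_continuous.
apply: cvgM; first exact: cvg_cst.
by apply: cvg_big => [|i _]; [exact: mul_continuous | exact: XB].
Qed.

Lemma cvg_harmonic_floor (R : realType) (b : R) :
  (fun N : nat => N.+1%:R^-1 * (Num.floor (N.+1%:R * b))%:~R) @ \oo --> b.
Proof.
apply: (@squeeze_cvgr _ _ _ _ (fun N => b - N.+1%:R^-1) (fun=> b)); last first.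
- exact: cvg_cst.
- rewrite -[X in _ --> X]subr0; apply: cvgB; first exact: cvg_cst.
  exact: cvg_harmonic.
apply: nearW => N; have N0 : 0 < N.+1%:R :> R by rewrite ltr0n.
rewrite -(ler_pM2l N0) -[X in _ && X](ler_pM2l N0) !mulrA mulrBr divff ?lt0r_neq0//.
rewrite mul1r floor_le andbT; have := floorD1_gt (N.+1%:R * b).
by rewrite intrD lerBlDr => /ltW.
Qed.

(** Rounding (N + 1) B down costs at most 1 per column, hence [k] on top of (N + 1) h; after scaling
    back the error 2 k / (N + 1) vanishes in the limit. *)
Lemma det_balanced_le (R : realType) (k : nat) (B : 'M[R]_k) (h : R) : 0 <= h ->
  hereditarily_balanced B h -> `|\det B| <= (2 * h) ^+ k.
Proof.
move=> h0 hB; pose BN N := \matrix_(i, j) Num.floor (N.+1%:R * B i j) : 'M[int]_k.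
pose X N := N.+1%:R^-1 *: map_mx intr (BN N) : 'M[R]_k.
have le_N N : `|\det (X N)| <= (2 * h + 2 * k%:R * N.+1%:R^-1) ^+ k.
  have N0 : 0 < N.+1%:R :> R by rewrite ltr0n.
  have hBN : hereditarily_balanced (map_mx intr (BN N)) (N.+1%:R * h + k%:R).
    move=> S; have [b hb] := hB S; exists b => i.
    have -> : \sum_(j in S) (map_mx intr (BN N)) i j * (-1) ^+ b j =
        N.+1%:R * (\sum_(j in S) B i j * (-1) ^+ b j) +
        \sum_(j in S) ((Num.floor (N.+1%:R * B i j))%:~R - N.+1%:R * B i j) * (-1) ^+ b j.
      rewrite mulr_sumr -big_split; apply: eq_bigr => j _ /=.
      by rewrite !mxE; ring.
    apply: le_trans (ler_normD _ _) _; rewrite lerD// ?normrM.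
      by rewrite ger0_norm ?ler_wpM2l// ltW.
    apply: le_trans (ler_norm_sum _ _ _) _.
    apply: (@le_trans _ _ (\sum_(j in S) 1)); last first.
      by rewrite sumr_const ler_nat -[leqRHS]card_ord max_card.
    apply: ler_sum => j _; rewrite normrM normr_sign mulr1 distrC ger0_norm.
      by have := floorD1_gt (N.+1%:R * B i j); rewrite intrD lerBlDl => /ltW.
    by rewrite subr_ge0 floor_le.
  have := det_int_le (addr_ge0 (mulr_ge0 (ltW N0) h0) (ler0n _ k)) hBN.
  rewrite /X detZ normrM normrX normfV (ger0_norm (ltW N0)) det_map_mx.
  rewrite -intr_norm -natr_absz => hd.
  rewrite exprVn ler_pdivrMl ?exprn_gt0// -exprMn; congr (_ <= _ ^+ _): hd.
  by field; rewrite lt0r_neq0.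
have cv : (fun N => `|\det (X N)|) @ \oo --> `|\det B|.
  apply: cvg_norm; apply: cvg_det => i j.
  rewrite (_ : (fun N => _) = fun N => N.+1%:R^-1 * (Num.floor (N.+1%:R * B i j))%:~R).
    exact: cvg_harmonic_floor.
  by apply/funext => N; rewrite !mxE.
apply: ler_cvg_to cv (@cvg_affine_pow R (2 * h) (2 * k%:R) k _ (@cvg_harmonic R)) _.
exact: nearW.
Qed.

End Limits.

Lemma herdisc_ge0 (R : realType) (m n : nat) (A : 'M[R]_(m, n)) : 0 <= herdisc A.
Proof. exact: bigmax_ge_id. Qed.

Lemma ler_linfty (R : realType) (m : nat) (v : 'cV[R]_m) (i : 'I_m) :
  `|v i 0| <= linfty v.
Proof. exact: (le_bigmax _ (fun i => `|v i 0|)). Qed.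

Lemma linfty_le (R : realType) (m : nat) (v : 'cV[R]_m) (c : R) :
  0 <= c -> (forall i, `|v i 0| <= c) -> linfty v <= c.
Proof. by move=> c0 hv; apply: bigmax_le => // i _. Qed.

Lemma disc_witness (R : realType) (m n : nat) (A : 'M[R]_(m, n)) :
  exists b, linfty (A *m coloring b) = disc A.
Proof.
rewrite /disc; apply: (big_ind (fun d => exists b, linfty (A *m coloring b) = d)).
- by exists [ffun=> false].
- by move=> x y [b <-] [b' <-]; rewrite minEle; case: ifP; [exists b | exists b'].
- by move=> b _; exists b.
Qed.

Lemma herdisc_balanced (R : realType) (m n : nat) (A : 'M[R]_(m, n)) :
  hereditarily_balanced A (herdisc A).
Proof.
move=> S; have [b hb] := disc_witness (colsub (fun j : 'I_#|S| => enum_val j) A).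
have [S0|[j0 j0S]] := set_0Vmem S.
  by exists (fun=> false) => i; rewrite S0 big_set0 normr0 herdisc_ge0.
exists (fun j => b (enum_rank_in j0S j)) => i.
apply: le_trans (_ : disc (colsub (fun j : 'I_#|S| => enum_val j) A) <= _).
  rewrite -hb; apply: le_trans (ler_linfty _ i); rewrite mxE big_enum_val /=.
  rewrite le_eqVlt; apply/orP; left; apply/eqP; congr (`|_|).
  by apply: eq_bigr => j _; rewrite !mxE enum_valK_in.
exact: (le_bigmax _ (fun S : {set 'I_n} =>
  disc (colsub (fun j : 'I_#|S| => enum_val j) A))).
Qed.

Lemma hereditarily_balanced_sub (R : numDomainType) (m n k l : nat)
    (A : 'M[R]_(m, n)) (h : R) (f : 'I_k -> 'I_m) (g : 'I_l -> 'I_n) :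
  injective g -> hereditarily_balanced A h ->
  hereditarily_balanced (mxsub f g A) h.
Proof.
move=> g_inj hA S; have [b hb] := hA (g @: S); exists (b \o g) => i.
have := hb (f i); rewrite big_imset /=; last by move=> ? ? _ _; exact: g_inj.
by congr (`|_| <= _); apply: eq_bigr => j _; rewrite mxE.
Qed.

(** The determinant lower bound. A repeated column makes the determinant vanish; repeated rows are
    harmless, because balance is a condition on each row separately. *)
Lemma det_mxsub_le (R : realType) (m n k : nat) (A : 'M[R]_(m, n))
    (f : 'I_k -> 'I_m) (g : 'I_k -> 'I_n) :
  `|\det (mxsub f g A)| <= (2 * herdisc A) ^+ k.
Proof.
have [/injectiveP g_inj|/injectivePn[i [j ij gij]]] := boolP (injectiveb g).
  apply: det_balanced_le (herdisc_ge0 A) _.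
  exact: hereditarily_balanced_sub g_inj (herdisc_balanced A).
rewrite -det_tr (determinant_alternate ij) ?normr0 ?exprn_ge0 ?mulr_ge0//.
  exact: herdisc_ge0.
by move=> l; rewrite !mxE gij.
Qed.

(** * Projections and pivoting *)

Definition sqnorm (R : comRingType) (n : nat) (v : 'rV[R]_n) : R :=
  \sum_j v 0 j * v 0 j.

(** A Gram-Schmidt step: the component along row [q] is removed from every row, row [q] included. If
    that row is zero, the quotient by 0 is 0 and nothing changes. *)
Definition sweep (R : fieldType) (p n : nat) (G : 'M[R]_(p, n)) (q : 'I_p) :
    'M[R]_(p, n) :=
  \matrix_(i, j)
    (G i j - (\sum_l G i l * G q l) * G q j / (\sum_l G q l * G q l)).

Definition projector (R : comRingType) (n : nat) (P : 'M[R]_n) : Prop :=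
  P^T = P /\ P *m P = P.

(** For [v] in the range of the projector [P], this is the projector onto the part of that range
    orthogonal to [v]; with 0^-1 = 0 it is [P] itself when [v] is zero. *)
Definition downdate (R : fieldType) (n : nat) (P : 'M[R]_n) (v : 'rV[R]_n) :
    'M[R]_n :=
  P - (sqnorm v)^-1 *: (v^T *m v).

Section Projector.
Variables (R : realFieldType) (n : nat).
Implicit Types (P : 'M[R]_n) (v a : 'rV[R]_n).

Lemma sqnormE v : v *m v^T = (sqnorm v)%:M.
Proof.
rewrite [LHS]mx11_scalar mxE; congr (_%:M).
by apply: eq_bigr => j _; rewrite mxE.
Qed.

Lemma sqnorm_ge0 v : 0 <= sqnorm v.
Proof. by apply: sumr_ge0 => j _; rewrite -expr2 sqr_ge0. Qed.

Lemma sqnorm_eq0 v : sqnorm v = 0 -> v = 0.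
Proof.
move=> /eqP; rewrite psumr_eq0 => [/allP v0|j _]; last by rewrite -expr2 sqr_ge0.
apply/rowP => j; rewrite mxE; have := v0 j (mem_index_enum _).
by rewrite /= mulf_eq0 orbb => /eqP.
Qed.

Lemma sqr_le_sqnorm v j : v 0 j ^+ 2 <= sqnorm v.
Proof.
rewrite /sqnorm (bigD1 j)//= expr2 lerDl.
by apply: sumr_ge0 => l _; rewrite -expr2 sqr_ge0.
Qed.

(** True for the zero vector as well, so that its uses need no case distinction. *)
Lemma mul_sqnormV v : (sqnorm v)^-1 * sqnorm v *: v = v.
Proof.
have [/sqnorm_eq0->|v0] := eqVneq (sqnorm v) 0; first by rewrite scaler0.
by rewrite mulVf// scale1r.
Qed.

Lemma sqnorm_projector P a : projector P ->
  (sqnorm (a *m P))%:M = a *m P *m a^T.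
Proof.
by move=> [Ps PP]; rewrite -sqnormE trmx_mul Ps mulmxA -(mulmxA a) PP.
Qed.

Lemma mul_projector_tr P a : projector P -> P *m (a *m P)^T = (a *m P)^T.
Proof. by move=> [Ps PP]; rewrite trmx_mul Ps mulmxA PP. Qed.

Lemma downdate_projector P v : projector P -> v *m P = v ->
  projector (downdate P v).
Proof.
move=> [Ps PP] vP; rewrite /downdate; have Pv : P *m v^T = v^T.
  by rewrite -{1}Ps -trmx_mul vP.
split; first by rewrite linearB linearZ /= trmx_mul trmxK Ps.
set V := v^T *m v; have PV : P *m V = V by rewrite mulmxA Pv.
have VP : V *m P = V by rewrite -mulmxA vP.
have VV : ((sqnorm v)^-1 *: V) *m ((sqnorm v)^-1 *: V) = (sqnorm v)^-1 *: V.
  rewrite -scalemxAl -scalemxAr; congr (_ *: _).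
  rewrite /V -mulmxA (mulmxA v) sqnormE mul_scalar_mx -scalemxAr scalerA.
  by rewrite scalemxAr mul_sqnormV.
by rewrite mulmxBl !mulmxBr PP VV -scalemxAr PV -scalemxAl VP subrr subr0.
Qed.

Lemma downdate_trace P v : \tr P - 1 <= \tr (downdate P v).
Proof.
rewrite /downdate linearB linearZ /= mxtrace_mulC sqnormE mxtrace_scalar lerB//.
rewrite mulr1n; have [->|v0] := eqVneq (sqnorm v) 0; first by rewrite mulr0.
by rewrite mulVf.
Qed.

Lemma downdate_orthogonal P v : v *m P = v -> v *m downdate P v = 0.
Proof.
move=> vP; rewrite /downdate mulmxBr vP -scalemxAr mulmxA sqnormE mul_scalar_mx.
by rewrite scalerA mul_sqnormV subrr.
Qed.

Lemma downdate_annihilates P v a :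
  a *m P = 0 -> a *m v^T = 0 -> a *m downdate P v = 0.
Proof.
by move=> aP av; rewrite mulmxBr aP -scalemxAr mulmxA av mul0mx scaler0 subr0.
Qed.

Lemma downdate_sqnorm P v a : projector P -> v *m P = v ->
  sqnorm (a *m downdate P v) <= sqnorm (a *m P).
Proof.
move=> hP vP; have hP' := downdate_projector hP vP.
have := sqnorm_projector a hP; have := sqnorm_projector a hP'.
move=> /(congr1 (fun M : 'M[R]_(1, 1) => M 0 0)); rewrite mxE mulr1n => ->.
move=> /(congr1 (fun M : 'M[R]_(1, 1) => M 0 0)); rewrite mxE mulr1n => ->.
rewrite /downdate mulmxBr mulmxBl mxE gerDl mxE oppr_le0.
rewrite -scalemxAr -scalemxAl mxE mulr_ge0 ?invr_ge0 ?sqnorm_ge0//.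
rewrite (mulmxA a) -(mulmxA (a *m v^T)).
have -> : v *m a^T = (a *m v^T)^T by rewrite trmx_mul trmxK.
by rewrite (mx11_scalar (a *m v^T)) tr_scalar_mx -scalar_mxM mxE mulr1n -expr2 sqr_ge0.
Qed.

(** The link between program and proof: a sweep of the stored product is a downdate of the
    projector, so the product stays current without a matrix multiplication. *)
Lemma sweepE (p : nat) (M : 'M[R]_(p, n)) P (q : 'I_p) : projector P ->
  sweep (M *m P) q = M *m downdate P (row q (M *m P)).
Proof.
move=> hP; set G := M *m P; set v := row q G.
have -> : sweep G q = G - (sqnorm v)^-1 *: (G *m v^T *m v).
  apply/matrixP => i j; rewrite !mxE big_ord1 !mxE; congr (_ - _).
  rewrite mulrC /sqnorm; congr (_^-1 * (_ * _)).
    by apply: eq_bigr => l _; rewrite !mxE.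
  by apply: eq_bigr => l _; rewrite !mxE.
have Mv : G *m v^T = M *m v^T.
  by rewrite /v /G row_mul -mulmxA mul_projector_tr.
by rewrite Mv mulmxBr -scalemxAr mulmxA.
Qed.

(** The squared Frobenius norm is how the dimension of the subspace enters the average of [gain]. *)
Lemma trace_projector P : projector P -> \tr P = \sum_j \sum_i P i j * P i j.
Proof.
move=> [Ps PP]; rewrite -{1}PP /mxtrace; apply: eq_bigr => j _; rewrite mxE.
by apply: eq_bigr => i _; rewrite -{1}Ps mxE.
Qed.

End Projector.

Definition mask (R : comRingType) (n : nat) (T : {set 'I_n}) : 'M[R]_n :=
  diag_mx (\row_j (j \in T)%:R).

(* [G] is [P] on top of [A *m P] for a projector [P]: its rows are the images
   under [P] of the unit vectors and of the rows of [A]. *)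
Definition projected (R : comRingType) (m n : nat) (A : 'M[R]_(m, n))
    (P : 'M[R]_n) (G : 'M[R]_(n + m, n)) : Prop :=
  projector P /\ G = col_mx 1%:M A *m P.

(* [B] collects the [c] rows already swept out, restricted to the columns in
   [T]; [\det (B *m B^T)] is the square of the volume they span. *)
Definition pivoted (R : numFieldType) (m n : nat) (A : 'M[R]_(m, n))
    (T : {set 'I_n}) (c : nat) (G : 'M[R]_(n + m, n)) : Prop :=
  exists P, exists f : 'I_c -> 'I_m, exists Y : 'M[R]_(n, c),
    let B := rowsub f (A *m mask R T) in
    [/\ projected A P G, mask R T - P = Y *m B, B *m P = 0,
        (#|T|%:R <= \tr P + c%:R) &
        forall i, sqnorm (row (rshift n i) G) ^+ c <= \det (B *m B^T)].

Definition append_index (m c : nat) (f : 'I_c -> 'I_m) (q : 'I_m)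
    (i : 'I_(c + 1)) : 'I_m :=
  match fintype.split i with inl i => f i | inr _ => q end.

Lemma rowsub_append (R : Type) (m n c : nat) (M : 'M[R]_(m, n))
    (f : 'I_c -> 'I_m) (q : 'I_m) :
  rowsub (append_index f q) M = col_mx (rowsub f M) (row q M).
Proof.
apply/matrixP => i j; rewrite mxE /append_index [RHS]mxE.
by case: splitP => k _; rewrite !mxE.
Qed.

Section Pivot.
Variables (R : realType) (m n : nat) (A : 'M[R]_(m, n)) (T : {set 'I_n}).
Implicit Types (G : 'M[R]_(n + m, n)).
Let D := mask R T.

Lemma mask_projector : projector D.
Proof.
split; first by rewrite tr_diag_mx.
rewrite mulmx_diag; congr diag_mx; apply/rowP => j; rewrite !mxE.
by case: (j \in T); rewrite ?mulr1 ?mulr0.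
Qed.

Lemma mul_maskE (p : nat) (M : 'M[R]_(p, n)) i j :
  (M *m D) i j = M i j * (j \in T)%:R.
Proof. by rewrite mul_mx_diag !mxE. Qed.

Lemma trace_mask : \tr D = #|T|%:R.
Proof.
rewrite mxtrace_diag; under eq_bigr => j _ do rewrite mxE.
by rewrite -natr_sum -big_mkcond sum1_card.
Qed.

Lemma pivoted0 : pivoted A T 0 (col_mx 1%:M A *m D).
Proof.
have f : 'I_0 -> 'I_m by case.
exists D, f, 0.
split.
- by split=> //; exact: mask_projector.
- by rewrite subrr mul0mx.
- by apply/matrixP => [[]].
- by rewrite trace_mask addr0.
- by move=> i; rewrite expr0 det_mx00.
Qed.
(** The squared volume is multiplied by the squared distance of [b] from the row space of [B]: as D
    - P = Y B, the vectors [b] and [b P] differ by a combination of rows of [B], which a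
    unitriangular factor absorbs. *)
Lemma det_gram_col_mx (c : nat) (B : 'M[R]_(c, n)) (b : 'rV[R]_n) (P : 'M[R]_n)
    (Y : 'M[R]_(n, c)) : projector P -> b *m D = b -> D - P = Y *m B ->
  B *m P = 0 ->
  \det (col_mx B b *m (col_mx B b)^T) = \det (B *m B^T) * sqnorm (b *m P).
Proof.
move=> [Ps PP] bD DP BP.
have -> : col_mx B b = block_mx 1%:M 0 (b *m Y) 1%:M *m col_mx B (b *m P).
  rewrite mul_block_col !mul1mx mul0mx addr0 -mulmxA -DP mulmxBr bD.
  by rewrite subrK.
rewrite trmx_mul mulmxA -(mulmxA (block_mx _ _ _ _)) !det_mulmx det_tr.
rewrite det_lblock !det1 !mul1r mulr1 tr_col_mx mul_col_row.
have -> : B *m (b *m P)^T = 0 by rewrite trmx_mul Ps mulmxA BP mul0mx.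
by rewrite det_lblock sqnormE det_scalar1.
Qed.

Lemma row_projectedE (P : 'M[R]_n) (i : 'I_m) :
  row (rshift n i) (col_mx 1%:M A *m P) = row i A *m P.
Proof. by rewrite row_mul rowKd. Qed.

Lemma mul_mask_sub (c : nat) (B : 'M[R]_(c, n)) (P : 'M[R]_n) Y :
  projector P -> D - P = Y *m B -> B *m P = 0 -> D *m P = P.
Proof.
move=> [_ PP] DP BP; apply/eqP; rewrite -subr_eq0 -{2}PP -mulmxBl DP -mulmxA.
by rewrite BP mulmx0.
Qed.

(** Downdates shrink all residual norms, so pivots never increase. The squared volume, being their
    product, therefore dominates the corresponding power of every remaining residual norm. *)
Lemma pivoted_sweep (c : nat) G (q : 'I_m) : pivoted A T c G ->
  (forall i, sqnorm (row (rshift n i) G) <= sqnorm (row (rshift n q) G)) ->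
  pivoted A T (c + 1) (sweep G (rshift n q)).
Proof.
move=> [P [f [Y [[hP ->] DP BP trP rho_le]]]] q_max.
set B := rowsub f _ in DP BP rho_le; pose b := row q (A *m D).
have DPP := mul_mask_sub hP DP BP.
have bD : b *m D = b by rewrite /b -row_mul -mulmxA mask_projector.2.
have bP : b *m P = row q A *m P by rewrite /b row_mul -mulmxA DPP.
set v := row q A *m P in bP; have vP : v *m P = v by rewrite -mulmxA hP.2.
(* Since v = b P = b - b Y B, the difference D - downdate P v is Y B + |v|^-2 v^T (b - b Y B); its
   coefficients of [B] and of [b] are the two blocks. *)
exists (downdate P v), (append_index f q), (row_mx (Y - (sqnorm v)^-1 *: (v^T *m b *m Y))
                                   ((sqnorm v)^-1 *: v^T)).
rewrite rowsub_append -/b -/B; have GE := row_projectedE P; split.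
- split; first exact: downdate_projector.
  by rewrite sweepE// GE.
- rewrite mul_row_col mulmxBl -DP -!scalemxAl -(mulmxA (v^T *m b)) -DP.
  rewrite -(mulmxA v^T) mulmxBr bD bP mulmxBr scalerBr /downdate.
  move: (_ *: _) (_ *: _) => x y; apply/matrixP => i j; rewrite !mxE; ring.
- have BP' : B *m downdate P v = 0.
    apply/row_matrixP => i; rewrite row_mul row0 downdate_annihilates//.
      by rewrite -row_mul BP row0.
    by rewrite -row_mul -bP trmx_mul hP.1 mulmxA BP mul0mx row0.
  have bP0 : b *m downdate P v = 0.
    have -> : b *m downdate P v = v *m downdate P v.
      rewrite /downdate !mulmxBr bP vP; congr (_ - _).
      rewrite -!scalemxAr !mulmxA; congr (_ *: (_ *m _)).
      by rewrite -{1}vP trmx_mul hP.1 mulmxA bP.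
    exact: downdate_orthogonal.
  by rewrite mul_col_mx BP' bP0 col_mx0.
- rewrite (le_trans trP)// natrD addrA addrAC lerD2r -lerBlDr.
  exact: downdate_trace.
- move=> i; rewrite (det_gram_col_mx hP bD DP BP) bP sweepE// GE.
  rewrite row_projectedE -/v addn1 exprSr.
  have le_i : sqnorm (row i A *m downdate P v) <= sqnorm v.
    apply: le_trans (downdate_sqnorm _ hP vP) _.
    by have := q_max i; rewrite !row_projectedE.
  rewrite ler_pM ?exprn_ge0 ?sqnorm_ge0//.
  apply: le_trans (rho_le q); rewrite GE.
  by rewrite lerXn2r ?nnegrE ?sqnorm_ge0.
Qed.

(** With the largest row appended to the [c] pivots, its squared residual norm to the power c + 1 is
    at most 2 ^ #|T| (2 h)^(2 (c + 1)). As #|T| <= 2 (c + 1), the root of order c + 1 is at most 4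
    (2 h)^2 = (4 h)^2. *)
Lemma pivoted_bound (c : nat) G (q : 'I_m) : pivoted A T c G ->
  (forall i, sqnorm (row (rshift n i) G) <= sqnorm (row (rshift n q) G)) ->
  (#|T| <= 2 * c.+1)%N ->
  sqnorm (row (rshift n q) G) <= (4 * herdisc A) ^+ 2.
Proof.
move=> hG q_max Tc; set h := herdisc A; have h0 : 0 <= h by exact: herdisc_ge0.
have [P [f [Y [[hP GE] DP BP _ rho_le]]]] := hG.
set B := rowsub f _ in DP BP rho_le; pose b := row q (A *m D).
have DPP := mul_mask_sub hP DP BP.
have bD : b *m D = b by rewrite /b -row_mul -mulmxA mask_projector.2.
have bP : b *m P = row (rshift n q) G.
  by rewrite GE row_projectedE /b row_mul -mulmxA DPP.
have := det_gram_le (B := col_mx B b) (T := T) (d := (2 * h) ^+ (c + 1)).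
rewrite (det_gram_col_mx hP bD DP BP) bP => bound.
set rho := sqnorm _ in bound q_max *.
have rho0 : 0 <= rho by exact: sqnorm_ge0.
rewrite -(@ler_pXn2r _ c.+1) ?nnegrE ?exprn_ge0 ?mulr_ge0//.
apply: (@le_trans _ _ ((2 ^ #|T|)%:R * ((2 * h) ^+ (c + 1)) ^+ 2)).
  rewrite exprSr; apply: le_trans (bound _ _ _).
  - by rewrite ler_wpM2r// rho_le.
  - move=> i j jT; rewrite -rowsub_append !mxE big1// => l _; rewrite !mxE.
    by have [->|_] := eqVneq l j; rewrite ?(negPf jT) ?mulr0n ?mul0rn mulr0.
  - move=> g; rewrite -rowsub_append.
    have [gT|/existsP[j gj]] := boolP [forall j, g j \in T].
      apply: le_trans (det_mxsub_le A (append_index f q) g).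
      rewrite le_eqVlt; apply/orP; left; apply/eqP; congr (`|\det _|).
      by apply/matrixP => i j; rewrite [LHS]mxE [LHS]mxE mul_maskE [RHS]mxE (forallP gT) mulr1.
    rewrite (expand_det_col _ j) big1 ?normr0 ?exprn_ge0 ?mulr_ge0// => i _.
    by rewrite mxE mxE mul_maskE (negPf gj) mulr0 mul0r.
  - by rewrite exprn_ge0// mulr_ge0.
have -> : ((4 * h) ^+ 2) ^+ c.+1 = (2 ^ (2 * c.+1))%:R * ((2 * h) ^+ (c + 1)) ^+ 2.
  have -> : ((2 * h) ^+ (c + 1)) ^+ 2 = ((2 * h) ^+ 2) ^+ c.+1.
    by rewrite addn1 -!exprM mulnC.
  by rewrite natrX exprM -exprMn; congr (_ ^+ _); ring.
by rewrite ler_wpM2r ?exprn_ge0 ?mulr_ge0// ler_nat leq_exp2l.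
Qed.
End Pivot.

(** * The deterministic walk *)

(** From exp (- z / 2) >= 1 - z / 2 follows exp z <= (1 - z / 2)^-2, and (1 + z + z^2) (1 - z / 2)^2
    - 1 = z^2 (1 - 3 z + z^2) / 4 is nonnegative for small [z]. *)
Lemma expR_le_quadratic (R : realType) (z : R) : `|z| <= 1 / 8 ->
  expR z <= 1 + z + z * z.
Proof.
rewrite ler_norml => /andP[z_ge z_le].
have e2 : expR z = (expR (- (z / 2)))^-1 * (expR (- (z / 2)))^-1.
  by rewrite -expRN opprK -expRD; congr expR; field.
have e1 : 1 - z / 2 <= expR (- (z / 2)) by rewrite expR_ge1Dx.
have z2 : 0 < 1 - z / 2 by lra.
have e0 := expR_gt0 (- (z / 2)).
apply: (@le_trans _ _ ((1 - z / 2)^-1 * (1 - z / 2)^-1)).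
  by rewrite e2 ler_pM ?invr_ge0 ?lef_pV2 ?posrE// ltW.
rewrite -invfM -div1r ler_pdivrMr ?mulr_gt0//.
have : 0 <= z ^+ 2 by rewrite sqr_ge0.
nra.
Qed.

Section Walk.
Variables (R : realType) (m n : nat) (A : 'M[R]_(m, n)) (T : {set 'I_n}).
Variables (s : R) (x0 : 'I_n -> R).
Implicit Types (G : 'M[R]_(n + m, n)) (x : 'I_n -> R) (Wp Wm : 'I_m -> R).

(** Balances the potential: beta #|T| = 2 m is the initial sum of the weights, so neither part
    starts above 2 m. *)
Definition beta : R := m%:R * 2 / #|T|%:R.

Definition potential x Wp Wm : R :=
  \sum_i (Wp i + Wm i) + beta * \sum_p (1 - x p ^+ 2).

(** Minus the coefficient of t^2 in the potential along column [j]; [slope] is the coefficient of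
    t. *)
Definition gain Wp Wm G (j : 'I_n) : R :=
  \sum_p beta * (G (lshift m p) j * G (lshift m p) j) -
  \sum_i (Wp i + Wm i) *
    (G (rshift n i) j / (8 * s) * (G (rshift n i) j / (8 * s))).

Definition slope x Wp Wm G (j : 'I_n) : R :=
  \sum_i (Wp i - Wm i) * (G (rshift n i) j / (8 * s)) -
  \sum_p 2 * beta * x p * G (lshift m p) j.

(* [F] is the set of variables frozen so far in the current phase. *)
Definition walking (f : nat) x Wp Wm G : Prop :=
  exists P, exists F : {set 'I_n},
  [/\ projected A P G, #|F| = f /\ F \subset T,
      (forall j, `|x j| <= 1) /\
      (forall j, (j \notin T) || (j \in F) -> `|x j| = 1 /\ forall i, P i j = 0),
      #|T|%:R <= \tr P + (#|T| %/ 2)%:R + f%:R &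
      (forall i, sqnorm (row (rshift n i) G) <= s ^+ 2) /\
      forall i, exists y, [/\ expR y <= Wp i, expR (- y) <= Wm i &
        \sum_j A i j * (x j - x0 j) = 8 * s * y]].

(** The maximum is at least the average over [T]; columns outside [T] contribute nothing. The gains
    sum to at least beta tr P - 4 m / 64, and tr P >= #|T| / 4 makes this m / 2 - m / 16 = 7 m /
    16. *)
Lemma gain_max f x Wp Wm G (j : 'I_n) :
  walking f x Wp Wm G -> (4 * f < #|T|)%N ->
  potential x Wp Wm <= 4 * m%:R ->
  (forall j', gain Wp Wm G j' <= gain Wp Wm G j) ->
  7 * m%:R / (16 * #|T|%:R) <= gain Wp Wm G j.
Proof.
move=> [P [F [[hP GE] [Ff FT] [x1 frozen] trP [rho_le hW]]]] fT Psi4 j_max.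
have W0 i : 0 <= Wp i + Wm i.
  have [y [y1 y2 _]] := hW i.
  by rewrite addr_ge0//; [apply: le_trans y1|apply: le_trans y2]; exact: expR_ge0.
have T0 : 0 < #|T|%:R :> R by rewrite ltr0n; apply: leq_ltn_trans fT.
have beta0 : 0 <= beta by rewrite divr_ge0 ?mulr_ge0.
have PhiM : \sum_i (Wp i + Wm i) <= 4 * m%:R.
  apply: le_trans Psi4; rewrite lerDl mulr_ge0// sumr_ge0// => p _.
  by rewrite subr_ge0 -real_normK ?num_real// expr_le1// x1.
have GtopE p j' : G (lshift m p) j' = P p j'.
  by rewrite GE mul_col_mx mul1mx col_mxEu.
have GbotE i j' : G (rshift n i) j' = (A *m P) i j'.
  by rewrite GE mul_col_mx mul1mx col_mxEd.
have gain0 j' : j' \notin T -> gain Wp Wm G j' = 0.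
  move=> j'T; have [_ P0] : `|x j'| = 1 /\ forall i, P i j' = 0.
    by apply: frozen; rewrite j'T.
  rewrite /gain !big1 ?subrr// => i _; last by rewrite GtopE P0; ring.
  by rewrite GbotE mxE big1 ?mul0r ?mulr0// => l _; rewrite P0 mulr0.
have sum_le : \sum_j' gain Wp Wm G j' <= #|T|%:R * gain Wp Wm G j.
  rewrite (bigID (mem T)) /= [X in _ + X]big1 ?addr0//.
  rewrite -sum1_card natr_sum mulr_suml; apply: ler_sum => j' _.
  by rewrite mul1r.
have sum_ge : beta * \tr P - \sum_i (Wp i + Wm i) / 64 <= \sum_j' gain Wp Wm G j'.
  rewrite /gain sumrB; apply: lerB.
    rewrite (trace_projector hP) mulr_sumr; apply: ler_sum => j' _.
    by rewrite mulr_sumr; apply: ler_sum => p _; rewrite GtopE.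
  rewrite exchange_big; apply: ler_sum => i _ /=; rewrite -mulr_sumr ler_wpM2l//.
  have -> : \sum_j' G (rshift n i) j' / (8 * s) * (G (rshift n i) j' / (8 * s)) =
      sqnorm (row (rshift n i) G) / (8 * s) ^+ 2.
    by rewrite mulr_suml; apply: eq_bigr => l _; rewrite !mxE mulrACA -invfM.
  have [->|s0] := eqVneq s 0; first by rewrite mulr0 expr0n invr0 mulr0.
  rewrite ler_pdivrMr ?exprn_even_gt0 ?mulf_neq0//.
  by apply: le_trans (rho_le i) _; rewrite exprMn; lra.
have trT : #|T|%:R / 4 <= \tr P.
  have := trP; have : (#|T| %/ 2)%:R <= #|T|%:R / 2 :> R.
    by rewrite ler_pdivlMr// -natrM ler_nat leq_trunc_div.
  have : f%:R <= #|T|%:R / 4 :> R.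
    by rewrite ler_pdivlMr// -natrM ler_nat mulnC ltnW.
  lra.
rewrite invfM mulrA ler_pdivrMr// [leRHS]mulrC; apply: le_trans sum_le.
apply: le_trans sum_ge; have : m%:R / 2 <= beta * \tr P.
  have -> : m%:R / 2 = beta * (#|T|%:R / 4) by rewrite /beta; field; rewrite lt0r_neq0.
  by rewrite ler_wpM2l.
rewrite -mulr_suml; lra.
Qed.

(** An identity and not a Taylor estimate, because the weights are multiplied by quadratic
    polynomials. *)
Lemma potential_step x Wp Wm G (j : 'I_n) (t sg : R) : sg * sg = 1 ->
  let z i := t * (sg * G (rshift n i) j) / (8 * s) in
  potential (fun p => x p + t * (sg * G (lshift m p) j))
    (fun i => Wp i * (1 + z i + z i * z i)) (fun i => Wm i * (1 - z i + z i * z i)) =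
  potential x Wp Wm + t * (sg * slope x Wp Wm G j) - t * t * gain Wp Wm G j.
Proof.
move=> sg2 z; rewrite /potential /slope /gain.
have -> : \sum_i (Wp i * (1 + z i + z i * z i) + Wm i * (1 - z i + z i * z i)) =
    \sum_i (Wp i + Wm i) +
    t * (sg * \sum_i (Wp i - Wm i) * (G (rshift n i) j / (8 * s))) +
    t * t * (sg * sg) * \sum_i (Wp i + Wm i) *
      (G (rshift n i) j / (8 * s) * (G (rshift n i) j / (8 * s))).
  by rewrite !mulr_sumr -!big_split; apply: eq_bigr => i _ /=; rewrite /z; ring.
have -> : \sum_p (1 - (x p + t * (sg * G (lshift m p) j)) ^+ 2) =
    \sum_p (1 - x p ^+ 2) - t * (sg * \sum_p 2 * x p * G (lshift m p) j) -
    t * t * (sg * sg) * \sum_p G (lshift m p) j * G (lshift m p) j.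
  by rewrite !mulr_sumr -!sumrB; apply: eq_bigr => p _ /=; ring.
have -> : \sum_p 2 * beta * x p * G (lshift m p) j =
    beta * \sum_p 2 * x p * G (lshift m p) j.
  by rewrite mulr_sumr; apply: eq_bigr => p _; ring.
by rewrite -mulr_sumr sg2; ring.
Qed.

Lemma row_top (P : 'M[R]_n) (h : 'I_n) :
  row (lshift m h) (col_mx 1%:M A *m P) = row h P.
Proof. by rewrite mul_col_mx mul1mx rowKu. Qed.

(** For a projector the squared norm of row [h] is the entry P h h, so the rank-one correction
    cancels column [h] exactly; columns that are already zero stay zero. *)
Lemma downdate_frozen (P : 'M[R]_n) (h i l : 'I_n) : projector P ->
  (l = h) \/ (forall i', P i' l = 0) -> downdate P (row h P) i l = 0.
Proof.
move=> hP [->|P0]; last first.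
  by rewrite /downdate !mxE P0 big_ord1 !mxE P0 mulr0 mulr0 subr0.
have [Ps PP] := hP.
have vE : sqnorm (row h P) = P h h.
  have /matrixP/(_ h h) := PP; rewrite mxE => <-; apply: eq_bigr => l' _.
  by rewrite !mxE -[in X in _ = _ * X]Ps mxE.
have -> : downdate P (row h P) i h = downdate P (row h P) h i.
  have vP : row h P *m P = row h P by rewrite -row_mul PP.
  by rewrite -[in RHS](downdate_projector hP vP).1 [RHS]mxE.
have /rowP/(_ i) := mul_sqnormV (row h P).
by rewrite !mxE big_ord1 !mxE vE -mulrA => ->; rewrite subrr.
Qed.

Lemma walk_step f x Wp Wm G (j : 'I_n) (t sg : R) (o : option 'I_n) :
  walking f x Wp Wm G -> (4 * f < #|T|)%N ->
  potential x Wp Wm <= 4 * m%:R ->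
  (forall j', gain Wp Wm G j' <= gain Wp Wm G j) ->
  sg * sg = 1 -> sg * slope x Wp Wm G j <= 0 ->
  0 <= t <= 1 ->
  let x' p := x p + t * (sg * G (lshift m p) j) in
  let z i := t * (sg * G (rshift n i) j) / (8 * s) in
  let Wp' i := Wp i * (1 + z i + z i * z i) in
  let Wm' i := Wm i * (1 - z i + z i * z i) in
  (forall p, `|x' p| <= 1) ->
  (forall h, o = Some h -> sg * G (lshift m h) j != 0 /\ `|x' h| = 1) ->
  walking (f + isSome o) x' Wp' Wm'
    (if o is Some h then sweep G (lshift m h) else G) /\
  potential x' Wp' Wm' <= potential x Wp Wm - t * t * (7 * m%:R / (16 * #|T|%:R)).
Proof.
move=> hw fT Psi4 j_max sg2 sgL /andP[t0 t1] x' z Wp' Wm' x'1 oP.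
split; last first.
  rewrite potential_step//.
  have := gain_max hw fT Psi4 j_max; move: (gain _ _ _ _) (_ / _) => g e ge.
  have := mulr_ge0_le0 t0 sgL; have := ler_wpM2l (mulr_ge0 t0 t0) ge; lra.
move: hw => [P [F [[hP GE] [Ff FT] [x1 frozen] trP [rho_le hW]]]].
have [Ps PP] := hP.
have GtopE p j' : G (lshift m p) j' = P p j'.
  by rewrite GE mul_col_mx mul1mx col_mxEu.
have GbotE i j' : G (rshift n i) j' = (A *m P) i j'.
  by rewrite GE mul_col_mx mul1mx col_mxEd.
have P_sym a b : P a b = P b a by rewrite -{1}Ps mxE.
have x'_frozen l : (l \notin T) || (l \in F) -> `|x' l| = 1 /\ forall i, P i l = 0.
  move=> /frozen[xl P0]; split=> //.
  by rewrite /x' GtopE P_sym P0 !mulr0 addr0.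
have sg1 : `|sg| = 1.
  by apply/eqP; rewrite -(@eqrXn2 _ 2)// expr1n expr2 -normrM sg2 normr1.
have hW' i : exists y, [/\ expR y <= Wp' i, expR (- y) <= Wm' i &
    \sum_l A i l * (x' l - x0 l) = 8 * s * y].
  have [y [y1 y2 y3]] := hW i; exists (y + z i).
  (* The cap t <= 1 and |G i j| <= |s| keep the scaled change in the range of [expR_le_quadratic];
     this is the purpose of the 8 in the scale. *)
  have z8 : `|z i| <= 1 / 8.
    rewrite /z 3!normrM sg1 mul1r (ger0_norm t0).
    have : `|G (rshift n i) j| <= `|s|.
      rewrite -(@ler_pXn2r _ 2) ?nnegrE// !real_normK ?num_real//.
      apply: le_trans (rho_le i); have := sqr_le_sqnorm (row (rshift n i) G) j.
      by rewrite mxE.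
    have [->|s0] := eqVneq s 0; first by rewrite mulr0 invr0 normr0 mulr0; lra.
    rewrite normfV normrM normr_nat ler_pdivrMr ?mulr_gt0 ?normr_gt0// => Gs.
    have := ler_pM t0 (normr_ge0 _) t1 Gs; lra.
  split.
  - rewrite expRD ler_pM ?expR_ge0//; exact: expR_le_quadratic.
  - rewrite opprD expRD ler_pM ?expR_ge0//.
    have -> : 1 - z i + z i * z i = 1 + (- z i) + (- z i) * (- z i) by ring.
    by apply: expR_le_quadratic; rewrite normrN.
  - rewrite mulrDr -y3 /x'.
    (* If s = 0, the row has norm 0 and both sides vanish. *)
    have -> : 8 * s * z i = t * (sg * G (rshift n i) j).
      rewrite /z; have [s0|s0] := eqVneq s 0; last by field.
      have /sqnorm_eq0/rowP/(_ j) : sqnorm (row (rshift n i) G) = 0.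
        by apply/eqP; rewrite eq_le sqnorm_ge0 andbT -[leRHS](expr0n _ 2) -s0.
      by rewrite s0 !mxE => ->; rewrite !(mulr0, mul0r).
    rewrite GbotE mxE !mulr_sumr -big_split; apply: eq_bigr => l _ /=.
    by rewrite GtopE; ring.
case: o oP => [h|] oP; last first.
  by exists P, F; rewrite addn0.
have [vh x'h] := oP h erefl.
have Phj : P h j != 0 by move: vh; rewrite GtopE mulf_eq0 negb_or => /andP[].
(* A frozen variable has a zero column in [P], so a variable that moves along column [j] is not yet
   frozen. *)
have /norP[/negPn hT hF] : ~~ ((h \notin T) || (h \in F)).
  by apply/negP => /frozen[_ P0]; move: Phj; rewrite P_sym P0 eqxx.
have vP : row h P *m P = row h P by rewrite -row_mul PP.
exists (downdate P (row h P)), (h |: F); split.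
- split; first exact: downdate_projector.
  by rewrite GE sweepE// row_top.
- by rewrite cardsU1 hF Ff addnC; split=> //; rewrite finset.subUset finset.sub1set hT.
- split=> // l; rewrite in_setU1 orbCA => /predU1P[->|lTF].
    by split=> // i; apply: downdate_frozen => //; left.
  have [xl P0] := x'_frozen l lTF; split=> // i.
  by apply: downdate_frozen => //; right.
- by have := downdate_trace P (row h P); rewrite addn1 -natr1; lra.
- split=> // i; rewrite GE sweepE// row_top row_projectedE.
  apply: le_trans (rho_le i); rewrite GE row_projectedE.
  exact: downdate_sqnorm.
Qed.

Lemma potential_ge0 f x Wp Wm G : walking f x Wp Wm G ->
  [/\ forall i, 0 <= Wp i, forall i, 0 <= Wm i & 0 <= beta * \sum_p (1 - x p ^+ 2)].
Proof.
move=> [P [F [_ _ [x1 _] _ [_ hW]]]]; split.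
- by move=> i; have [y [y1 _ _]] := hW i; apply: le_trans y1; exact: expR_ge0.
- by move=> i; have [y [_ y1 _]] := hW i; apply: le_trans y1; exact: expR_ge0.
- rewrite mulr_ge0 ?divr_ge0 ?mulr_ge0// sumr_ge0// => p _.
  by rewrite subr_ge0 -real_normK ?num_real// expr_le1// x1.
Qed.

(** Both exp y and exp (- y) are bounded by a single weight, hence by the potential, so |y| <= ln (4
    m). *)
Lemma walking_disc f x Wp Wm G i : walking f x Wp Wm G -> 0 <= s -> (0 < m)%N ->
  potential x Wp Wm <= 4 * m%:R ->
  `|\sum_j A i j * (x j - x0 j)| <= 8 * s * ln (4 * m%:R).
Proof.
move=> hw s0 m0 Psi4; have [Wp0 Wm0 x_ge0] := potential_ge0 hw.
have m4 : 0 < 4 * m%:R :> R by rewrite mulr_gt0 ?ltr0n.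
have [P [F [_ _ _ _ [_ hW]]]] := hw; have [y [y1 y2 ->]] := hW i.
have W_le : Wp i + Wm i <= 4 * m%:R.
  apply: le_trans Psi4; apply: le_trans (_ : \sum_i (Wp i + Wm i) <= _); last first.
    by rewrite lerDl.
  by rewrite (bigD1 i)//= lerDl sumr_ge0// => l _; rewrite addr_ge0.
rewrite normrM ger0_norm ?mulr_ge0// ler_wpM2l ?mulr_ge0//.
rewrite ler_norml lerNl -(ler_expR (- y)) -(ler_expR y) lnK ?posrE//; apply/andP; split.
  by have := Wp0 i; lra.
by have := Wm0 i; lra.
Qed.

Lemma walking_active f x Wp Wm G : walking f x Wp Wm G ->
  (#|[set j | (x j * x j < 1)%R]| + f <= #|T|)%N.
Proof.
move=> [P [F [_ [<- FT] [_ frozen] _ _]]].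
have -> : #|T| = (#|T :\: F| + #|F|)%N.
  by rewrite -(cardsID F T) addnC (finset.setIidPr FT).
rewrite leq_add2r subset_leq_card//; apply/fintype.subsetP => j.
rewrite !inE => xj; apply: contraLR xj; rewrite negb_and negbK orbC => /frozen[xj _].
by rewrite -expr2 -real_normK ?num_real// xj expr1n ltxx.
Qed.

Lemma walking0 x G : x0 = x -> (0 < #|T|)%N ->
  (forall j, `|x j| <= 1) -> T = [set j | x j * x j < 1] ->
  pivoted A T (#|T| %/ 2) G -> (forall i, sqnorm (row (rshift n i) G) <= s ^+ 2) ->
  walking 0 x (fun=> 1) (fun=> 1) G /\
  potential x (fun=> 1) (fun=> 1) <= 4 * m%:R.
Proof.
move=> x0E T0 x1 TE [P [g [Y [hP DP BP trP _]]]] rho_le; split.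
  have DPP := mul_mask_sub hP.1 DP BP.
  exists P, finset.set0; split=> //.
  - by rewrite cards0; split=> //; exact: finset.sub0set.
  - split=> // j; rewrite finset.in_set0 orbF => jT; split.
      move: jT; rewrite TE inE -leNgt -expr2 -real_normK ?num_real// => xj.
      by apply/eqP; rewrite eq_le x1 -(@expr_ge1 _ 2).
    move=> i; have [Ps _] := hP.1; rewrite -Ps -DPP trmx_mul (proj1 (mask_projector R T)).
    by rewrite Ps mul_maskE (negPf jT) mulr0.
  - by rewrite addr0.
  - split=> // i; exists 0; rewrite oppr0 expR0 mulr0 x0E; split=> //.
    by rewrite big1// => j _; rewrite subrr mulr0.
rewrite /potential sumr_const card_ord.
have : \sum_p (1 - x p ^+ 2) <= #|T|%:R.
  rewrite -sum1_card natr_sum [leRHS]big_mkcond; apply: ler_sum => p _.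
  rewrite TE inE; case: ltP => [_|xp]; first by rewrite gerBl sqr_ge0.
  by rewrite subr_le0 expr2.
rewrite /beta => sum_le; have Tr : 0 < #|T|%:R :> R by rewrite ltr0n.
have b0 : 0 <= m%:R * 2 / #|T|%:R :> R by rewrite divr_ge0 ?mulr_ge0.
have := ler_wpM2l b0 sum_le; rewrite divfK ?lt0r_neq0// -mulr_natr; lra.
Qed.

End Walk.

(** * A Hoare logic for the real RAM *)

(* Programs use 16 word variables and 16 real arrays. The words 0 and 1 hold
   the dimensions and word 2 the length [P] reserved for every array, so that
   array [r] starts at address [r * P]. *)
Inductive nexp : Type :=
  | N of nat
  | V of nat
  | NAdd of nexp & nexp
  | NSub of nexp & nexp
  | NMul of nexp & nexp
  | NDiv of nexp & nexp.

Inductive vexp : Type :=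
  | VN of nexp
  | VL of nat & nexp
  | VAdd of vexp & vexp
  | VSub of vexp & vexp
  | VMul of vexp & vexp
  | VDiv of vexp & vexp.

Inductive cond : Type :=
  | CN of nexp & nexp
  | CV of vexp & vexp.

Fixpoint ncomp (e : nexp) : wexp :=
  match e with
  | N k => WLit k
  | V k => WLoad (WLit k)
  | NAdd a b => WAdd (ncomp a) (ncomp b)
  | NSub a b => WSub (ncomp a) (ncomp b)
  | NMul a b => WMul (ncomp a) (ncomp b)
  | NDiv a b => WDiv (ncomp a) (ncomp b)
  end.

Definition address (r : nat) (e : nexp) : wexp :=
  WAdd (WMul (WLit r) (WLoad (WLit 2))) (ncomp e).

Fixpoint vcomp (e : vexp) : rexp :=
  match e with
  | VN a => ROfWord (ncomp a)
  | VL r a => RLoad (address r a)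
  | VAdd a b => RAdd (vcomp a) (vcomp b)
  | VSub a b => RSub (vcomp a) (vcomp b)
  | VMul a b => RMul (vcomp a) (vcomp b)
  | VDiv a b => RDiv (vcomp a) (vcomp b)
  end.

Definition ccomp (c : cond) : test :=
  match c with
  | CN a b => TWlt (ncomp a) (ncomp b)
  | CV a b => TRlt (vcomp a) (vcomp b)
  end.

Definition Set_ (k : nat) (e : nexp) : instr := WStore (WLit k) (ncomp e).
Definition Put (r : nat) (i : nexp) (e : vexp) : instr :=
  RStore (address r i) (vcomp e).
Definition Cond (c : cond) (p q : program) : instr := If (ccomp c) p q.
Definition Loop (c : cond) (p : program) : instr := While (ccomp c) p.
Definition For (v : nat) (e : nexp) (p : program) : program :=
  [:: Set_ v (N 0); Loop (CN (V v) e) (p ++ [:: Set_ v (NAdd (V v) (N 1))])].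

Definition wmem : Type := nat -> nat.
Definition rmem (R : Type) : Type := nat -> nat -> R.

Definition upd (w : wmem) (k v : nat) : wmem :=
  fun k' => if eqn k' k then v else w k'.

Definition put {R : Type} (M : rmem R) (r i : nat) (v : R) : rmem R :=
  fun r' i' => if eqn r' r && eqn i' i then v else M r' i'.

Fixpoint nval (w : wmem) (e : nexp) : nat :=
  match e with
  | N k => k
  | V k => w k
  | NAdd a b => nval w a + nval w b
  | NSub a b => nval w a - nval w b
  | NMul a b => nval w a * nval w b
  | NDiv a b => nval w a %/ nval w b
  end%N.

Section Logic.
Variables (R : realType) (W P : nat).
Implicit Types (w : wmem) (M : rmem R) (s : state R) (Q : wmem -> rmem R -> Prop).

(* [nok] and [vok] exclude the wrap-around of words and out-of-range indices. *)
Fixpoint nok w (e : nexp) : bool :=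
  match e with
  | N k => k < W
  | V k => k < 16
  | NAdd a b => [&& nok w a, nok w b & nval w a + nval w b < W]
  | NMul a b => [&& nok w a, nok w b & nval w a * nval w b < W]
  | NSub a b | NDiv a b => nok w a && nok w b
  end%N.

Fixpoint vval w M (e : vexp) : R :=
  match e with
  | VN a => (nval w a)%:R
  | VL r a => M r (nval w a)
  | VAdd a b => vval w M a + vval w M b
  | VSub a b => vval w M a - vval w M b
  | VMul a b => vval w M a * vval w M b
  | VDiv a b => vval w M a / vval w M b
  end.

Fixpoint vok w (e : vexp) : bool :=
  match e with
  | VN a => nok w a
  | VL r a => [&& r < 16, nok w a & nval w a < P]%N
  | VAdd a b | VSub a b | VMul a b | VDiv a b => vok w a && vok w b
  end.

Definition cval w M (c : cond) : bool :=
  match c with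
  | CN a b => (nval w a < nval w b)%N
  | CV a b => vval w M a < vval w M b
  end.

Definition cok w (c : cond) : bool :=
  match c with
  | CN a b => nok w a && nok w b
  | CV a b => vok w a && vok w b
  end.

Definition represents s w M : Prop :=
  [/\ forall k, (k < 16)%N -> words s k = w k,
      forall r i, (r < 16)%N -> (i < P)%N -> reals s (r * P + i) = M r i &
      w 2 = P].

(** Total correctness with a time bound. The number of steps and the final state are fixed before
    the coins, and the arbitrary continuation [k] makes the statement compose. *)
Definition achieves (p : program) (c : nat) Q w M : Prop :=
  forall s, represents s w M -> exists t s' w' M',
    [/\ (t <= c)%N,
        forall k cs, size cs = t -> run W (p ++ k, s) cs = (k, s'),
        represents s' w' M' & Q w' M'].

Hypothesis P_W : (16 * P <= W)%N.
Hypothesis W_16 : (16 < W)%N.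

Lemma weval_ncomp s w M e : represents s w M -> nok w e ->
  weval W s (ncomp e) = nval w e.
Proof.
move=> [hw _ _]; elim: e => //= [k|k|a IHa b IHb|a IHa b IHb|a IHa b IHb|a IHa b IHb].
- exact: modn_small.
- by move=> k16; rewrite modn_small ?hw//; apply: ltn_trans W_16.
- by move=> /and3P[/IHa-> /IHb->]; exact: modn_small.
- by move=> /andP[/IHa-> /IHb->].
- by move=> /and3P[/IHa-> /IHb->]; exact: modn_small.
- by move=> /andP[/IHa-> /IHb->].
Qed.

Lemma weval_address s w M r e : represents s w M -> (r < 16)%N -> nok w e ->
  (nval w e < P)%N -> weval W s (address r e) = (r * P + nval w e)%N.
Proof.
move=> hs r16 ok eP; rewrite /= (weval_ncomp hs ok); case: hs => hw _ w2.
have rP : (r * P + nval w e < W)%N.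
  apply: leq_trans P_W; apply: (@leq_trans (r.+1 * P)).
    by rewrite mulSn addnC ltn_add2r.
  by rewrite leq_mul2r r16 orbT.
rewrite (modn_small (ltn_trans r16 W_16)) (@modn_small 2) ?hw ?w2//; last first.
  exact: ltn_trans W_16.
rewrite (@modn_small (r * P)) ?modn_small//.
by apply: leq_ltn_trans rP; rewrite leq_addr.
Qed.

Lemma reval_vcomp s w M e : represents s w M -> vok w e ->
  reval W s (vcomp e) = vval w M e.
Proof.
move=> hs; elim: e => [a|r a|a IHa b IHb|a IHa b IHb|a IHa b IHb|a IHa b IHb].
- by rewrite /= => /(weval_ncomp hs)->.
- move=> /and3P[r16 ok aP].
  change (reals s (weval W s (address r a)) = M r (nval w a)).
  rewrite (weval_address hs)//.
  by case: hs => _ ->.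
- by move=> /andP[/IHa/= -> /IHb/= ->].
- by move=> /andP[/IHa/= -> /IHb/= ->].
- by move=> /andP[/IHa/= -> /IHb/= ->].
- by move=> /andP[/IHa/= -> /IHb/= ->].
Qed.

Lemma teval_ccomp s w M c : represents s w M -> cok w c ->
  teval W s (ccomp c) = cval w M c.
Proof.
move=> hs; case: c => a b /= /andP[oka okb].
  by rewrite !(weval_ncomp hs).
by rewrite !(reval_vcomp hs).
Qed.

Lemma achieves_nil c Q w M : Q w M -> achieves [::] c Q w M.
Proof.
by move=> hQ s hs; exists 0%N, s, w, M; split=> // k [].
Qed.

Lemma achieves_weaken p c c' Q Q' w M : (c <= c')%N ->
  (forall w' M', Q w' M' -> Q' w' M') ->
  achieves p c Q w M -> achieves p c' Q' w M.
Proof.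
move=> cc' QQ' hp s hs; have [t [s' [w' [M' [tc hr hs' hQ]]]]] := hp s hs.
by exists t, s', w', M'; split=> //; [exact: leq_trans cc' | exact: QQ'].
Qed.

Lemma run_cat cf cs cs' :
  run W cf (cs ++ cs') = run W (run W cf cs) cs' :> config R.
Proof. by rewrite /run foldl_cat. Qed.

Lemma achieves_cat p q c d Q w M :
  achieves p c (achieves q d Q) w M -> achieves (p ++ q) (c + d) Q w M.
Proof.
move=> hp s hs; have [t [s' [w' [M' [tc hr hs' hq]]]]] := hp s hs.
have [u [s2 [w2 [M2 [ud hr2 hs2 hQ]]]]] := hq s' hs'.
exists (t + u)%N, s2, w2, M2; split=> //; first exact: leq_add.
move=> k cs size_cs; rewrite -(cat_take_drop t cs) run_cat -catA.
rewrite hr ?size_takel ?size_cs ?leq_addr//.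
by rewrite hr2// size_drop size_cs addKn.
Qed.

Lemma achieves_cons i p c d Q w M :
  achieves [:: i] c (achieves p d Q) w M -> achieves (i :: p) (c + d) Q w M.
Proof. exact: (@achieves_cat [:: i]). Qed.

Lemma achieves_set k e Q w M : (k < 16)%N -> (k != 2)%N -> nok w e ->
  Q (upd w k (nval w e)) M -> achieves [:: Set_ k e] 1 Q w M.
Proof.
move=> k16 k2 ok hQ s hs.
exists 1%N, (State (update (words s) k (nval w e)) (reals s)), (upd w k (nval w e)), M.
split=> // [l [|c [|//]]// _ /=|].
  by rewrite modn_small ?(weval_ncomp hs)//; apply: ltn_trans W_16.
case: hs => hw hr w2; split=> //=.
- by move=> l l16; rewrite /update /upd eqnE hw.
- by rewrite /upd eqnE eq_sym (negPf k2).
Qed.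

Lemma region_inj r i r' i' : (i < P)%N -> (i' < P)%N ->
  (r * P + i == r' * P + i')%N = (r == r') && (i == i').
Proof.
move=> iP i'P; apply/eqP/andP => [e|[/eqP-> /eqP->]//].
have P0 : (0 < P)%N by exact: leq_ltn_trans iP.
have := congr1 (divn^~ P) e; have := congr1 (modn^~ P) e.
by rewrite !modnMDl !divnMDl// !modn_small// !divn_small// !addn0 => -> ->.
Qed.

Lemma achieves_put r i e Q w M : (r < 16)%N -> nok w i -> (nval w i < P)%N ->
  vok w e -> Q w (put M r (nval w i) (vval w M e)) ->
  achieves [:: Put r i e] 1 Q w M.
Proof.
move=> r16 oki iP oke hQ s hs.
exists 1%N, (State (words s) (update (reals s) (r * P + nval w i) (vval w M e))),
  w, (put M r (nval w i) (vval w M e)).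
split=> // [l [|c [|//]]// _|].
  change ((l, State (words s) (update (reals s) (weval W s (address r i))
    (reval W s (vcomp e)))) = (l, State (words s) (update (reals s)
      (r * P + nval w i) (vval w M e)))).
  by rewrite (weval_address hs)// (reval_vcomp hs).
case: hs => hw hr w2; split=> //= r' i' r'16 i'P.
by rewrite /update /put region_inj// !eqnE hr.
Qed.

Lemma achieves_cond b p q c Q w M : cok w b ->
  (if cval w M b then achieves p c Q w M else achieves q c Q w M) ->
  achieves [:: Cond b p q] c.+1 Q w M.
Proof.
move=> ok hpq s hs.
have : achieves (if cval w M b then p else q) c Q w M by case: ifP hpq.
move=> /(_ s hs)[t [s' [w' [M' [tc hr hs' hQ]]]]].
exists t.+1, s', w', M'; split=> // k [//|a cs] [size_cs].
by rewrite /run /= (teval_ccomp hs)//; exact: hr.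
Qed.

(** The rank [k] ensures termination and [C k] is the remaining time budget, which pays 1 for each
    test and [d] for a body. The cost [d] may vary between iterations, as it does for phases of
    shrinking size. *)
Lemma achieves_loop b p (C : nat -> nat) (I : nat -> wmem -> rmem R -> Prop) Q :
  (forall k w M, I k w M -> cok w b /\
     if cval w M b then exists d, achieves p d (fun w' M' => exists k',
         [/\ (k' < k)%N, (d.+1 + C k' <= C k)%N & I k' w' M']) w M
     else (0 < C k)%N /\ Q w M) ->
  forall k w M, I k w M -> achieves [:: Loop b p] (C k) Q w M.
Proof.
move=> hI; elim/ltn_ind => k IH w M Ik s hs; have [ok] := hI k w M Ik.
case: ifP => [wb [d hp]|wb [C0 hQ]]; last first.
  exists 1%N, s, w, M; split=> // l [|c [|//]]// _.
  by rewrite /run /= (teval_ccomp hs)// wb.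
have [t [s' [w' [M' [td hr hs' [k' [k'k Ck Ik']]]]]]] := hp s hs.
have [u [s2 [w2 [M2 [uC hr2 hs2 hQ]]]]] := IH k' k'k w' M' Ik' s' hs'.
exists (t.+1 + u)%N, s2, w2, M2; split=> //.
  by apply: leq_trans Ck; rewrite addSn ltnS leq_add.
move=> l [//|a cs] [size_cs]; rewrite /run /= (teval_ccomp hs)// wb.
rewrite -(cat_take_drop t cs) -/(run W _ _) run_cat.
have -> := hr ([:: Loop b p] ++ l) (take t cs).
  by apply: hr2; rewrite size_drop size_cs addKn.
by rewrite size_takel// size_cs leq_addr.
Qed.

Lemma updK w k u v : upd (upd w k u) k v = upd w k v.
Proof. by apply/funext => l; rewrite /upd; case: (eqn l k). Qed.

(** A round consists of test, body and increment, c + 2 steps; the initial assignment and the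
    failing test account for the last 2. *)
Lemma achieves_for v e n p c (I : nat -> wmem -> rmem R -> Prop) Q w M :
  (v < 16)%N -> (v != 2)%N -> (n < W)%N ->
  (forall i w' M', (i <= n)%N -> I i w' M' ->
     [/\ w' v = i, nok w' e & nval w' e = n]) ->
  I 0%N (upd w v 0) M ->
  (forall i w' M', (i < n)%N -> I i w' M' -> achieves p c
     (fun w2 M2 => w2 v = i /\ I i.+1 (upd w2 v i.+1) M2) w' M') ->
  (forall w' M', I n w' M' -> Q w' M') ->
  achieves (For v e p) (n * (c + 2) + 2) Q w M.
Proof.
move=> v16 v2 nW hI I0 hp hQ.
rewrite [X in achieves _ X]addnC -[2%N]/(1 + 1)%N -addnA.
apply: achieves_cons; apply: achieves_set => //=; first exact: leq_ltn_trans nW.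
pose J k w' M' := exists2 i, (i + k = n)%N & I i w' M'.
apply: (@achieves_weaken _ (1 + n * (c + 2)) _ Q) => //.
apply: (@achieves_loop _ _ (fun k => 1 + k * (c + 2))%N J); last by exists 0%N.
move=> k w' M' [i ikn Ii].
have [wi ok ev] := hI i w' M' (leq_trans (leq_addr k i) (eq_leq ikn)) Ii.
split; first by rewrite /= v16 ok.
rewrite /= wi ev; case: ltnP => [i_n|n_i]; last first.
  have /eqP in_ : i == n by rewrite eqn_leq n_i -ikn leq_addr.
  by split=> //; apply: hQ; rewrite -in_.
exists (c + 1)%N; apply: achieves_cat; apply: achieves_weaken (hp i w' M' i_n Ii) => //.
move=> w2 M2 [w2v IS]; apply: achieves_set => //=.
  rewrite v16 w2v addn1 (leq_ltn_trans i_n nW) andbT.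
  exact: leq_ltn_trans (leq_ltn_trans (leq0n i) i_n) nW.
exists k.-1; case: k ikn => [|k] ikn; first by lia.
split=> //=; first by lia.
by exists i.+1; [lia | rewrite w2v addn1].
Qed.

End Logic.

(** * Array loops over flat indices *)

Lemma big_nat_div (R : nmodType) (k n p : nat) (E : nat -> R) :
  (p < k)%N -> (0 < n)%N ->
  \sum_(0 <= i < k * n | (i %/ n == p)%N) E i = \sum_(j < n) E (p * n + j)%N.
Proof.
move=> pk n0; rewrite (@big_cat_nat _ _ _ (p * n)) ?leq_mul2r ?(ltnW pk) ?orbT//=.
rewrite [X in X + _]big_nat_cond big1 ?add0r; last first.
  move=> i /andP[/andP[_ ip] /eqP ipE].
  by have := ltn_divLR i p n0; rewrite ip ipE ltnn.
rewrite (@big_cat_nat _ _ _ (p.+1 * n)) ?leq_mul2r ?pk ?leqnSn ?orbT//=.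
rewrite [X in _ + X]big_nat_cond [X in _ + X]big1 ?addr0; last first.
  move=> i /andP[/andP[ip _] /eqP ipE].
  by have := leq_divRL p.+1 i n0; rewrite ip ipE ltnn.
rewrite mulSn addnC -{1}[(p * n)%N]add0n big_addn addKn big_mkord.
apply: eq_big => [i|i _]; last by rewrite addnC.
by rewrite addnC divnMDl// divn_small// addn0 eqxx.
Qed.

Lemma big_nat_mod (R : nmodType) (k n j : nat) (E : nat -> R) : (j < n)%N ->
  \sum_(0 <= i < k * n | (i - i %/ n * n == j)%N) E i = \sum_(p < k) E (p * n + j)%N.
Proof.
move=> jn; have n0 : (0 < n)%N by exact: leq_ltn_trans jn.
elim: k => [|k IHk]; first by rewrite mul0n big_geq// big_ord0.
rewrite big_ord_recr /= -IHk (@big_cat_nat _ _ _ (k * n)) ?leq_mul2r ?leqnSn ?orbT//=.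
congr (_ + _); rewrite mulSn addnC -{1}[(k * n)%N]add0n big_addn addKn big_mkord.
have jE (i : 'I_n) : (i + k * n - (i + k * n) %/ n * n == j)%N = (i == Ordinal jn).
  by rewrite addnC divnMDl// divn_small// addn0 addKn -val_eqE.
rewrite (eq_bigl _ _ jE) big_pred1_eq; congr (E _).
by rewrite addnC.
Qed.

Section Loops.
Variables (R : realType) (W P : nat).
Hypothesis P_W : (16 * P <= W)%N.
Hypothesis W_16 : (16 < W)%N.
Implicit Types (w : wmem) (M : rmem R) (Q : wmem -> rmem R -> Prop).

Definition fill M (r D n : nat) (E : nat -> R) : rmem R :=
  fun r' a => if eqn r' r && (D <= a < D + n)%N then E (a - D)%N else M r' a.

(** Accumulation over the fibres of [f]: one loop over the flat indices of a matrix computes all row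
    sums, or all column sums, at once. *)
Definition increase M (r n : nat) (f : nat -> nat) (E : nat -> R) : rmem R :=
  fun r' a => if eqn r' r then M r' a + \sum_(0 <= i < n | f i == a) E i
              else M r' a.

(** The value is evaluated in the partly filled memory, which admits loops that overwrite the array
    they read. *)
Lemma achieves_fill e n r ie ve D (E : nat -> R) Q w M :
  (r < 16)%N -> (n < W)%N -> (D + n <= P)%N ->
  (forall i, (i <= n)%N -> nok W (upd w 3 i) e /\ nval (upd w 3 i) e = n) ->
  (forall i, (i < n)%N ->
     nok W (upd w 3 i) ie /\ nval (upd w 3 i) ie = (D + i)%N) ->
  (forall i, (i < n)%N -> vok W P (upd w 3 i) ve /\
     vval (upd w 3 i) (fill M r D i E) ve = E i) ->
  Q (upd w 3 n) (fill M r D n E) ->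
  achieves W P (For 3 e [:: Put r ie ve]) (n * 3 + 2) Q w M.
Proof.
move=> r16 nW DnP he hie hve hQ.
apply: (@achieves_for _ _ _ P_W W_16 3 e n _ 1
  (fun i w' M' => w' = upd w 3 i /\ M' = fill M r D i E)) => //.
- by move=> i w' M' i_n [-> _]; have [] := he i i_n.
- split=> //; apply/funext => r'; apply/funext => a; rewrite /fill addn0.
  by case: (eqn r' r) => //=; case: leqP => //= Da; rewrite ltnNge Da.
- move=> i w' M' i_n [-> ->]; have [oki iE] := hie i i_n; have [okv vE] := hve i i_n.
  apply: achieves_put => //; first by rewrite iE; lia.
  split=> //; rewrite updK; split=> //; rewrite iE vE.
  apply/funext => r'; apply/funext => a; rewrite /fill /put !eqnE.
  case: eqP => //= _; case: eqP => [->|aDi] /=.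
    by rewrite leq_addr addnS ltnS leqnn addKn.
  by rewrite addnS ltnS; have -> : (a <= D + i)%N = (a < D + i)%N by lia.
- by move=> w' M' [-> ->].
Qed.

Lemma achieves_increase e n r ie ve f (E : nat -> R) Q w M :
  (r < 16)%N -> (n < W)%N ->
  (forall i, (i <= n)%N -> nok W (upd w 3 i) e /\ nval (upd w 3 i) e = n) ->
  (forall i, (i < n)%N ->
     [/\ nok W (upd w 3 i) ie, nval (upd w 3 i) ie = f i & (f i < P)%N]) ->
  (forall i, (i < n)%N -> vok W P (upd w 3 i) ve /\
     vval (upd w 3 i) (increase M r i f E) ve = E i) ->
  Q (upd w 3 n) (increase M r n f E) ->
  achieves W P (For 3 e [:: Put r ie (VAdd (VL r ie) ve)]) (n * 3 + 2) Q w M.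
Proof.
move=> r16 nW he hie hve hQ.
apply: (@achieves_for _ _ _ P_W W_16 3 e n _ 1
  (fun i w' M' => w' = upd w 3 i /\ M' = increase M r i f E)) => //.
- by move=> i w' M' i_n [-> _]; have [] := he i i_n.
- split=> //; apply/funext => r'; apply/funext => a; rewrite /increase.
  by rewrite big_geq// addr0; case: (eqn r' r).
- move=> i w' M' i_n [-> ->]; have [oki iE fP] := hie i i_n.
  have [okv vE] := hve i i_n.
  apply: achieves_put => //; first by rewrite iE.
    by rewrite /= okv r16 oki iE fP.
  split=> //; rewrite updK; split=> //; rewrite iE /= vE iE.
  apply/funext => r'; apply/funext => a; rewrite /increase /put !eqnE.
  case: eqP => //= ->; rewrite eqxx big_mkcond [in RHS]big_mkcond.
  rewrite [in RHS]big_nat_recr//=.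
  case: eqP => [->|fa] /=; first by rewrite eqxx addrA big_mkcond.
  by case: eqP => [af|_]; [case: fa | rewrite addr0 big_mkcond].
- by move=> w' M' [-> ->].
Qed.

End Loops.

(** * The program *)

Definition n_row : nexp := NDiv (V 3) (V 1).
Definition n_col : nexp := NSub (V 3) (NMul (NDiv (V 3) (V 1)) (V 1)).
Definition n_rows : nexp := NAdd (V 1) (V 0).

(* Arrays: 0 input and output, 1 coloring, 2 matrix G, 3 and 4 weights,
   5 current vector, 6 row or column sums, 7 scalars, 8 mask, 9 slope.
   Words: 3 loop index, 4 selected row or column, 5 number of pivots,
   6 number of frozen variables, 7 number of active variables, 8 variable hit. *)
Definition sweep_prog : program :=
  For 3 (V 1) [:: Put 5 (V 3) (VL 2 (NAdd (NMul (V 4) (V 1)) (V 3)))] ++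
  For 3 n_rows [:: Put 6 (V 3) (VN (N 0))] ++
  For 3 (NMul n_rows (V 1))
    [:: Put 6 n_row (VAdd (VL 6 n_row) (VMul (VL 2 (V 3)) (VL 5 n_col)))] ++
  [:: Put 7 (N 5) (VL 6 (V 4))] ++
  For 3 (NMul n_rows (V 1))
    [:: Put 2 (V 3) (VSub (VL 2 (V 3))
          (VDiv (VMul (VL 6 n_row) (VL 5 n_col)) (VL 7 (N 5))))].

(** As m + n >= 2, the fourth power gives arrays of length at least 16, enough for the scalars, and
    at least (m + n)^2, enough for the matrix G. *)
Record dimensions (m n W P : nat) : Prop := Dimensions {
  dim_m : (0 < m)%N;
  dim_n : (0 < n)%N;
  dim_P : P = ((m + n) ^ 4)%N;
  dim_PW : (16 * P <= W)%N;
  dim_W : (16 < W)%N }.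

Section Indices.
Variables (m n W P : nat).
Hypothesis dims : dimensions m n W P.
Let S := ((n + m) * n)%N.

Lemma size_bounds : [/\ 16 <= P, P < W, n + m <= S, S <= P & m * n + n * n = S]%N.
Proof.
have [m0 n0 PE PW W16] := dims.
have P16 : (16 <= P)%N by rewrite PE (@leq_exp2r 2 _ 4)//; lia.
split=> //.
- by lia.
- by rewrite /S; nia.
- apply: (@leq_trans ((m + n) ^ 2)); last by rewrite PE leq_pexp2l// addn_gt0 m0.
  by rewrite /S expnS expn1; nia.
- by rewrite /S; lia.
Qed.

Lemma index_row (p j : nat) : (j < n)%N -> ((p * n + j) %/ n = p)%N.
Proof. by move=> jn; rewrite divnMDl ?(dim_n dims)// divn_small// addn0. Qed.

Lemma index_col (p j : nat) : (j < n)%N ->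
  (p * n + j - (p * n + j) %/ n * n = j)%N.
Proof. by move=> jn; rewrite index_row// addKn. Qed.

Lemma divn_bounds (i k : nat) : (i < k * n)%N ->
  [/\ i %/ n <= i, i %/ n * n <= i, i - i %/ n * n < n & i %/ n < k]%N.
Proof.
have n0 := dim_n dims; move=> ik; have := ltn_ceil i n0; rewrite mulSn => h.
rewrite leq_div leq_trunc_div ltn_divLR//; split=> //.
by have := leq_trunc_div i n; lia.
Qed.

Lemma index_lt (p j k : nat) : (p < k)%N -> (j < n)%N -> (p * n + j < k * n)%N.
Proof. by move: (dim_n dims); nia. Qed.
End Indices.

Section Blocks.
Variables (R : realType) (m n W P : nat).
Hypothesis dims : dimensions m n W P.
Let S := ((n + m) * n)%N.
Let n_gt0 := dim_n dims.
Let P_W := dim_PW dims.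
Let W_16 := dim_W dims.
Implicit Types (w : wmem) (M : rmem R) (Q : wmem -> rmem R -> Prop).

Definition keeps (ks : seq nat) w w' : Prop := forall k, k \notin ks -> w' k = w k.
Definition preserves (rs : seq nat) M M' : Prop :=
  forall r, r \notin rs -> M' r = M r.

Definition stores M (r k : nat) (G : 'M[R]_(k, n)) : Prop :=
  forall (p : 'I_k) (j : 'I_n), M r (p * n + j)%N = G p j.

Lemma sweep_progP (G : 'M[R]_(n + m, n)) (q : 'I_(n + m)) w M :
  w 0%N = m -> w 1%N = n -> w 4%N = q -> stores M 2%N G ->
  achieves W P sweep_prog (25 * S) (fun w' M' =>
    [/\ keeps [:: 3]%N w w', preserves [:: 2; 5; 6; 7]%N M M',
        forall i, (i < 5)%N -> M' 7%N i = M 7%N i & stores M' 2%N (sweep G q)]) w M.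
Proof.
move=> w0 w1 w4 hG; have [P_16 P_ltW nm_S S_P SE] := size_bounds dims.
have qn : (q * n + n <= S)%N by rewrite -mulSnr leq_mul2r (ltn_ord q) orbT.
apply: (@achieves_weaken _ _ _ _ ((n * 3 + 2) + (((n + m) * 3 + 2) +
  ((S * 3 + 2) + (1 + (S * 3 + 2)))))).
- by lia.
- by move=> ? ? hQ; exact: hQ.
apply: achieves_cat.
(* Row [q] is copied, because the last loop overwrites it in place while it is still needed. *)
apply: (achieves_fill P_W W_16 (D := 0) (E := fun i => M 2%N (q * n + i)%N));
  [by [] | lia | lia | | | |].
- by move=> i _; rewrite /upd /= w1.
- by move=> i ?; rewrite /upd /=; split=> //.
- by move=> i ?; rewrite /upd /fill /= w1 w4; split=> //; lia.
apply: achieves_cat.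
apply: (achieves_fill P_W W_16 (n := n + m) (D := 0) (E := fun i => 0));
  [by [] | lia | lia | | | |].
- by move=> i _; rewrite /upd /= w1 w0; split=> //; lia.
- by move=> i ?; rewrite /upd /=; split=> //.
- by move=> i ?; rewrite /upd /fill /=; split=> //; lia.
apply: achieves_cat.
apply: (achieves_increase P_W W_16 (n := S) (f := fun i => (i %/ n)%N)
  (E := fun i => M 2%N i * M 2%N (q * n + (i - i %/ n * n))%N));
  [by [] | lia | | | |].
- by move=> i _; rewrite /upd /= w1 w0 /S; split=> //; lia.
- by move=> i iS; rewrite /upd /= w1; split=> //; have := leq_div i n; lia.
- move=> i iS; rewrite /upd /increase /fill /= w1.
  have [h1 h2 h3 h4] := divn_bounds dims iS; split; first lia.
  by rewrite add0n subn0 h3.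
apply: achieves_cons; apply: (achieves_put P_W W_16); [by [] | | | |].
- by rewrite /=; lia.
- by rewrite /=; lia.
- by rewrite /upd /= w4; have := ltn_ord q; lia.
apply: (achieves_fill P_W W_16 (n := S) (D := 0)
  (E := fun i => M 2%N i - (\sum_(j < n) M 2%N (i %/ n * n + j)%N * M 2%N (q * n + j)%N) *
    M 2%N (q * n + (i - i %/ n * n))%N /
    (\sum_(j < n) M 2%N (q * n + j)%N * M 2%N (q * n + j)%N))); [by [] | lia | lia | | | |].
- by move=> i _; rewrite /upd /= w1 w0 /S; split=> //; lia.
- by move=> i ?; rewrite /upd /=; split=> //.
- move=> i iS; rewrite /upd /fill /= w1.
  have [h1 h2 h3 h4] := divn_bounds dims iS; split; first lia.
  rewrite /put /increase /= w4 /= ltnn subn0 !add0n.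
  rewrite h3 h4 ltn_ord !add0r.
  rewrite !big_nat_div//; congr (_ - _ * _ / _).
    by apply: eq_bigr => j _; rewrite (index_col dims).
  by apply: eq_bigr => j _; rewrite (index_col dims).
split.
- by move=> k; rewrite /upd !inE !eqnE; case: eqP.
- move=> r; rewrite !inE /fill /put /increase !eqnE => hr; apply/funext => a.
  by move: hr; do !case: eqP => //=.
- by move=> i i5; rewrite /fill /put /increase /= !eqnE; case: eqP => // i5'; lia.
- move=> p j; rewrite /fill /= subn0 add0n (index_lt dims)// (index_col dims)//.
  rewrite (index_row dims)// mxE hG.
  congr (_ - _ * _ / _).
  - by apply: eq_bigr => l _; rewrite !hG.
  - exact: hG.
  - by apply: eq_bigr => l _; rewrite !hG.
Qed.

End Blocks.

(** * Pivot search, active variables and initialization *)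

Definition argmax_prog (e : nexp) : program :=
  [:: Set_ 4 (N 0); Put 7 (N 0) (VL 6 (N 0))] ++
  For 3 e [:: Cond (CV (VL 7 (N 0)) (VL 6 (V 3)))
                [:: Put 7 (N 0) (VL 6 (V 3)); Set_ 4 (V 3)] [::]].

Definition lower (e : nexp) : nexp := NAdd (NMul (V 1) (V 1)) e.

Definition norms_prog : program :=
  For 3 (V 0) [:: Put 6 (V 3) (VN (N 0))] ++
  For 3 (NMul (V 0) (V 1))
    [:: Put 6 n_row (VAdd (VL 6 n_row)
          (VMul (VL 2 (lower (V 3))) (VL 2 (lower (V 3)))))].

Definition find_pivot_prog : program :=
  norms_prog ++ argmax_prog (V 0) ++ [:: Set_ 4 (NAdd (V 1) (V 4))].

Definition count_prog : program :=
  [:: Set_ 7 (N 0)] ++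
  For 3 (V 1) [:: Cond (CV (VMul (VL 1 (V 3)) (VL 1 (V 3))) (VN (N 1)))
    [:: Put 8 (V 3) (VN (N 1)); Set_ 7 (NAdd (V 7) (N 1))]
    [:: Put 8 (V 3) (VN (N 0))]].

(** With truncated subtraction, 1 - (r - c) - (c - r) is 1 if r = c and 0 otherwise: the identity
    matrix without a branch. *)
Definition init_prog : program :=
  For 3 (NMul (V 1) (V 1)) [:: Put 2 (V 3) (VMul
    (VN (NSub (NSub (N 1) (NSub n_row n_col)) (NSub n_col n_row)))
    (VL 8 n_col))] ++
  For 3 (NMul (V 0) (V 1))
    [:: Put 2 (lower (V 3)) (VMul (VL 0 (V 3)) (VL 8 n_col))].

Section Blocks.
Variables (R : realType) (m n W P : nat).
Hypothesis dims : dimensions m n W P.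
Let S := ((n + m) * n)%N.
Let n_gt0 := dim_n dims.
Let m_gt0 := dim_m dims.
Let P_W := dim_PW dims.
Let W_16 := dim_W dims.
Implicit Types (w : wmem) (M : rmem R) (Q : wmem -> rmem R -> Prop).

Lemma argmax_progP e k w M : (0 < k <= P)%N -> (k <= S)%N ->
  (forall w', keeps [:: 3; 4]%N w w' -> nok W w' e /\ nval w' e = k) ->
  achieves W P (argmax_prog e) (9 * S) (fun w' M' =>
    [/\ keeps [:: 3; 4]%N w w', (w' 4%N < k)%N, M' = put M 7%N 0 (M 6%N (w' 4%N)) &
        forall i, (i < k)%N -> M 6%N i <= M 6%N (w' 4%N)]) w M.
Proof.
move=> /andP[k0 kP] kS he; have [P_16 P_ltW _ S_P _] := size_bounds dims.
apply: (@achieves_weaken _ _ _ _ (1 + (1 + (k * (3 + 2) + 2)))); first by lia.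
  by move=> ? ? hQ; exact: hQ.
apply: achieves_cons; apply: (achieves_set W_16); [by []|by []|by rewrite /=; lia|].
apply: achieves_cons; apply: (achieves_put P_W W_16);
  [by []|by rewrite /=; lia|by rewrite /=; lia|by rewrite /=; lia|].
apply: (@achieves_for _ _ _ P_W W_16 3 e k _ 3 (fun i w' M' =>
  [/\ w' 3%N = i, (w' 4%N < k)%N, keeps [:: 3; 4]%N w w', M' = put M 7%N 0 (M 6%N (w' 4%N)) &
      forall l, (l < i)%N -> M 6%N l <= M 6%N (w' 4%N)])) => //.
- lia.
- by move=> i w' M' ik [-> _ /he[ok eE]].
- split=> //; first by move=> l; rewrite /upd !inE !eqnE; do !case: eqP.
- move=> i w' M' ik [w3 w4 kw -> hmax].
  apply: (achieves_cond P_W W_16) => /=; first by rewrite w3; lia.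
  rewrite w3 /put /=; case: ltP => hi; last first.
    apply: achieves_nil; split=> //; split=> //.
    + by move=> l hl; rewrite /upd eqnE; case: eqP hl => [->//|_ /kw].
    + by move=> l; rewrite ltnS leq_eqVlt => /predU1P[->//|/hmax].
  apply: (@achieves_cons _ _ _ _ _ 1 1); apply: (achieves_put P_W W_16);
    [by []|by rewrite /=; lia|by rewrite /=; lia|by rewrite /= w3; lia|].
  apply: (achieves_set W_16); [by []|by []|by []|].
  rewrite /= w3; split=> //; split=> //.
  + move=> l hl; rewrite /upd !eqnE; case: eqP hl => [->//|_ hl].
    by case: eqP hl => [->//|_ /kw].
  + by apply/funext => r; apply/funext => a; rewrite /put; case: (_ && _).
  + move=> l; rewrite ltnS leq_eqVlt => /predU1P[->//|/hmax /le_trans]; apply.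
    exact: ltW.
- by move=> w' M' [_ w4 kw ME hmax]; split.
Qed.

Lemma norms_progP (G : 'M[R]_(n + m, n)) w M :
  w 0%N = m -> w 1%N = n -> stores M 2%N G ->
  achieves W P norms_prog (10 * S) (fun w' M' =>
    [/\ keeps [:: 3]%N w w', preserves [:: 6]%N M M' &
        forall i : 'I_m, M' 6%N i = sqnorm (row (rshift n i) G)]) w M.
Proof.
move=> w0 w1 hG; have [P_16 P_ltW nm_S S_P SE] := size_bounds dims.
apply: (@achieves_weaken _ _ _ _ ((m * 3 + 2) + (m * n * 3 + 2))); first by lia.
  by move=> ? ? hQ; exact: hQ.
apply: achieves_cat.
apply: (achieves_fill P_W W_16 (n := m) (D := 0) (E := fun i => 0));
  [by [] | lia | lia | | | |].
- by move=> i _; rewrite /upd /= w0.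
- by move=> i ?; rewrite /upd /=; split=> //.
- by move=> i ?; rewrite /upd /fill /=; split=> //; lia.
apply: (achieves_increase P_W W_16 (n := m * n) (f := fun i => (i %/ n)%N)
  (E := fun i => M 2%N (n * n + i)%N * M 2%N (n * n + i)%N));
  [by [] | lia | | | |].
- by move=> i _; rewrite /upd /= w1 w0; split=> //; lia.
- by move=> i iS; rewrite /upd /= w1; split=> //; have := leq_div i n; lia.
- by move=> i iS; rewrite /upd /increase /fill /= w1; split=> //; lia.
split.
- by move=> k; rewrite /upd !inE !eqnE; case: eqP.
- move=> r; rewrite !inE /fill /put /increase !eqnE => hr; apply/funext => a.
  by move: hr; do !case: eqP => //=.
- move=> i; rewrite /increase /fill /= add0n ltn_ord add0r big_nat_div//.
  apply: eq_bigr => j _; rewrite mxE -!hG /=.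
  by rewrite mulnDl addnA.
Qed.

Lemma find_pivotP (G : 'M[R]_(n + m, n)) w M :
  w 0%N = m -> w 1%N = n -> stores M 2%N G ->
  achieves W P find_pivot_prog (20 * S) (fun w' M' =>
    [/\ keeps [:: 3; 4]%N w w', preserves [:: 6; 7]%N M M', M' 7%N 1%N = M 7%N 1%N &
      exists q : 'I_m, [/\ w' 4%N = rshift n q,
        M' 7%N 0%N = sqnorm (row (rshift n q) G) &
        forall i, sqnorm (row (rshift n i) G) <= sqnorm (row (rshift n q) G)]]) w M.
Proof.
move=> w0 w1 hG; have [P_16 P_ltW nm_S S_P SE] := size_bounds dims.
apply: (@achieves_weaken _ _ _ _ (10 * S + (9 * S + 1))); first by lia.
  by move=> ? ? hQ; exact: hQ.
apply: achieves_cat; apply: achieves_weaken (norms_progP w0 w1 hG) => //.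
move=> w' M' [kw pM M6].
apply: achieves_cat; apply: achieves_weaken (argmax_progP (k := m) _ _ _) => //.
- move=> w2 M2 [kw2 w24 M2E hmax]; apply: (achieves_set W_16) => //=.
    by rewrite kw2// kw// w1; lia.
  rewrite kw2// kw// w1; split.
  + move=> k; rewrite /upd !inE !eqnE => /norP[k3 k4]; rewrite (negPf k4).
    by rewrite kw2 ?kw ?inE ?negb_or ?k3.
  + move=> r hr; rewrite M2E /put; apply/funext => a; move: hr.
    rewrite !inE eqnE => /norP[r6 r7]; rewrite (negPf r7) /= pM//.
    by rewrite inE.
  + by rewrite M2E /put /= pM.
  + exists (Ordinal w24); split=> //.
    * by rewrite M2E /put /= (M6 (Ordinal w24)).
    * by move=> i; rewrite -!M6; apply: hmax.
- lia.
- lia.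
- by move=> w2 kw2; rewrite /= kw2// kw.
Qed.
End Blocks.

Definition v_entry : vexp := VL 2 (NAdd (NMul (V 4) (V 1)) (V 3)).
Definition v_scale : vexp := VL 7 (N 1).

(* Halving the l1 norm [n] times brings it within a factor 2 of the l2 norm. *)
Definition sqrt_prog : program :=
  [:: Put 7 (N 1) (VN (N 0))] ++
  For 3 (V 1) [:: Cond (CV v_entry (VN (N 0)))
    [:: Put 7 (N 1) (VSub v_scale v_entry)]
    [:: Put 7 (N 1) (VAdd v_scale v_entry)]] ++
  For 3 (V 1) [:: Cond (CV (VMul (VN (N 4)) (VL 7 (N 0))) (VMul v_scale v_scale))
    [:: Put 7 (N 1) (VDiv v_scale (VN (N 2)))] [::]].

Definition weights_prog : program :=
  For 3 (V 0) [:: Put 3 (V 3) (VN (N 1))] ++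
  For 3 (V 0) [:: Put 4 (V 3) (VN (N 1))].

Section Blocks.
Variables (R : realType) (m n W P : nat).
Hypothesis dims : dimensions m n W P.
Let S := ((n + m) * n)%N.
Let n_gt0 := dim_n dims.
Let m_gt0 := dim_m dims.
Let P_W := dim_PW dims.
Let W_16 := dim_W dims.
Implicit Types (w : wmem) (M : rmem R) (Q : wmem -> rmem R -> Prop).

Lemma count_progP (T : {set 'I_n}) w M : w 1%N = n ->
  T = [set j : 'I_n | M 1%N j * M 1%N j < 1] ->
  achieves W P count_prog (10 * S) (fun w' M' =>
    [/\ keeps [:: 3; 7]%N w w', preserves [:: 8]%N M M', w' 7%N = #|T| &
        forall j : 'I_n, M' 8%N j = (j \in T)%:R]) w M.
Proof.
move=> w1 TE; have [P_16 P_ltW nm_S S_P SE] := size_bounds dims.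
pose a (l : nat) := (M 1%N l * M 1%N l < 1)%R.
apply: (@achieves_weaken _ _ _ _ (1 + (n * (3 + 2) + 2))); first by lia.
  by move=> ? ? hQ; exact: hQ.
apply: achieves_cons; apply: (achieves_set W_16); [by []|by []|by rewrite /=; lia|].
apply: (@achieves_for _ _ _ P_W W_16 3 (V 1) n _ 3 (fun i w' M' =>
  [/\ w' 3%N = i, keeps [:: 3; 7]%N w w', preserves [:: 8]%N M M',
      w' 7%N = (\sum_(0 <= l < i) a l)%N &
      forall l, (l < i)%N -> M' 8%N l = (a l)%:R])) => //.
- lia.
- by move=> i w' M' ik [-> kw _ _ _]; rewrite /= kw// w1.
- split=> //; last by rewrite big_geq.
  by move=> l hl; rewrite /upd !eqnE; do 2![case: eqP hl => [->//|_ hl]].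
- move=> i w' M' ik [w3 kw pM w7 M8].
  have kwS (u : wmem) v : keeps [:: 3; 7]%N w u -> keeps [:: 3; 7]%N w (upd u 3 v).
    by move=> ku l hl; rewrite /upd eqnE; case: eqP hl => [->//|_ /ku].
  have kw7 (u : wmem) v : keeps [:: 3; 7]%N w u -> keeps [:: 3; 7]%N w (upd u 7 v).
    by move=> ku l hl; rewrite /upd eqnE; case: eqP hl => [->//|_ /ku].
  have a_le : (\sum_(0 <= l < i) a l <= i)%N.
    rewrite -[leqRHS]subn0 -[leqRHS]muln1 -sum_nat_const_nat.
    by apply: leq_sum => l _; case: (a l).
  apply: (achieves_cond P_W W_16) => /=; first by rewrite w3; lia.
  rewrite w3 pM// -/(a i); case: ifP => ai.
    apply: (@achieves_cons _ _ _ _ _ 1 1); apply: (achieves_put P_W W_16);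
      [by []|by []|by rewrite /= w3; lia|by rewrite /=; lia|].
    apply: (achieves_set W_16); [by []|by []|by rewrite /= w7; lia|].
    split=> //; split=> //.
    + exact/kwS/kw7.
    + move=> r hr; apply/funext => l; rewrite /put eqnE.
      by case: eqP hr => [->//|_ /pM ->].
    + by rewrite /upd /= w7 big_nat_recr//= ai.
    + move=> l; rewrite /put /= w3 eqnE ltnS leq_eqVlt; case: eqP => [->|_] /=.
        by rewrite ai.
      exact: M8.
  apply: (@achieves_weaken _ _ _ _ 1) => //; first by move=> ? ? hQ; exact: hQ.
  apply: (achieves_put P_W W_16);
      [by []|by []|by rewrite /= w3; lia|by rewrite /=; lia|].
  split=> //; split=> //.
  + exact/kwS.
  + move=> r hr; apply/funext => l; rewrite /put eqnE.
    by case: eqP hr => [->//|_ /pM ->].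
  + by rewrite /upd /= w7 big_nat_recr//= ai addn0.
  + move=> l; rewrite /put /= w3 eqnE ltnS leq_eqVlt; case: eqP => [->|_] /=.
      by rewrite ai.
    exact: M8.
- move=> w' M' [w3 kw pM w7 M8]; split=> //.
    rewrite w7 big_mkord TE -sum1_card [RHS]big_mkcond; apply: eq_bigr => l _.
    by rewrite inE /a; case: ifP.
  by move=> j; rewrite M8// TE inE.
Qed.

Lemma init_progP (A : 'M[R]_(m, n)) (T : {set 'I_n}) w M : w 0%N = m -> w 1%N = n ->
  stores M 0%N A -> (forall j : 'I_n, M 8%N j = (j \in T)%:R) ->
  achieves W P init_prog (10 * S) (fun w' M' =>
    [/\ keeps [:: 3]%N w w', preserves [:: 2]%N M M' &
        stores M' 2%N (col_mx 1%:M A *m mask R T)]) w M.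
Proof.
move=> w0 w1 hA hT; have [P_16 P_ltW nm_S S_P SE] := size_bounds dims.
apply: (@achieves_weaken _ _ _ _ ((n * n * 3 + 2) + (m * n * 3 + 2))); first by lia.
  by move=> ? ? hQ; exact: hQ.
apply: achieves_cat.
apply: (achieves_fill P_W W_16 (n := n * n) (D := 0)
  (E := fun i => (1 - (i %/ n - (i - i %/ n * n)) - (i - i %/ n * n - i %/ n))%:R *
                 M 8%N (i - i %/ n * n)%N));
  [by [] | lia | lia | | | |].
- by move=> i _; rewrite /upd /= w1; lia.
- by move=> i ?; rewrite /upd /=; split=> //.
- move=> i iS; rewrite /upd /fill /= w1; split=> //.
  by have [h1 h2 h3 h4] := divn_bounds dims iS; lia.
apply: (achieves_fill P_W W_16 (n := m * n) (D := n * n)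
  (E := fun i => M 0%N i * M 8%N (i - i %/ n * n)%N)); [by [] | lia | lia | | | |].
- by move=> i _; rewrite /upd /= w1 w0; lia.
- by move=> i ?; rewrite /upd /= w1; lia.
- move=> i iS; rewrite /upd /fill /= w1; split=> //.
  by have [h1 h2 h3 h4] := divn_bounds dims iS; lia.
split.
- by move=> k; rewrite /upd !inE !eqnE; case: eqP.
- move=> r; rewrite !inE /fill !eqnE => hr; apply/funext => a.
  by rewrite (negPf hr).
- move=> p j; rewrite mul_maskE /fill /=; case: (split_ordP p) => i -> /=.
    have := index_lt dims (ltn_ord i) (ltn_ord j) => ijn.
    rewrite leqNgt ijn /= subn0 (index_col dims)// (index_row dims)// hT.
    rewrite col_mxEu mxE -val_eqE /=; congr (_%:R * _); lia.
  rewrite mulnDl -addnA leq_addr ltn_add2l (index_lt dims)//= addKn.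
  by rewrite (index_col dims)// hT col_mxEd hA.
Qed.

Lemma weights_progP w M : w 0%N = m ->
  achieves W P weights_prog (10 * S) (fun w' M' =>
    [/\ keeps [:: 3]%N w w', preserves [:: 3; 4]%N M M',
        forall i, (i < m)%N -> M' 3%N i = 1 & forall i, (i < m)%N -> M' 4%N i = 1]) w M.
Proof.
move=> w0; have [P_16 P_ltW nm_S S_P SE] := size_bounds dims.
apply: (@achieves_weaken _ _ _ _ ((m * 3 + 2) + (m * 3 + 2))); first by lia.
  by move=> ? ? hQ; exact: hQ.
apply: achieves_cat.
apply: (achieves_fill P_W W_16 (n := m) (D := 0) (E := fun i => 1));
  [by [] | lia | lia | | | |].
- by move=> i _; rewrite /upd /= w0.
- by move=> i ?; rewrite /upd /=; split=> //.
- by move=> i ?; rewrite /upd /fill /=; split=> //; lia.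
apply: (achieves_fill P_W W_16 (n := m) (D := 0) (E := fun i => 1));
  [by [] | lia | lia | | | |].
- by move=> i _; rewrite /upd /= w0.
- by move=> i ?; rewrite /upd /=; split=> //.
- by move=> i ?; rewrite /upd /fill /=; split=> //; lia.
split.
- by move=> k; rewrite /upd !inE !eqnE; case: eqP.
- move=> r; rewrite !inE /fill !eqnE => /norP[h3 h4]; apply/funext => a.
  by rewrite (negPf h3) (negPf h4).
- by move=> i im; rewrite /fill /= add0n im.
- by move=> i im; rewrite /fill /= add0n im.
Qed.

Lemma sqrt_progP (G : 'M[R]_(n + m, n)) (q : 'I_(n + m)) w M :
  w 1%N = n -> w 4%N = q -> stores M 2%N G -> M 7%N 0 = sqnorm (row q G) ->
  achieves W P sqrt_prog (15 * S) (fun w' M' =>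
    [/\ keeps [:: 3]%N w w', preserves [:: 7]%N M M',
        0 <= M' 7%N 1, sqnorm (row q G) <= M' 7%N 1 ^+ 2 &
        M' 7%N 1 ^+ 2 <= 4 * sqnorm (row q G)]) w M.
Proof.
move=> w1 w4 hG hrho; have [P_16 P_ltW nm_S S_P SE] := size_bounds dims.
have qn : (q * n + n <= S)%N by rewrite -mulSnr leq_mul2r (ltn_ord q) orbT.
set rho := sqnorm _ in hrho *; pose g l := M 2%N (q * n + l)%N.
have rhoE : rho = \sum_(0 <= l < n) g l ^+ 2.
  by rewrite big_mkord; apply: eq_bigr => j _; rewrite mxE /g hG expr2.
pose l1 i := \sum_(0 <= l < i) `|g l|.
have l1_ge0 i : 0 <= l1 i by apply: sumr_ge0.
have l1_ge : rho <= l1 n ^+ 2.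
  rewrite rhoE; elim: (n) => [|k IHk]; first by rewrite big_geq// sqr_ge0.
  rewrite /l1 !big_nat_recr//= -/(l1 k) -(real_normK (num_real (g k))).
  by have := l1_ge0 k; have := normr_ge0 (g k); nra.
(* Every entry is at most the l2 norm, so the l1 norm exceeds it by at most the factor n <= 2^n,
   which [n] halvings remove. *)
have l1_le : l1 n ^+ 2 <= 4 ^+ n * rho.
  have rho0 : 0 <= rho by exact: sqnorm_ge0.
  apply: (@le_trans _ _ ((n%:R * Num.sqrt rho) ^+ 2)).
    rewrite lerXn2r ?nnegrE ?mulr_ge0 ?sqrtr_ge0// /l1 big_mkord.
    rewrite -[X in X%:R]card_ord -sumr_const mulr_suml; apply: ler_sum => j _.
    rewrite mul1r -sqrtr_sqr ler_wsqrtr// rhoE big_mkord (bigD1 j)//= lerDl.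
    by apply: sumr_ge0 => l _; exact: sqr_ge0.
  rewrite exprMn sqr_sqrtr// ler_wpM2r// (_ : 4 = 2 ^+ 2); last by ring.
  rewrite -exprM mulnC exprM lerXn2r ?nnegrE ?exprn_ge0//.
  by rewrite -natrX ler_nat ltnW// ltn_expl.
apply: (@achieves_weaken _ _ _ _ (1 + ((n * (2 + 2) + 2) + (n * (2 + 2) + 2)))).
- by lia.
- by move=> ? ? hQ; exact: hQ.
have kwS (u : wmem) v : keeps [:: 3]%N w u -> keeps [:: 3]%N w (upd u 3 v).
  by move=> ku l hl; rewrite /upd eqnE; case: eqP hl => [->//|_ /ku].
apply: achieves_cons; apply: (achieves_put P_W W_16);
  [by []|by rewrite /=; lia|by rewrite /=; lia|by rewrite /=; lia|].
apply: achieves_cat.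
apply: (@achieves_for _ _ _ P_W W_16 3 (V 1) n _ 2 (fun i w' M' =>
  [/\ w' 3%N = i, keeps [:: 3]%N w w' & M' = put M 7%N 1 (l1 i)])) => //.
- lia.
- by move=> i w' M' ik [-> kw _]; rewrite /= kw// w1.
- split=> //; first exact: kwS.
  by rewrite /l1 big_geq.
- move=> i w' M' ik [w3 kw ->].
  apply: (achieves_cond P_W W_16) => /=; first by rewrite kw// w4 w3 kw// w1; lia.
  rewrite kw// w4 w3 kw// w1 /put /= -/(g i).
  case: ifP => gi; apply: (achieves_put P_W W_16);
    try by [|rewrite /=; lia|rewrite /= kw// w4 w3 kw// w1; lia].
    split=> //; split=> //; first exact: kwS.
    apply/funext => r; apply/funext => a; rewrite /= kw// w4 w3 kw// w1 /put /=.
    by case: (_ && _) => //; rewrite /l1 big_nat_recr//= ltr0_norm.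
  split=> //; split=> //; first exact: kwS.
  apply/funext => r; apply/funext => a; rewrite /= kw// w4 w3 kw// w1 /put /=.
  by case: (_ && _) => //; rewrite /l1 big_nat_recr//= ger0_norm// leNgt gi.
move=> w' M' [w3 kw ->].
(* A halving happens only while s^2 > 4 rho, so rho <= s^2 survives it. The disjunction says that
   the target is reached or that no halving was skipped. *)
apply: (@achieves_for _ _ _ P_W W_16 3 (V 1) n _ 2 (fun i w' M' =>
  [/\ w' 3%N = i, keeps [:: 3]%N w w' & exists s, [/\ M' = put M 7%N 1 s,
    0 <= s, rho <= s ^+ 2 & s ^+ 2 <= 4 * rho \/ 4 ^+ i * s ^+ 2 <= 4 ^+ n * rho]])) => //.
- lia.
- by move=> i w2 M2 ik [-> kw2 _]; rewrite /= kw2// w1.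
- split=> //; first exact: kwS.
  by exists (l1 n); split=> //; right; rewrite mul1r.
- move=> i w2 M2 ik [w23 kw2 [s [-> s0 rho_s hs]]].
  apply: (achieves_cond P_W W_16) => /=; first by lia.
  rewrite /put /= hrho; case: ltrP => hlt.
    apply: (achieves_put P_W W_16);
      [by []|by rewrite /=; lia|by rewrite /=; lia|by rewrite /=; lia|].
    split=> //; split=> //; first exact: kwS.
    exists (s / 2); split.
    + by apply/funext => r; apply/funext => a; rewrite /put /=; case: (_ && _).
    + by rewrite divr_ge0.
    + by rewrite expr2; lra.
    + right; case: hs => [|hs]; first by rewrite expr2; lra.
      by rewrite exprS; apply: le_trans hs; rewrite expr2; nra.
  apply: achieves_nil; split=> //; split=> //; first exact: kwS.
  by exists s; split=> //; left; rewrite expr2.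
- move=> w2 M2 [_ kw2 [s [-> s0 rho_s hs]]]; rewrite /put /=; split=> //.
  + by move=> r hr; apply/funext => a; rewrite eqnE; case: eqP hr => [->|].
  + case: hs => // hs; have : s ^+ 2 <= rho by rewrite -(@ler_pM2l _ (4 ^+ n)) ?exprn_gt0.
    by have := sqr_ge0 s; lra.
Qed.
End Blocks.

(** * One step of the walk *)

Definition v_scaled (e : vexp) : vexp := VDiv e (VMul (VN (N 8)) v_scale).
Definition v_beta : vexp := VDiv (VMul (VN (V 0)) (VN (N 2))) (VN (V 7)).

Definition gain_prog : program :=
  let z := v_scaled (VL 2 (lower (V 3))) in
  For 3 (V 1) [:: Put 6 (V 3) (VN (N 0))] ++
  For 3 (NMul (V 1) (V 1)) [:: Put 6 n_col (VAdd (VL 6 n_col)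
    (VMul v_beta (VMul (VL 2 (V 3)) (VL 2 (V 3)))))] ++
  For 3 (NMul (V 0) (V 1)) [:: Put 6 n_col (VAdd (VL 6 n_col)
    (VSub (VN (N 0)) (VMul (VAdd (VL 3 n_row) (VL 4 n_row)) (VMul z z))))].

Definition slope_prog : program :=
  [:: Put 9 (N 0) (VN (N 0))] ++
  For 3 (V 0) [:: Put 9 (N 0) (VAdd (VL 9 (N 0))
    (VMul (VSub (VL 3 (V 3)) (VL 4 (V 3)))
      (v_scaled (VL 2 (NAdd (NMul (NAdd (V 1) (V 3)) (V 1)) (V 4))))))] ++
  For 3 (V 1) [:: Put 9 (N 0) (VAdd (VL 9 (N 0))
    (VSub (VN (N 0)) (VMul (VMul (VMul (VN (N 2)) v_beta) (VL 1 (V 3)))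
      (VL 2 (NAdd (NMul (V 3) (V 1)) (V 4))))))].

Definition direction_prog : program :=
  [:: Put 7 (N 4) (VN (N 1));
      Cond (CV (VN (N 0)) (VL 9 (N 0)))
        [:: Put 7 (N 4) (VSub (VN (N 0)) (VN (N 1)))] [::]] ++
  For 3 n_rows [:: Put 5 (V 3)
    (VMul (VL 7 (N 4)) (VL 2 (NAdd (NMul (V 3) (V 1)) (V 4))))].

Definition v_time : vexp := VL 7 (N 2).

(** One pass suffices: by convexity, shortening the step keeps the earlier variables in [-1, 1]. The
    value [n] in word 8 means that no variable is hit. *)
Definition clip_prog : program :=
  let y := VAdd (VL 1 (V 3)) (VMul v_time (VL 5 (V 3))) in
  [:: Put 7 (N 2) (VN (N 1)); Set_ 8 (V 1)] ++
  For 3 (V 1) [:: Cond (CV (VN (N 1)) y)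
    [:: Put 7 (N 2) (VDiv (VSub (VN (N 1)) (VL 1 (V 3))) (VL 5 (V 3)));
        Set_ 8 (V 3)]
    [:: Cond (CV y (VSub (VN (N 0)) (VN (N 1))))
      [:: Put 7 (N 2) (VDiv (VSub (VSub (VN (N 0)) (VN (N 1))) (VL 1 (V 3)))
                            (VL 5 (V 3)));
          Set_ 8 (V 3)] [::]]].

Definition move_prog : program :=
  let z := v_scaled (VMul v_time (VL 5 (NAdd (V 1) (V 3)))) in
  For 3 (V 1) [:: Put 1 (V 3) (VAdd (VL 1 (V 3)) (VMul v_time (VL 5 (V 3))))] ++
  For 3 (V 0) [:: Put 3 (V 3)
    (VMul (VL 3 (V 3)) (VAdd (VAdd (VN (N 1)) z) (VMul z z)))] ++
  For 3 (V 0) [:: Put 4 (V 3)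
    (VMul (VL 4 (V 3)) (VAdd (VSub (VN (N 1)) z) (VMul z z)))].

(** The first [n] rows of G are those of the projector, so the index of the hit variable is also the
    row whose sweep freezes it. *)
Definition step_prog : program :=
  gain_prog ++ argmax_prog (V 1) ++ slope_prog ++ direction_prog ++ clip_prog ++
  move_prog ++
  [:: Cond (CN (V 8) (V 1))
    ([:: Set_ 4 (V 8)] ++ sweep_prog ++ [:: Set_ 6 (NAdd (V 6) (N 1))]) [::]].

Lemma clip_convex (R : realFieldType) (x v t t' : R) :
  `|x| <= 1 -> `|x + t * v| <= 1 -> 0 <= t' <= t -> `|x + t' * v| <= 1.
Proof.
rewrite !ler_norml => /andP[a b] /andP[c d] /andP[e f].
by case: (lerP 0 v) => v0; apply/andP; split; nra.
Qed.

(** The strict violation forces the sign of [v], so that the division by [v] is sound and can only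
    shorten the step. *)
Lemma clip_up (R : realFieldType) (x v t : R) :
  0 <= t -> x <= 1 -> 1 < x + t * v -> 0 < v /\ 0 <= (1 - x) / v <= t.
Proof.
move=> t0 x1 hi; have v0 : 0 < v.
  by rewrite ltNge; apply/negP => v0; have := mulr_ge0_le0 t0 v0; lra.
split=> //; apply/andP; split.
  by apply: divr_ge0; [rewrite subr_ge0 | exact: ltW].
by rewrite ler_pdivrMr//; lra.
Qed.

Lemma clip_down (R : realFieldType) (x v t : R) :
  0 <= t -> -1 <= x -> x + t * v < -1 -> v < 0 /\ 0 <= (-1 - x) / v <= t.
Proof.
move=> t0 x1 hi; have v0 : v < 0.
  by rewrite ltNge; apply/negP => v0; have := mulr_ge0 t0 v0; lra.
by split=> //; rewrite ler_ndivlMr// mul0r ler_ndivrMr//; apply/andP; split; lra.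
Qed.

Section Blocks.
Variables (R : realType) (m n W P : nat).
Hypothesis dims : dimensions m n W P.
Let S := ((n + m) * n)%N.
Let n_gt0 := dim_n dims.
Let m_gt0 := dim_m dims.
Let P_W := dim_PW dims.
Let W_16 := dim_W dims.
Implicit Types (w : wmem) (M : rmem R) (Q : wmem -> rmem R -> Prop).

Lemma gain_progP (T : {set 'I_n}) (G : 'M[R]_(n + m, n)) w M :
  w 0%N = m -> w 1%N = n -> w 7%N = #|T| -> stores M 2%N G ->
  achieves W P gain_prog (12 * S) (fun w' M' =>
    [/\ keeps [:: 3]%N w w', preserves [:: 6]%N M M' &
        forall j : 'I_n, M' 6%N j =
          gain T (M 7%N 1) (fun i : 'I_m => M 3%N i) (fun i : 'I_m => M 4%N i) G j]) w M.
Proof.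
move=> w0 w1 w7 hG; have [P_16 P_ltW nm_S S_P SE] := size_bounds dims.
apply: (@achieves_weaken _ _ _ _
  ((n * 3 + 2) + ((n * n * 3 + 2) + (m * n * 3 + 2)))); first by lia.
  by move=> ? ? hQ; exact: hQ.
apply: achieves_cat.
apply: (achieves_fill P_W W_16 (n := n) (D := 0) (E := fun i => 0));
  [by [] | lia | lia | | | |].
- by move=> i _; rewrite /upd /= w1.
- by move=> i ?; rewrite /upd /=; split=> //.
- by move=> i ?; rewrite /upd /fill /=; split=> //; lia.
apply: achieves_cat.
apply: (achieves_increase P_W W_16 (n := n * n) (f := fun i => (i - i %/ n * n)%N)
  (E := fun i => beta R m T * (M 2%N i * M 2%N i))); [by [] | lia | | | |].
- by move=> i _; rewrite /upd /= w1; lia.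
- move=> i iS; rewrite /upd /= w1; split=> //;
  by have [h1 h2 h3 h4] := divn_bounds dims iS; lia.
- by move=> i iS; rewrite /upd /increase /fill /= w0 w7; split=> //; lia.
apply: (achieves_increase P_W W_16 (n := m * n) (f := fun i => (i - i %/ n * n)%N)
  (E := fun i => - ((M 3%N (i %/ n)%N + M 4%N (i %/ n)%N) *
    (M 2%N (n * n + i)%N / (8 * M 7%N 1) * (M 2%N (n * n + i)%N / (8 * M 7%N 1))))));
  [by [] | lia | | | |].
- by move=> i _; rewrite /upd /= w1 w0; lia.
- move=> i iS; rewrite /upd /= w1; split=> //;
  by have [h1 h2 h3 h4] := divn_bounds dims iS; lia.
- move=> i iS; rewrite /upd /increase /fill /= w1 sub0r; split=> //;
  by have [h1 h2 h3 h4] := divn_bounds dims iS; lia.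
split.
- by move=> k; rewrite /upd !inE !eqnE; case: eqP.
- move=> r; rewrite !inE /fill /put /increase !eqnE => hr; apply/funext => a.
  by rewrite (negPf hr).
- move=> j; rewrite /increase /fill /= add0n ltn_ord add0r !big_nat_mod// /gain -sumrN.
  congr (_ + _); first by apply: eq_bigr => p _; rewrite -!hG.
  apply: eq_bigr => i _; rewrite (index_row dims)// -!hG /=.
  by rewrite mulnDl addnA.
Qed.

Lemma slope_progP (T : {set 'I_n}) (G : 'M[R]_(n + m, n)) (j : 'I_n) w M :
  w 0%N = m -> w 1%N = n -> w 7%N = #|T| -> w 4%N = j -> stores M 2%N G ->
  achieves W P slope_prog (12 * S) (fun w' M' =>
    [/\ keeps [:: 3]%N w w', preserves [:: 9]%N M M' &
        M' 9%N 0 = slope T (M 7%N 1) (fun p : 'I_n => M 1%N p)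
          (fun i : 'I_m => M 3%N i) (fun i : 'I_m => M 4%N i) G j]) w M.
Proof.
move=> w0 w1 w7 w4 hG; have [P_16 P_ltW nm_S S_P SE] := size_bounds dims.
have jn := ltn_ord j.
have ilt i : (i < n + m)%N -> (i * n + j < S)%N by move=> ?; exact: (index_lt dims).
apply: (@achieves_weaken _ _ _ _ (1 + ((m * 3 + 2) + (n * 3 + 2)))); first by lia.
  by move=> ? ? hQ; exact: hQ.
apply: achieves_cons; apply: (achieves_put P_W W_16);
  [by []|by rewrite /=; lia|by rewrite /=; lia|by rewrite /=; lia|].
apply: achieves_cat.
apply: (achieves_increase P_W W_16 (n := m) (f := fun i => 0%N)
  (E := fun i => (M 3%N i - M 4%N i) * (M 2%N ((n + i) * n + j)%N / (8 * M 7%N 1))));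
  [by [] | lia | | | |].
- by move=> i _; rewrite /upd /= w0.
- by move=> i iS; rewrite /upd /=; split=> //; lia.
- move=> i iS; rewrite /upd /increase /put /= w1 w4; split=> //.
  have := ilt (n + i)%N; rewrite ltn_add2l => /(_ iS); lia.
apply: (achieves_increase P_W W_16 (n := n) (f := fun i => 0%N)
  (E := fun i => - (2 * beta R m T * M 1%N i * M 2%N (i * n + j)%N)));
  [by [] | lia | | | |].
- by move=> i _; rewrite /upd /= w1.
- by move=> i iS; rewrite /upd /=; split=> //; lia.
- move=> i iS; rewrite /upd /increase /put /= w0 w1 w4 w7 sub0r; split=> //.
  have := ilt i; rewrite ltn_addr// => /(_ isT); lia.
split.
- by move=> k; rewrite /upd !inE !eqnE; case: eqP.
- move=> r; rewrite !inE /fill /put /increase !eqnE => hr; apply/funext => a.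
  by rewrite (negPf hr).
- rewrite /increase /put /= add0r !big_mkord /slope -sumrN.
  by congr (_ + _); apply: eq_bigr => l _; rewrite -hG.
Qed.

Lemma direction_progP (G : 'M[R]_(n + m, n)) (j : 'I_n) w M :
  w 0%N = m -> w 1%N = n -> w 4%N = j -> stores M 2%N G ->
  achieves W P direction_prog (10 * S) (fun w' M' =>
    [/\ keeps [:: 3]%N w w', preserves [:: 5; 7]%N M M', M' 7%N 1 = M 7%N 1 &
      exists sg, [/\ sg * sg = 1, sg * M 9%N 0 <= 0 &
        forall p : 'I_(n + m), M' 5%N p = sg * G p j]]) w M.
Proof.
move=> w0 w1 w4 hG; have [P_16 P_ltW nm_S S_P SE] := size_bounds dims.
have jn := ltn_ord j.
have ilt i : (i < n + m)%N -> (i * n + j < S)%N by move=> ?; exact: (index_lt dims).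
apply: (@achieves_weaken _ _ _ _ (1 + (2 + ((n + m) * 3 + 2)))); first by lia.
  by move=> ? ? hQ; exact: hQ.
apply: achieves_cons; apply: (achieves_put P_W W_16);
  [by []|by rewrite /=; lia|by rewrite /=; lia|by rewrite /=; lia|].
apply: achieves_cons.
pose sg : R := if 0 < M 9%N 0 then -1 else 1.
have sg_cond : achieves W P [:: Cond (CV (VN (N 0)) (VL 9 (N 0)))
    [:: Put 7 (N 4) (VSub (VN (N 0)) (VN (N 1)))] [::]] 2
    (fun w' M' => w' = w /\ M' = put M 7%N 4 sg) w (put M 7%N 4 1).
  apply: (achieves_cond P_W W_16) => /=; first by lia.
  rewrite /put /= /sg; case: ifP => h.
    apply: (achieves_put P_W W_16);
      [by []|by rewrite /=; lia|by rewrite /=; lia|by rewrite /=; lia|].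
    split=> //=; rewrite sub0r; apply/funext => r; apply/funext => a.
    by rewrite /put h; case: (_ && _).
  apply: achieves_nil; split=> //; apply/funext => r; apply/funext => a.
  by rewrite h.
apply: achieves_weaken sg_cond => // _ _ [-> ->].
apply: (achieves_fill P_W W_16 (n := n + m) (D := 0)
  (E := fun i => sg * M 2%N (i * n + j)%N)); [by [] | lia | lia | | | |].
- by move=> i _; rewrite /upd /= w1 w0; lia.
- by move=> i ?; rewrite /upd /=; split=> //.
- move=> i /ilt; rewrite /upd /fill /put /= w1 w4; split=> //; lia.
split.
- by move=> k; rewrite /upd !inE !eqnE; case: eqP.
- move=> r; rewrite !inE /fill /put !eqnE => /norP[h5 h7]; apply/funext => a.
  by rewrite (negPf h5) (negPf h7).
- by [].
- exists sg; split.
  + by rewrite /sg; case: ifP; rewrite ?mulrNN mulr1.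
  + by rewrite /sg; case: ltrP => h; lra.
  + by move=> p; rewrite /fill /= add0n ltn_ord subn0 hG.
Qed.

Lemma clip_progP w M : w 1%N = n -> (forall p, (p < n)%N -> `|M 1%N p| <= 1) ->
  achieves W P clip_prog (10 * S) (fun w' M' =>
    [/\ keeps [:: 3; 8]%N w w', preserves [:: 7]%N M M', M' 7%N 1 = M 7%N 1,
        0 <= M' 7%N 2 <= 1 /\
        (forall p, (p < n)%N -> `|M 1%N p + M' 7%N 2 * M 5%N p| <= 1) &
        (w' 8%N = n /\ M' 7%N 2 = 1) \/
        [/\ (w' 8%N < n)%N, M 5%N (w' 8%N) != 0 &
            `|M 1%N (w' 8%N) + M' 7%N 2 * M 5%N (w' 8%N)| = 1]]) w M.
Proof.
move=> w1 x1; have [P_16 P_ltW nm_S S_P SE] := size_bounds dims.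
apply: (@achieves_weaken _ _ _ _ (1 + (1 + (n * (4 + 2) + 2)))); first by lia.
  by move=> ? ? hQ; exact: hQ.
apply: achieves_cons; apply: (achieves_put P_W W_16);
  [by []|by rewrite /=; lia|by rewrite /=; lia|by rewrite /=; lia|].
apply: achieves_cons; apply: (achieves_set W_16); [by []|by []|by rewrite /=; lia|].
have kwS (u : wmem) v : keeps [:: 3; 8]%N w u -> keeps [:: 3; 8]%N w (upd u 3 v).
  by move=> ku l hl; rewrite /upd eqnE; case: eqP hl => [->//|_ /ku].
have kw8 (u : wmem) v : keeps [:: 3; 8]%N w u -> keeps [:: 3; 8]%N w (upd u 8 v).
  by move=> ku l hl; rewrite /upd eqnE; case: eqP hl => [->//|_ /ku].
have putK t t' : put (put M 7%N 2 t) 7 2 t' = put M 7%N 2 t'.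
  by apply/funext => r; apply/funext => a; rewrite /put; case: (_ && _).
apply: (@achieves_for _ _ _ P_W W_16 3 (V 1) n _ 4 (fun i w' M' =>
  [/\ w' 3%N = i, keeps [:: 3; 8]%N w w' & exists t, [/\ M' = put M 7%N 2 t, 0 <= t <= 1,
    forall p, (p < i)%N -> `|M 1%N p + t * M 5%N p| <= 1 &
    (w' 8%N = n /\ t = 1) \/ [/\ (w' 8%N < n)%N, M 5%N (w' 8%N) != 0 &
            `|M 1%N (w' 8%N) + t * M 5%N (w' 8%N)| = 1]]])) => //.
- lia.
- by move=> i w2 M2 ik [-> kw _]; rewrite /= kw// w1.
- split=> //; first exact/kwS/kw8.
  by exists 1; split=> //; [rewrite ler01 lexx | left; rewrite /upd /= w1].
- move=> i w2 M2 ik [w3 kw [t [-> t01 ht hit]]].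
  have /andP[t0 t1] := t01.
  have := x1 i ik; rewrite ler_norml => /andP[xi_ge xi_le].
  have bnds : [/\ i < P, 2 < W & 2 < P]%N.
    by move: ik nm_S S_P P_ltW P_16; clear; split; lia.
  have newtime t' : 0 <= t' <= t -> M 5%N i != 0 -> `|M 1%N i + t' * M 5%N i| = 1 ->
      w2 3%N = i /\ [/\ upd (upd w2 8%N i) 3 i.+1 3 = i.+1,
        keeps [:: 3; 8]%N w (upd (upd w2 8%N i) 3 i.+1) &
        exists t, [/\ put M 7%N 2 t' = put M 7%N 2 t, 0 <= t <= 1,
          forall p, (p < i.+1)%N -> `|M 1%N p + t * M 5%N p| <= 1 &
          (upd (upd w2 8%N i) 3 i.+1 8 = n /\ t = 1) \/
          [/\ (upd (upd w2 8%N i) 3 i.+1 8 < n)%N,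
            M 5%N (upd (upd w2 8%N i) 3 i.+1 8) != 0 &
            `|M 1%N (upd (upd w2 8%N i) 3 i.+1 8) +
              t * M 5%N (upd (upd w2 8%N i) 3 i.+1 8)| = 1]]].
    move=> t't v0 hi1; split=> //; split=> //; first exact/kwS/kw8.
    exists t'; split=> //.
    + by case/andP: t't => -> /le_trans->.
    + move=> p; rewrite ltnS leq_eqVlt => /predU1P[->|pi]; first by rewrite hi1.
      exact: clip_convex (x1 p (ltn_trans pi ik)) (ht p pi) t't.
    + by right; rewrite /upd /=; split.
  apply: (achieves_cond P_W W_16) => /=; first by rewrite w3; lia.
  rewrite w3 /put /=; case: ltrP => hi.
    have [v0 time_le] := clip_up t0 xi_le hi.
    apply: (@achieves_cons _ _ _ _ _ 1 2); apply: (achieves_put P_W W_16);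
      [by []|by case: bnds|by case: bnds|
       by rewrite /= w3; case: bnds; clear; lia|].
    apply: (@achieves_weaken _ _ _ _ 1) => //; first by move=> ? ? hQ; exact: hQ.
    apply: (achieves_set W_16); [by []|by []|by []|].
    rewrite /= w3 putK /put /=; apply: newtime; last 2 first.
    + by rewrite lt0r_neq0.
    + by rewrite divfK ?lt0r_neq0// addrCA subrr addr0 normr1.
    + exact: time_le.
  apply: (achieves_cond P_W W_16) => /=; first by rewrite w3; lia.
  rewrite w3 /put /=; case: ltrP => hi'.
    rewrite sub0r in hi' *; have [v0 time_le] := clip_down t0 xi_ge hi'.
    apply: (@achieves_cons _ _ _ _ _ 1 1); apply: (achieves_put P_W W_16);
      [by []|by case: bnds|by case: bnds|
       by rewrite /= w3; case: bnds; clear; lia|].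
    apply: (achieves_set W_16); [by []|by []|by []|].
    rewrite /= w3 putK /put /=; apply: newtime; last 2 first.
    + by rewrite ltr0_neq0.
    + by rewrite divfK ?ltr0_neq0// addrCA subrr addr0 ?sub0r normrN normr1.
    + by rewrite sub0r.
  apply: achieves_nil; split=> //; split=> //; first exact: kwS.
  exists t; split=> //.
  move=> p; rewrite ltnS leq_eqVlt => /predU1P[->|/ht//].
  rewrite ler_norml hi andbT; apply: le_trans hi'; rewrite sub0r; exact: lexx.
- move=> w' M' [w3 kw [t [-> t01 ht hit]]]; rewrite /put /=; split=> //.
  by move=> r hr; apply/funext => a; rewrite eqnE; case: eqP hr => [->|].
Qed.

Lemma move_progP w M : w 0%N = m -> w 1%N = n ->
  let z i := M 7%N 2 * M 5%N (n + i)%N / (8 * M 7%N 1) in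
  achieves W P move_prog (15 * S) (fun w' M' =>
    [/\ keeps [:: 3]%N w w', preserves [:: 1; 3; 4]%N M M',
        forall p, (p < n)%N -> M' 1%N p = M 1%N p + M 7%N 2 * M 5%N p,
        forall i, (i < m)%N -> M' 3%N i = M 3%N i * (1 + z i + z i * z i) &
        forall i, (i < m)%N -> M' 4%N i = M 4%N i * (1 - z i + z i * z i)]) w M.
Proof.
move=> w0 w1 z; have [P_16 P_ltW nm_S S_P SE] := size_bounds dims.
apply: (@achieves_weaken _ _ _ _
  ((n * 3 + 2) + ((m * 3 + 2) + (m * 3 + 2)))); first by lia.
  by move=> ? ? hQ; exact: hQ.
apply: achieves_cat.
apply: (achieves_fill P_W W_16 (n := n) (D := 0)
  (E := fun p => M 1%N p + M 7%N 2 * M 5%N p)); [by [] | lia | lia | | | |].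
- by move=> i _; rewrite /upd /= w1.
- by move=> i ?; rewrite /upd /=; split=> //.
- by move=> i ?; rewrite /upd /fill /= add0n ltnn; split=> //; lia.
apply: achieves_cat.
apply: (achieves_fill P_W W_16 (n := m) (D := 0)
  (E := fun i => M 3%N i * (1 + z i + z i * z i))); [by [] | lia | lia | | | |].
- by move=> i _; rewrite /upd /= w0.
- by move=> i ?; rewrite /upd /=; split=> //.
- by move=> i ?; rewrite /upd /fill /= add0n ltnn w1; split=> //; lia.
apply: (achieves_fill P_W W_16 (n := m) (D := 0)
  (E := fun i => M 4%N i * (1 - z i + z i * z i))); [by [] | lia | lia | | | |].
- by move=> i _; rewrite /upd /= w0.
- by move=> i ?; rewrite /upd /=; split=> //.
- by move=> i ?; rewrite /upd /fill /= add0n ltnn w1; split=> //; lia.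
split.
- by move=> k; rewrite /upd !inE !eqnE; case: eqP.
- move=> r; rewrite !inE /fill !eqnE => /norP[h1 /norP[h3 h4]]; apply/funext => a.
  by rewrite (negPf h1) (negPf h3) (negPf h4).
- by move=> i im; rewrite /fill /= add0n im subn0.
- by move=> i im; rewrite /fill /= add0n im subn0.
- by move=> i im; rewrite /fill /= add0n im subn0.
Qed.

End Blocks.

Section Step.
Variables (R : realType) (m n W P : nat).
Hypothesis dims : dimensions m n W P.
Variables (A : 'M[R]_(m, n)) (T : {set 'I_n}) (s : R) (x0 : 'I_n -> R).
Let S := ((n + m) * n)%N.
Let n_gt0 := dim_n dims.
Let m_gt0 := dim_m dims.
Let P_W := dim_PW dims.
Let W_16 := dim_W dims.
Implicit Types (w : wmem) (M : rmem R) (Q : wmem -> rmem R -> Prop).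

Definition coloring_of M : 'I_n -> R := fun p => M 1%N p.
Definition weights_of M (r : nat) : 'I_m -> R := fun i => M r i.

Definition potential_of M : R :=
  potential T (coloring_of M) (weights_of M 3%N) (weights_of M 4%N).

Definition walk_state (f : nat) w M : Prop :=
  [/\ [/\ w 0%N = m, w 1%N = n, w 7%N = #|T| & w 6%N = f], stores M 0%N A, M 7%N 1 = s,
      potential_of M <= 4 * m%:R &
      exists2 G, stores M 2%N G &
        walking A T s x0 f (coloring_of M) (weights_of M 3%N) (weights_of M 4%N) G].

(** A step of full length 1 pays with potential; one that stops at the boundary of the cube pays
    with a frozen variable. *)
Definition progress (f : nat) M (f' : nat) M' : Prop :=
  (f' = f /\ potential_of M' <= potential_of M - 7 * m%:R / (16 * #|T|%:R)) \/
  (f' = f.+1 /\ potential_of M' <= potential_of M).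

Lemma step_progP f w M : walk_state f w M -> (4 * f < #|T|)%N ->
  achieves W P step_prog (110 * S) (fun w' M' =>
    exists2 f', walk_state f' w' M' & progress f M f' M') w M.
Proof.
move=> [[w0 w1 w7 w6] hA M71 Psi4 [G hG hw]] fT.
have [P_16 P_ltW nm_S S_P SE] := size_bounds dims.
have x1 p : (p < n)%N -> `|M 1%N p| <= 1.
  by move=> pn; have [_ [_ [_ _ [x1 _] _ _]]] := hw; exact: (x1 (Ordinal pn)).
apply: (@achieves_weaken _ _ _ _ (12 * S + (9 * S + (12 * S + (10 * S + (10 * S +
  (15 * S + (1 + (25 * S + 1)).+1))))))); first by lia.
  by move=> ? ? hQ; exact: hQ.
apply: achieves_cat.
apply: achieves_weaken (gain_progP dims (T := T) w0 w1 w7 hG) => //.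
move=> u1 M1 [ku1 pM1 gainE].
have u10 : u1 0 = m by rewrite ku1.
have u11 : u1 1 = n by rewrite ku1.
have u17 : u1 7 = #|T| by rewrite ku1.
have u16 : u1 6 = f by rewrite ku1.
apply: achieves_cat.
apply: achieves_weaken (argmax_progP dims (k := n) _ _ _) => //; first last.
- by move=> u ku; rewrite /= ku ?u11.
- by lia.
- by lia.
move=> u2 M2 [ku2 jn M2E jmax]; pose j := Ordinal jn.
have u20 : u2 0 = m by rewrite ku2.
have u21 : u2 1 = n by rewrite ku2.
have u27 : u2 7 = #|T| by rewrite ku2.
have u26 : u2 6 = f by rewrite ku2.
have {}jmax j' : gain T s (weights_of M 3%N) (weights_of M 4%N) G j' <=
    gain T s (weights_of M 3%N) (weights_of M 4%N) G j.
  by have := jmax j' (ltn_ord j'); rewrite gainE (gainE j) M71.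
have pM2 r : r \notin [:: 6; 7]%N -> M2 r = M r.
  rewrite !inE => /norP[r6 r7]; rewrite M2E; apply/funext => a.
  by rewrite /put eqnE (negPf r7) /= pM1 ?inE.
have M271 : M2 7%N 1 = s by rewrite M2E /put /= pM1.
have hG2 : stores M2 2%N G by move=> p l; rewrite pM2.
apply: achieves_cat.
apply: achieves_weaken (slope_progP dims (T := T) (j := j) u20 u21 u27 erefl hG2) => //.
move=> u3 M3 [ku3 pM3 slopeE].
have u30 : u3 0 = m by rewrite ku3.
have u31 : u3 1 = n by rewrite ku3.
have u37 : u3 7 = #|T| by rewrite ku3.
have u36 : u3 6 = f by rewrite ku3.
have u34 : u3 4 = j by rewrite ku3.
have hG3 : stores M3 2%N G by move=> p l; rewrite pM3// pM2.
apply: achieves_cat.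
apply: achieves_weaken (direction_progP dims u30 u31 u34 hG3) => //.
move=> u4 M4 [ku4 pM4 M471 [sg [sg2 sgL vE]]].
have u40 : u4 0 = m by rewrite ku4.
have u41 : u4 1 = n by rewrite ku4.
have u47 : u4 7 = #|T| by rewrite ku4.
have u46 : u4 6 = f by rewrite ku4.
have x14 p : (p < n)%N -> `|M4 1 p| <= 1 by rewrite pM4// pM3// pM2//; exact: x1.
apply: achieves_cat.
apply: achieves_weaken (clip_progP dims u41 x14) => //.
move=> u5 M5 [ku5 pM5 M571 [t01 x't] hit].
have u50 : u5 0 = m by rewrite ku5.
have u51 : u5 1 = n by rewrite ku5.
have u57 : u5 7 = #|T| by rewrite ku5.
have u56 : u5 6 = f by rewrite ku5.
apply: achieves_cat.
have hmove := @move_progP R m n W P dims u5 M5 u50 u51; cbv zeta in hmove.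
apply: achieves_weaken hmove => //.
set t := M5 7 2 in t01 x't hit *.
move=> u6 M6 [ku6 pM6 xE WpE WmE].
have u60 : u6 0 = m by rewrite ku6.
have u61 : u6 1 = n by rewrite ku6.
have u67 : u6 7 = #|T| by rewrite ku6.
have u66 : u6 6 = f by rewrite ku6.
have u68 : u6 8 = u5 8 by rewrite ku6.
have pM5' r : r \in [:: 0; 1; 2; 3; 4]%N -> M5 r = M r.
  by rewrite !inE => /or4P[/eqP->|/eqP->|/eqP->|/orP[]/eqP->];
    rewrite pM5// pM4// pM3// pM2.
have v5 p : M5 5 p = M4 5 p by rewrite pM5.
have s5 : M5 7 1 = s by rewrite M571 M471 pM3.
pose z (i : 'I_m) := t * (sg * G (rshift n i) j) / (8 * s).
have xE' : coloring_of M6 =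
    (fun p => coloring_of M p + t * (sg * G (lshift m p) j)).
  by apply/funext => p; rewrite /coloring_of xE// pM5'// v5 -(vE (lshift m p)).
have zE (i : 'I_m) : t * M5 5 (n + i)%N / (8 * M5 7 1) = z i.
  by rewrite v5 s5 (vE (rshift n i)).
have WpE' : weights_of M6 3 =
    (fun i => weights_of M 3%N i * (1 + z i + z i * z i)).
  by apply/funext => i; rewrite /weights_of WpE// zE pM5'.
have WmE' : weights_of M6 4 =
    (fun i => weights_of M 4%N i * (1 - z i + z i * z i)).
  by apply/funext => i; rewrite /weights_of WmE// zE pM5'.
have hG6 : stores M6 2 G by move=> p l; rewrite pM6// pM5'.
have hA6 : stores M6 0 A by move=> p l; rewrite pM6// pM5'.
have M671 : M6 7 1 = s by rewrite pM6.
have {}sgL : sg * slope T s (coloring_of M) (weights_of M 3%N) (weights_of M 4%N) G j <= 0.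
  move: sgL; rewrite slopeE M271 /coloring_of /weights_of.
  by rewrite (pM2 1%N)// (pM2 3%N)// (pM2 4%N).
have step o := walk_step (o := o) hw fT Psi4 jmax sg2 sgL t01.
have x'1 p : `|coloring_of M p + t * (sg * G (lshift m p) j)| <= 1.
  have := x't p (ltn_ord p); rewrite (pM4 1%N)// pM3// pM2// (vE (lshift m p)).
  by [].
have T0 : (0 < #|T|)%N by exact: leq_ltn_trans fT.
have gain1 : 0 <= 7 * m%:R / (16 * #|T|%:R) :> R by rewrite divr_ge0 ?mulr_ge0.
have gain0 : 0 <= t * t * (7 * m%:R / (16 * #|T|%:R)).
  by case/andP: t01 => t0 _; rewrite !mulr_ge0.
apply: (achieves_cond P_W W_16) => //.
rewrite /cval [nval _ _]/= [nval _ (V 1)]/= u61 u68; case: hit => [[u58 t1]|[h_lt vh xh]].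
  rewrite u58 ltnn; apply: achieves_nil.
  have [|hw' drop] := step None x'1; first by [].
  rewrite t1 !mul1r in drop.
  have pot_le : potential_of M6 <= potential_of M - 7 * m%:R / (16 * #|T|%:R).
    by rewrite /potential_of xE' WpE' WmE' /z t1.
  exists f; last by left.
  split=> //; first by apply: le_trans pot_le _; rewrite lerBlDr (le_trans Psi4)// lerDl.
  by exists G => //; rewrite addn0 in hw'; rewrite xE' WpE' WmE'.
rewrite h_lt; pose h := Ordinal h_lt.
have [|hw' drop] := step (Some h) x'1.
  move=> _ [<-]; split.
    by move: vh; rewrite -[u5 8%N]/(nat_of_ord (lshift m h)) (vE (lshift m h)).
  by move: xh; rewrite pM4// pM3// pM2// -[u5 8%N]/(nat_of_ord (lshift m h)) (vE (lshift m h)).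
have pot_le : potential_of M6 <= potential_of M.
  by rewrite /potential_of xE' WpE' WmE'; apply: le_trans drop _; rewrite gerBl.
apply: achieves_cons; apply: (achieves_set W_16); [by []|by []|by []|].
rewrite [nval _ _]/= u68.
have q4 : upd u6 4 (u5 8) 4 = lshift m h by [].
apply: achieves_cat.
have q0 : upd u6 4 (u5 8) 0 = m by [].
have q1 : upd u6 4 (u5 8) 1 = n by [].
apply: achieves_weaken (sweep_progP dims q0 q1 q4 hG6) => //.
move=> u7 M7 [ku7 pM7 M77 hG7].
have u76 : u7 6 = f by rewrite ku7// /upd /= u66.
have fn : (f <= n)%N.
  by move: (max_card T) fT; rewrite card_ord; clear; move: #|T| => ?; lia.
apply: (achieves_set W_16); [by []|by []| |].
  by rewrite /= u76; move: fn m_gt0 nm_S S_P P_ltW W_16; clear; lia.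
have colE : coloring_of M7 = coloring_of M6.
  by apply/funext => p; rewrite /coloring_of pM7.
have W3E : weights_of M7 3 = weights_of M6 3.
  by apply/funext => p; rewrite /weights_of pM7.
have W4E : weights_of M7 4 = weights_of M6 4.
  by apply/funext => p; rewrite /weights_of pM7.
have potE : potential_of M7 = potential_of M6 by rewrite /potential_of colE W3E W4E.
exists f.+1; last by right; rewrite potE.
split.
- by rewrite /upd /= u76 !ku7// /upd /= u60 u61 u67 addn1.
- by move=> p l; rewrite pM7.
- by rewrite M77.
- by rewrite potE; exact: le_trans pot_le Psi4.
- exists (sweep G (lshift m h)) => //.
  by rewrite addn1 in hw'; rewrite colE W3E W4E xE' WpE' WmE'.
Qed.

End Step.

(** * Phases and the complete algorithm *)

Definition walk_prog : program := [:: Loop (CN (NMul (N 4) (V 6)) (V 7)) step_prog].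

(** The test 2 c + 1 < #|T| means c < #|T| %/ 2 for both parities. The search after the last sweep
    supplies the norm from which the scale is computed. *)
Definition pivots_prog : program :=
  find_pivot_prog ++ [:: Set_ 5 (N 0)] ++
  [:: Loop (CN (NAdd (NMul (N 2) (V 5)) (N 1)) (V 7))
     (sweep_prog ++ [:: Set_ 5 (NAdd (V 5) (N 1))] ++ find_pivot_prog)].

Definition phase_prog : program :=
  init_prog ++ pivots_prog ++ sqrt_prog ++ weights_prog ++ [:: Set_ 6 (N 0)] ++
  walk_prog ++ count_prog.

Lemma keeps_sub (ks ks' : seq nat) w w' : all (mem ks') ks -> keeps ks w w' -> keeps ks' w w'.
Proof. by move=> /allP kk kw k hk; apply: kw; apply: contra hk => /kk. Qed.

Lemma keeps_trans ks w w' w2 : keeps ks w w' -> keeps ks w' w2 -> keeps ks w w2.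
Proof. by move=> kw kw' k hk; rewrite kw'// kw. Qed.

Lemma keeps_upd ks w w' k v : k \in ks -> keeps ks w w' -> keeps ks w (upd w' k v).
Proof.
by move=> hk kw l hl; rewrite /upd eqnE; case: eqP hl => [->|_ /kw//]; rewrite hk.
Qed.

Lemma preserves_sub (R : realType) (rs rs' : seq nat) (M M' : rmem R) :
  all (mem rs') rs -> preserves rs M M' -> preserves rs' M M'.
Proof. by move=> /allP kk kw k hk; apply: kw; apply: contra hk => /kk. Qed.

Lemma preserves_trans (R : realType) (rs : seq nat) (M M' M2 : rmem R) :
  preserves rs M M' -> preserves rs M' M2 -> preserves rs M M2.
Proof. by move=> kw kw' k hk; rewrite kw'// kw. Qed.

Section Phase.
Variables (R : realType) (m n W P : nat).
Hypothesis dims : dimensions m n W P.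
Variables (A : 'M[R]_(m, n)).
Let S := ((n + m) * n)%N.
Let n_gt0 := dim_n dims.
Let m_gt0 := dim_m dims.
Let P_W := dim_PW dims.
Let W_16 := dim_W dims.
Implicit Types (w : wmem) (M : rmem R) (Q : wmem -> rmem R -> Prop).

(** Every step lowers potential / unit plus the number of unfrozen variables by at least 1.
    Initially 4 m / unit = 64 #|T| / 7, and 64 / 7 + 1 <= 11. *)
Lemma walk_progP (T : {set 'I_n}) s x0 w M : (0 < #|T|)%N ->
  walk_state A T s x0 0 w M ->
  achieves W P walk_prog (11 * #|T| * (110 * S).+1 + 1) (fun w' M' =>
    exists2 f, walk_state A T s x0 f w' M' & (#|T| <= 4 * f)%N) w M.
Proof.
move=> T0 hw0; have [P_16 P_ltW nm_S S_P SE] := size_bounds dims.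
have Tn : (#|T| <= n)%N by rewrite -[leqRHS]card_ord max_card.
have Tr : 0 < #|T|%:R :> R by rewrite ltr0n.
have mr : 0 < m%:R :> R by rewrite ltr0n.
pose unit : R := 7 * m%:R / (16 * #|T|%:R).
have unit0 : 0 < unit by rewrite divr_gt0 ?mulr_gt0.
have f_le f u N : walk_state A T s x0 f u N -> (f <= #|T|)%N.
  by move=> [_ _ _ _ [G _ /walking_active]]; apply: leq_trans; rewrite leq_addl.
have pot_ge0 f u N : walk_state A T s x0 f u N -> 0 <= potential_of m T N :> R.
  move=> [_ _ _ _ [G _ /potential_ge0[Wp0 Wm0 ?]]].
  by rewrite addr_ge0// sumr_ge0// => i _; rewrite addr_ge0.
pose I k u N := exists2 f, walk_state A T s x0 f u N &
  potential_of m T N / unit + (#|T| - f)%:R <= k%:R :> R.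
apply: (@achieves_loop _ _ _ P_W W_16 _ _ (fun k => k * (110 * S).+1 + 1)%N I);
    last first.
  exists 0%N => //; case: hw0 => _ _ _ Psi4 _.
  apply: (@le_trans _ _ (4 * m%:R / unit + #|T|%:R)).
    by rewrite subn0 lerD2r ler_wpM2r// invr_ge0 ltW.
  have -> : 4 * m%:R / unit = 64 / 7 * #|T|%:R.
    by rewrite /unit; field; rewrite !lt0r_neq0.
  by rewrite natrM; lra.
move=> k u N [f hw le_k]; have [[u0 u1 u7 u6] _ _ _ _] := hw.
have fT := f_le _ _ _ hw; have pot0 := pot_ge0 _ _ _ hw.
split; first by rewrite /= u6; lia.
rewrite /cval [nval _ _]/= [nval _ (V 7)]/= u6 u7; case: ifP => f4; last first.
  by split; [rewrite addn1 | exists f => //; rewrite leqNgt f4].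
exists (110 * S)%N; apply: achieves_weaken (step_progP dims hw f4) => //.
move=> u' N' [f' hw' prog].
have k0 : (0 < k)%N.
  rewrite -(ltr0n R); apply: lt_le_trans le_k; rewrite ltr_wpDl//.
    by rewrite divr_ge0// ltW.
  by rewrite ltr0n; lia.
exists k.-1; split; first by rewrite prednK.
  by rewrite -{2}(prednK k0) mulSn addnA.
exists f' => //.
have -> : k.-1%:R = k%:R - 1 :> R by rewrite -subn1 natrB.
rewrite lerBrDr; apply: le_trans le_k.
case: prog => [[-> drop]|[-> drop]].
  rewrite addrAC lerD2r -[X in _ + X](divff (lt0r_neq0 unit0)) -mulrDl.
  by rewrite ler_wpM2r ?invr_ge0 ?(ltW unit0)// -lerBrDr.
rewrite -addrA lerD ?ler_wpM2r ?invr_ge0 ?(ltW unit0)//.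
by rewrite natr1 ler_nat; lia.
Qed.

Lemma pivots_progP (T : {set 'I_n}) w M :
  w 0%N = m -> w 1%N = n -> w 7%N = #|T| ->
  stores M 2%N (col_mx 1%:M A *m mask R T) ->
  achieves W P pivots_prog (21 * S + #|T| * (50 * S) + 1) (fun w' M' =>
    [/\ keeps [:: 3; 4; 5]%N w w', preserves [:: 2; 5; 6; 7]%N M M' &
      exists G, exists q : 'I_m, [/\ stores M' 2%N G, pivoted A T (#|T| %/ 2) G,
        w' 4%N = rshift n q, M' 7%N 0 = sqnorm (row (rshift n q) G) &
        forall i, sqnorm (row (rshift n i) G) <= sqnorm (row (rshift n q) G)]]) w M.
Proof.
move=> w0 w1 w7 hG; have [P_16 P_ltW nm_S S_P SE] := size_bounds dims.
have Tn : (#|T| <= n)%N by rewrite -[leqRHS]card_ord max_card.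
apply: (@achieves_weaken _ _ _ _ (20 * S + (1 + (#|T| %/ 2 * (47 * S) + 1))));
  [|by move=> ? ? hQ; exact: hQ|].
  have : (#|T| %/ 2 * (47 * S) <= #|T| * (50 * S))%N.
    by apply: leq_mul; [exact: leq_div | lia].
  by lia.
pose I k u N := exists c, exists G, exists q : 'I_m,
  [/\ (c + k = #|T| %/ 2)%N /\ u 5 = c, keeps [:: 3; 4; 5]%N w u,
      preserves [:: 2; 5; 6; 7]%N M N, stores N 2 G /\ pivoted A T c G &
      [/\ u 4 = rshift n q, N 7 0 = sqnorm (row (rshift n q) G) &
        forall i, sqnorm (row (rshift n i) G) <= sqnorm (row (rshift n q) G)]].
apply: achieves_cat; apply: achieves_weaken (find_pivotP dims w0 w1 hG) => //.
move=> u1 M1 [ku1 pM1 _ [q [u14 M170 qmax]]].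
apply: achieves_cons; apply: (achieves_set W_16); [by []|by []|by rewrite /=; lia|].
apply: (@achieves_loop _ _ _ P_W W_16 _ _ (fun k => k * (47 * S) + 1)%N I);
    last first.
  exists 0%N, (col_mx 1%:M A *m mask R T), q; split=> //.
  - by apply: keeps_upd => //; apply: keeps_sub ku1.
  - exact: preserves_sub pM1.
  - by split; [move=> p l; rewrite pM1 | exact: pivoted0].
move=> k u N [c [G [q' [[ck u5] ku pN [hGN hpiv] [u4 N70 q'max]]]]].
have u0 : u 0 = m by rewrite ku.
have u1' : u 1 = n by rewrite ku.
have u7 : u 7 = #|T| by rewrite ku.
have cT : (c <= #|T| %/ 2)%N by rewrite -ck leq_addr.
have cT2 : (2 * c <= #|T|)%N by have := leq_trunc_div #|T| 2; lia.
split; first by rewrite /= u5; lia.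
rewrite /cval [nval _ _]/= [nval _ (V 7)]/= u5 u7; case: ltnP => hc; last first.
  split; first by rewrite addn1.
  have cE : c = (#|T| %/ 2)%N by lia.
  by split=> //; exists G, q'; rewrite -cE.
have k0 : (0 < k)%N by lia.
exists (25 * S + (1 + 20 * S))%N.
apply: achieves_cat; apply: achieves_weaken (sweep_progP dims u0 u1' u4 hGN) => //.
move=> v N' [kv pN' _ hG'].
have v5 : v 5 = c by rewrite kv.
apply: achieves_cons; apply: (achieves_set W_16); [by []|by []|by rewrite /= v5; lia|].
rewrite [nval _ _]/= v5.
have v0 : upd v 5 (c + 1) 0 = m by rewrite /upd /= kv.
have v1 : upd v 5 (c + 1) 1 = n by rewrite /upd /= kv.
apply: achieves_weaken (find_pivotP dims v0 v1 hG') => //.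
move=> y N2 [ky pN2 _ [q2 [y4 N270 q2max]]].
exists k.-1; split; first by rewrite prednK.
  rewrite -{2}(prednK k0) [(_.-1.+1 * _)%N]mulSn.
  by have : (0 < S)%N := leq_trans (ltn_addr m n_gt0) nm_S; lia.
exists (c + 1)%N, (sweep G (rshift n q')), q2; split=> //.
- by split; [lia | rewrite ky].
- apply: keeps_trans (keeps_sub _ ky) => //; apply: keeps_upd => //.
  by apply: keeps_trans ku _; apply: keeps_sub kv.
- apply: preserves_trans (preserves_sub _ pN2) => //.
  by apply: preserves_trans pN _; apply: preserves_sub pN'.
- by split; [move=> p l; rewrite pN2 | exact: pivoted_sweep].
Qed.

End Phase.

Definition coloring_prog : program :=
  count_prog ++ [:: Loop (CN (N 0) (V 7)) phase_prog] ++
  For 3 (V 1) [:: Put 0 (V 3) (VL 1 (V 3))].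

Section Main.
Variables (R : realType) (m n W P : nat).
Hypothesis dims : dimensions m n W P.
Variables (A : 'M[R]_(m, n)).
Let S := ((n + m) * n)%N.
Let n_gt0 := dim_n dims.
Let m_gt0 := dim_m dims.
Let P_W := dim_PW dims.
Let W_16 := dim_W dims.
Let D : R := 64 * herdisc A * ln (4 * m%:R).
Implicit Types (w : wmem) (M : rmem R) (T : {set 'I_n}).

Definition active M : {set 'I_n} := [set j : 'I_n | M 1%N j * M 1%N j < 1].

Definition phase_state T w M : Prop :=
  [/\ [/\ w 0%N = m, w 1%N = n & w 7%N = #|T|], stores M 0%N A, T = active M,
      (forall j : 'I_n, M 8%N j = (j \in T)%:R) &
      (forall p : 'I_n, `|M 1%N p| <= 1)].

(** The cost is proportional to #|T|, which makes the total over all phases geometric. In [D], 64 =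
    8 * 8: the scale is at most 8 h by s^2 <= 4 rho <= 4 (4 h)^2, and [walking_disc] contributes the
    other 8. *)
Lemma phase_progP T w M : phase_state T w M -> (0 < #|T|)%N ->
  achieves W P phase_prog (#|T| * (1400 * S)) (fun w' M' =>
    exists T', [/\ phase_state T' w' M', (4 * #|T'| <= 3 * #|T|)%N &
      forall i, `|\sum_j A i j * (M' 1%N j - M 1%N j)| <= D]) w M.
Proof.
move=> [[w0 w1 w7] hA TE mask x1] T0.
have [P_16 P_ltW nm_S S_P SE] := size_bounds dims.
apply: (@achieves_weaken _ _ _ _ (10 * S + ((21 * S + #|T| * (50 * S) + 1) +
  (15 * S + (10 * S + (1 + ((11 * #|T| * (110 * S).+1 + 1) + 10 * S)))))));
  [|by move=> ? ? hQ; exact: hQ|].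
  have : (1 <= S)%N by exact: leq_trans (ltn_addr m n_gt0) nm_S.
  have : (S <= #|T| * S)%N by rewrite leq_pmull.
  have : (#|T| <= #|T| * S)%N by rewrite leq_pmulr// (leq_trans (ltn_addr m n_gt0) nm_S).
  by clear; move: #|T| (S) => t X; lia.
apply: achieves_cat; apply: achieves_weaken (init_progP dims w0 w1 hA mask) => //.
move=> u1 M1 [ku1 pM1 hG1].
have u10 : u1 0 = m by rewrite ku1.
have u11 : u1 1 = n by rewrite ku1.
have u17 : u1 7 = #|T| by rewrite ku1.
apply: achieves_cat; apply: achieves_weaken (pivots_progP dims u10 u11 u17 hG1) => //.
move=> u2 M2 [ku2 pM2 [G [q [hG2 hpiv u24 M270 qmax]]]].
have u20 : u2 0 = m by rewrite ku2.
have u21 : u2 1 = n by rewrite ku2.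
have u27 : u2 7 = #|T| by rewrite ku2.
apply: achieves_cat.
apply: (achieves_weaken _ _ (sqrt_progP dims u21 u24 hG2 M270)) => //.
move=> u3 M3 [ku3 pM3 s0 rho_s s_rho]; set s := M3 7%N 1 in s0 rho_s s_rho.
have u30 : u3 0 = m by rewrite ku3.
have u31 : u3 1 = n by rewrite ku3.
have u37 : u3 7 = #|T| by rewrite ku3.
apply: achieves_cat; apply: (achieves_weaken _ _ (@weights_progP R m n W P dims u3 M3 u30)) => //.
move=> u4 M4 [ku4 pM4 Wp1 Wm1].
apply: achieves_cons; apply: (achieves_set W_16); [by []|by []|by rewrite /=; lia|].
have s_le : s <= 8 * herdisc A.
  have h0 := herdisc_ge0 A; rewrite -(@ler_pXn2r _ 2) ?nnegrE ?mulr_ge0//.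
  apply: le_trans s_rho _; rewrite (_ : 8 * _ = 2 * (4 * herdisc A)); last by ring.
  rewrite exprMn [2 ^+ 2](_ : _ = 4); last by ring.
  rewrite ler_pM2l//; apply: pivoted_bound hpiv qmax _.
  by rewrite {1}(divn_eq #|T| 2); have := ltn_pmod #|T| (isT : (0 < 2)%N); lia.
have M1E r : r \in [:: 0; 1]%N -> M4 r = M r.
  by rewrite !inE => /orP[]/eqP->; rewrite pM4// pM3// pM2// pM1.
have colE : coloring_of M4 = coloring_of M :> ('I_n -> R).
  by apply/funext => p; rewrite /coloring_of M1E.
have [hw Psi4] := @walking0 R m n A T s (coloring_of M) (coloring_of M) G erefl
  T0 x1 TE hpiv (fun i => le_trans (qmax i) rho_s).
have W3E : weights_of M4 3 = (fun=> 1) :> ('I_m -> R) by apply/funext => i; rewrite /weights_of Wp1.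
have W4E : weights_of M4 4 = (fun=> 1) :> ('I_m -> R) by apply/funext => i; rewrite /weights_of Wm1.
have hw0 : walk_state A T s (coloring_of M) 0 (upd u4 6 0) M4.
  split.
  - by rewrite /upd /= !ku4.
  - by move=> i j; rewrite M1E.
  - by rewrite pM4.
  - by rewrite /potential_of colE W3E W4E.
  - by exists G; [move=> i j; rewrite pM4// pM3 | rewrite colE W3E W4E].
apply: achieves_cat; apply: achieves_weaken (walk_progP dims T0 hw0) => //.
move=> u5 M5 [f [[u50 u51 _ _] hA5 _ Psi5 [G5 _ hw5]] fT].
apply: achieves_weaken (count_progP dims (T := active M5) u51 erefl) => //.
move=> u6 M6 [ku6 pM6 u67 mask6].
have M6E : M6 1 = M5 1 by rewrite pM6.
have actE : active M6 = active M5 by rewrite /active M6E.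
exists (active M6); split.
- split.
  + by split; [rewrite ku6 | rewrite ku6 | rewrite u67 actE].
  + by move=> i j; rewrite pM6.
  + by [].
  + by rewrite actE.
  + by rewrite M6E; have [? [? [_ _ [x5 _] _ _]]] := hw5.
- have h : (#|active M5| + f <= #|T|)%N := walking_active hw5.
  by rewrite actE; move: h fT; clear; lia.
- move=> i; rewrite M6E; apply: le_trans (walking_disc i hw5 s0 m_gt0 Psi5) _.
  have ln0 : 0 <= ln (4 * m%:R) :> R.
    by rewrite ln_ge0// -natrM ler1n muln_gt0 m_gt0.
  rewrite /D ler_wpM2r//; lra.
Qed.

(** Here [e] counts the phases. The last one began with at least one active variable, whence (4 /
    3)^(e - 1) <= n. *)
Lemma coloring_progP w M : w 0%N = m -> w 1%N = n -> stores M 0%N A ->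
  (forall p, (p < n)%N -> M 1%N p = 0) ->
  achieves W P coloring_prog (3 * (4000 * (S * n))) (fun w' M' =>
    exists b : {ffun 'I_n -> bool}, exists e : nat,
    [/\ (e = 0)%N \/ (4 ^ e.-1 <= 3 ^ e.-1 * n)%N,
        forall p : 'I_n, M' 0%N p = (-1) ^+ b p &
        linfty (A *m coloring b) <= e%:R * D]) w M.
Proof.
move=> w0 w1 hA x0; have [P_16 P_ltW nm_S S_P SE] := size_bounds dims.
have S1 : (1 <= S)%N by exact: leq_trans (ltn_addr m n_gt0) nm_S.
have D0 : 0 <= D.
  rewrite /D !mulr_ge0 ?herdisc_ge0// ln_ge0// -natrM ler1n muln_gt0.
  by rewrite m_gt0.
apply: (@achieves_weaken _ _ _ _ (10 * S + ((n * (8 * (1400 * S)) + 1) + (n * 3 + 2))));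
  [|by move=> ? ? hQ; exact: hQ|].
  have : (S <= S * n)%N by rewrite leq_pmulr.
  have : (n <= S * n)%N by rewrite leq_pmull.
  by move: S1; clear; move: (S) (n) => X k; lia.
apply: achieves_cat.
apply: achieves_weaken (count_progP dims (T := active M) w1 erefl) => //.
move=> u1 M1 [ku1 pM1 u17 mask1].
have actE : active M = finset.setT.
  by apply/setP => j; rewrite !inE x0// mul0r ltr01.
have actE1 : active M1 = active M by rewrite /active pM1.
pose I k u N := exists T, exists e : nat,
  [/\ phase_state T u N /\ #|T| = k, (e = 0)%N \/ (4 ^ e.-1 <= 3 ^ e.-1 * n)%N,
      (4 ^ e * #|T| <= 3 ^ e * n)%N &
      forall i, `|\sum_j A i j * N 1 j| <= e%:R * D].
apply: achieves_cat.
(* A phase costs 1400 S per active variable and removes at least a quarter of them, so a budget of 8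
   * 1400 S per variable pays for it twice; the surplus covers the loop test. *)
apply: (@achieves_loop _ _ _ P_W W_16 _ _ (fun k => k * (8 * (1400 * S)) + 1)%N I);
    last first.
  exists finset.setT, 0%N; split=> //.
  - split; last by rewrite cardsT card_ord.
    split=> //.
    + by split; [rewrite ku1 | rewrite ku1 | rewrite u17 actE].
    + by move=> i j; rewrite pM1.
    + by rewrite actE1 actE.
    + by move=> j; rewrite mask1 actE.
    + by move=> p; rewrite pM1// x0// normr0.
  - by left.
  - by rewrite cardsT card_ord.
  - by move=> i; rewrite mul0r big1 ?normr0// => j _; rewrite pM1// x0// mulr0.
move=> k u N [T [e [[hst Tk] he hT hdisc]]].
have [[u0 u1' u7] hAN TE mask x1] := hst.
split; first by rewrite /=; lia.
rewrite /cval [nval _ _]/= [nval _ (V 7)]/= u7 Tk; case: ltnP => hk; last first.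
  have T0 : T = finset.set0 by apply/cards0_eq; lia.
  split; first by rewrite addn1.
  (* No variable is active, so x^2 >= 1 and |x| <= 1: every entry is a sign, exactly. *)
  have x_sq (p : 'I_n) : N 1 p = (-1) ^+ (N 1 p < 0)%R.
    have : p \notin active N by rewrite -TE T0 inE.
    rewrite inE -leNgt => xp; have := x1 p; rewrite ler_norml => /andP[a b].
    case: ltrP => h0; rewrite ?expr1 ?expr0; nra.
  apply: (achieves_fill P_W W_16 (n := n) (D := 0) (E := fun p => N 1 p));
    [by [] | lia | lia | | | |].
  - by move=> i _; rewrite /upd /= u1'.
  - by move=> i ?; rewrite /upd /=; split=> //.
  - by move=> i ?; rewrite /upd /fill /=; split=> //; lia.
  exists [ffun p : 'I_n => (N 1 p < 0)%R], e; split=> //.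
    by move=> p; rewrite /fill /= add0n ltn_ord subn0 ffunE.
  apply: linfty_le => [|i]; first by rewrite mulr_ge0.
  rewrite mxE; congr (`|_| <= _): (hdisc i); apply: eq_bigr => j _.
  by rewrite mxE ffunE -x_sq.
have T0 : (0 < #|T|)%N by rewrite Tk.
exists (#|T| * (1400 * S))%N; apply: achieves_weaken (phase_progP hst T0) => //.
move=> u2 N2 [T2 [hst2 T2T hd]].
exists #|T2|; split; first by rewrite -Tk; lia.
  rewrite -Tk; have : (#|T2| * (8 * (1400 * S)) <= #|T| * (6 * (1400 * S)))%N.
    by move: T2T; clear; move: #|T| #|T2| (1400 * S)%N => t t2 X; nia.
  have : (1 <= #|T| * S)%N by rewrite muln_gt0 T0.
  by clear; move: #|T| #|T2| (S) => t t2 X; lia.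
exists T2, e.+1; split=> //.
- right; rewrite /=; apply: leq_trans hT; rewrite leq_pmulr//.
- rewrite !expnS -(mulnA 3); move: T2T hT; clear.
  by move: #|T| #|T2| (4 ^ e)%N (3 ^ e * n)%N => t t2 a b; nia.
- move=> i; rewrite -natr1 mulrDl mul1r.
  have -> : \sum_j A i j * N2 1 j =
      \sum_j A i j * N 1 j + \sum_j A i j * (N2 1 j - N 1 j).
    by rewrite -big_split; apply: eq_bigr => j _ /=; ring.
  by apply: le_trans (ler_normD _ _) _; rewrite lerD.
Qed.

End Main.

(** * Running time *)

Fixpoint flip_free (i : instr) : bool :=
  match i with
  | Flip _ => false
  | If _ p q => all flip_free p && all flip_free q
  | While _ p => all flip_free p
  | _ => true
  end.

Section Deterministic.
Variables (R : realType) (W : nat).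
Implicit Types (cf : config R) (cs : seq bool).

Lemma step_flip_free cf c c' : all flip_free cf.1 ->
  step W cf c = step W cf c' /\ all flip_free (step W cf c).1.
Proof.
case: cf => [[|[a e|a e|a|t p q|t p] k] s] //= /andP[hi hk]; split=> //.
  by case: ifP => _; rewrite all_cat hk andbT; case/andP: hi.
by case: ifP => _ //; rewrite all_cat /= hi hk.
Qed.

Lemma run_flip_free cf cs cs' : all flip_free cf.1 -> size cs = size cs' ->
  run W cf cs = run W cf cs'.
Proof.
elim: cs cf cs' => [|c cs IHcs] cf [|c' cs'] //= hcf [/IHcs IH].
have [-> hstep] := step_flip_free c c' hcf; apply: IH.
by have [] := step_flip_free c' c' hcf.
Qed.

Lemma run_halted cf cs : halted cf -> run W cf cs = cf.
Proof.
move=> hcf; elim: cs => // c cs IHcs; rewrite /run /= -/(run W _ _).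
suff -> : step W cf c = cf by [].
by case: cf hcf {IHcs} => [[|i p] s].
Qed.

(** Only the number of coins matters to a flip-free program, so its running time is one number [T],
    the least count after which it has halted. *)
Lemma halts_at_flip_free cf t : all flip_free cf.1 ->
  halted (run W cf (nseq t false)) ->
  exists2 T, (T <= t)%N & forall cs, halts_at W cf cs = (size cs == T).
Proof.
move=> hcf ht; have runE cs : run W cf cs = run W cf (nseq (size cs) false).
  by apply: run_flip_free; rewrite ?size_nseq.
pose h k := halted (run W cf (nseq k false)).
case: (ex_minnP (ex_intro h t ht)) => T hT T_min; exists T; first exact: T_min.
move=> cs; rewrite /halts_at runE -/(h (size cs)).
apply/andP/eqP => [[h1 /forallP h2]|szE].
  apply/eqP; rewrite eqn_leq T_min// andbT leqNgt; apply/negP => T_lt.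
  have := h2 (Ordinal T_lt); rewrite /= runE size_takel; last exact: ltnW.
  by rewrite -/(h T) hT.
split; first by rewrite szE.
apply/forallP => k; rewrite runE size_takel ?(ltnW (ltn_ord k))//.
by apply/negP => /T_min; rewrite -szE leqNgt ltn_ord.
Qed.

Lemma run_halts_at cf t cs : all flip_free cf.1 ->
  halted (run W cf (nseq t false)) -> halts_at W cf cs ->
  run W cf cs = run W cf (nseq t false).
Proof.
move=> hcf ht hcs; have [T Tt hT] := halts_at_flip_free hcf ht.
have /eqP size_cs : size cs == T by rewrite -hT.
have runT : run W cf (nseq T false) = run W cf cs.
  by apply: run_flip_free; rewrite ?size_nseq.
by rewrite -(subnKC Tt) nseqD run_cat runT (@run_halted (run W cf cs))//; case/andP: hcs.
Qed.

Lemma nneseries_single (f : nat -> \bar R) (T : nat) :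
  (forall t, t != T -> f t = 0%E) -> (\sum_(0 <= t <oo) f t = f T)%E.
Proof.
move=> f0; apply/lim_near_cst => //; exists T.+1 => // N /= TN.
rewrite (big_cat_nat (n := T)) ?(ltnW TN)//= big_nat big1 ?add0e.
  rewrite big_ltn// big_nat big1 ?adde0// => i /andP[Ti _].
  by apply: f0; rewrite gtn_eqF.
by move=> i /andP[_ iT]; apply: f0; rewrite ltn_eqF.
Qed.

(** The running time is a point mass: its probabilities sum to 1, which excludes the infinite branch
    of [expected_time]. *)
Lemma expected_time_flip_free cf t : all flip_free cf.1 ->
  halted (run W cf (nseq t false)) -> (expected_time W cf <= (t%:R)%:E)%E.
Proof.
move=> hcf /(halts_at_flip_free hcf)[T Tt hT].
have probE k : time_prob W cf k = (k == T)%:R :> R.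
  rewrite /time_prob; have -> : [set cs : k.-tuple bool | halts_at W cf cs] =
      [set cs : k.-tuple bool | k == T].
    by apply/setP => cs; rewrite !inE hT size_tuple.
  case: eqP => [->|_]; last first.
    by rewrite (_ : [set _ | _] = finset.set0) ?cards0 ?mul0r//; apply/setP => cs; rewrite !inE.
  rewrite (_ : [set _ | _] = finset.setT); last by apply/setP => cs; rewrite !inE.
  by rewrite cardsT card_tuple card_bool natrX divff// expf_neq0.
rewrite /expected_time; under eq_eseriesr => k _ do rewrite probE.
under [X in (if _ then X else _)]eq_eseriesr => k _ do rewrite probE.
rewrite !(@nneseries_single _ T) ?eqxx ?mulr1 ?lee_fin ?ler_nat//.
- by move=> k /negPf->; rewrite mulr0.
- by move=> k /negPf->.
Qed.

End Deterministic.

Definition region_size : nexp :=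
  let k := NAdd (V 0) (V 1) in NMul (NMul k k) (NMul k k).

Definition main_prog : program := Set_ 2 region_size :: coloring_prog.

Lemma main_prog_flip_free : all flip_free main_prog.
Proof. by []. Qed.

Section Input.
Variables (R : realType) (m n : nat) (A : 'M[R]_(m, n)).
Hypotheses (m_gt0 : (0 < m)%N) (n_gt0 : (0 < n)%N).
Let W := ((m + n) ^ 10)%N.
Let P := ((m + n) ^ 4)%N.

(** The exponent 10 leaves room for 16 arrays: W = (m + n)^6 P, and 2^6 >= 16. *)
Lemma dims : dimensions m n W P.
Proof.
have mn2 : (2 <= m + n)%N by lia.
split=> //.
  have -> : W = ((m + n) ^ 6 * P)%N by rewrite /W /P -expnD.
  rewrite leq_mul2r; apply/orP; right; apply: (@leq_trans (2 ^ 6)) => //.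
  by rewrite leq_exp2r.
by apply: (@leq_trans (2 ^ 10)) => //; rewrite leq_exp2r.
Qed.

Let start : config R := (main_prog, input A).
Let D : R := 64 * herdisc A * ln (4 * m%:R).

Lemma main_progP : exists t s b e,
  [/\ (t <= 4 * 4000 * ((n + m) * n * n))%N,
      run W start (nseq t false) = ([::], s),
      (e = 0)%N \/ (4 ^ e.-1 <= 3 ^ e.-1 * n)%N,
      output n s = coloring b & linfty (A *m coloring b) <= e%:R * D].
Proof.
have [P_16 P_ltW nm_S S_P SE] := size_bounds dims.
pose s1 : state R := State (update (words (input A)) 2 P) (reals (input A)).
have step1 c : step W start c = (coloring_prog, s1).
  rewrite /start /main_prog /= /s1; congr (_, State (update _ _ _) _).
    by rewrite modn_small//; have := dim_W dims; lia.
  have W2 : (2 < W)%N by have := dim_W dims; lia.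
  have lit k : (k < 3)%N -> (k %% W)%N = k by move=> k3; rewrite modn_small//; lia.
  rewrite (lit 0%N)// (lit 1%N)//= (@modn_small (m + n)); last by apply: leq_ltn_trans P_ltW; lia.
  have Q_le : ((m + n) * (m + n) <= P)%N.
    by rewrite mulnn /P leq_pexp2l// addn_gt0 m_gt0.
  rewrite (@modn_small ((m + n) * (m + n))) ?(leq_ltn_trans Q_le)//.
  have -> : ((m + n) * (m + n) * ((m + n) * (m + n)) = P)%N.
    by rewrite mulnn mulnn -expnM.
  by rewrite modn_small.
pose w1 : wmem := words s1; pose M1 : rmem R := fun r i => reals s1 (r * P + i)%N.
have rep1 : represents P s1 w1 M1 by split.
have hA : stores M1 0 A.
  move=> i j; rewrite /M1 /= mul0n add0n (index_row dims)// modnMDl modn_small//.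
  by rewrite !valK.
(* Array 1 starts at address P >= m n, past the input, so the walk begins at the origin without
   initialization. *)
have x0 p : (p < n)%N -> M1 1 p = 0.
  move=> pn; rewrite /M1 /= mul1n; case: insubP => // i + _.
  rewrite ltn_divLR//; have : (m * n <= P)%N by lia.
  lia.
have [t [s' [w' [M' [tc hrun [_ hM' _] [b [e [he hb hlin]]]]]]]] :=
  coloring_progP dims (w := w1) erefl erefl hA x0 rep1.
exists t.+1, s', b, e; split=> //.
- have : (0 < (n + m) * n * n)%N by rewrite !muln_gt0 n_gt0 ltn_addr.
  by move: tc; clear; move: (_ * n)%N => X; lia.
- change (run W (step W start false) (nseq t false) = ([::], s')); rewrite step1.
  by have := hrun [::] (nseq t false); rewrite cats0 size_nseq => ->.
- apply/colP => j; rewrite !mxE -hb -hM'//.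
  have : (n <= P)%N by lia.
  by have := ltn_ord j; lia.
Qed.

End Input.

(** * Logarithmic estimates and the final constants *)

Lemma ln2_gt0 (R : realType) : 0 < ln 2 :> R.
Proof. by rewrite ln_gt0// ltr1n. Qed.

Lemma lg_ge1 (R : realType) (k : nat) : (1 < k)%N -> 1 <= lg k%:R :> R.
Proof.
move=> k1; rewrite /lg ler_pdivlMr ?ln2_gt0// mul1r ler_ln ?posrE ?ltr0n ?ler_nat//.
exact: ltnW.
Qed.

Lemma lg_exp (R : realType) (k l : nat) : (0 < k)%N ->
  lg (k ^ l)%:R = l%:R * lg k%:R :> R.
Proof.
by move=> k0; rewrite /lg natrX lnXn ?ltr0n// -[ln _ *+ l]mulr_natl mulrA.
Qed.

Lemma ler_lg (R : realType) (k l : nat) : (0 < k <= l)%N -> lg k%:R <= lg l%:R :> R.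
Proof.
move=> /andP[k0 kl]; rewrite ler_pM2r ?invr_gt0 ?ln2_gt0// ler_ln ?posrE ?ltr0n ?ler_nat//.
exact: leq_trans kl.
Qed.

(* Since [2 <= (4/3)^3], shrinking by 3/4 per phase leaves at most
   [1 + 3 lg n] phases. *)
Lemma phases_le (R : realType) (n e : nat) : (1 < n)%N ->
  (e = 0)%N \/ (4 ^ e.-1 <= 3 ^ e.-1 * n)%N -> e%:R <= 4 * lg n%:R :> R.
Proof.
move=> n1 he; have lgn := lg_ge1 R n1.
case: he => [->|]; first by lra.
case: e => [|e] /=; first by lra.
move=> he; have e2 : (2 ^ e <= n ^ 3)%N.
  rewrite -(@leq_pmul2l (27 ^ e)) ?expn_gt0// -expnMn.
  apply: (@leq_trans (64 ^ e)).
    by case: (posnP e) => [->|e0]; [by [] | rewrite leq_exp2r].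
  rewrite (_ : 64 = 4 ^ 3)%N// (_ : 27 = 3 ^ 3)%N// -!expnM ![(3 * e)%N]mulnC !expnM.
  by rewrite -expnMn leq_exp2r.
have : lg (2 ^ e)%:R <= lg (n ^ 3)%:R :> R by rewrite ler_lg// expn_gt0.
have lg2 : lg 2%:R = 1 :> R by rewrite /lg divff// lt0r_neq0// ln2_gt0.
rewrite !lg_exp// ?(ltnW n1)// lg2 mulr1 -natr1; lra.
Qed.

(** From lg m >= 1 and ln 2 <= 1, ln (4 m) = (2 + lg m) ln 2 is at most 3 lg m; the exponent 3 / 2
    enters by lg m >= 1 again. *)
Lemma ln_4m_le (R : realType) (m : nat) : (1 < m)%N ->
  ln (4 * m%:R) <= 3 * lg m%:R `^ (3 / 2) :> R.
Proof.
move=> m1; have lgm := lg_ge1 R m1; have m0 : (0 < m)%N by exact: ltnW.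
apply: (@le_trans _ _ (3 * lg m%:R)); last first.
  rewrite ler_pM2l// -[leLHS]powRr1 ?(le_trans ler01)//.
  by apply: ler_powR => //; lra.
have ln2 := ln2_gt0 R; have ln2_le1 : ln 2 <= 1 :> R.
  by have := @le_ln1Dx R 1; rewrite (_ : 1 + 1 = 2)//; apply; lra.
have lnm : ln m%:R = lg m%:R * ln 2 :> R by rewrite /lg divfK// lt0r_neq0.
rewrite lnM ?posrE ?ltr0n// (_ : 4 = 2 ^+ 2); last by ring.
rewrite lnXn// lnm -[ln _ *+ 2]mulr_natl; nra.
Qed.

(** Since lg (2 + m / n) >= 1, a cost of order m n^2 + n^3 is within the bound. *)
Lemma cost_le (R : realType) (m n c : nat) : (0 < m)%N -> (0 < n)%N ->
  (c * ((n + m) * n * n))%:R <=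
  c%:R * (m%:R * n%:R ^+ 2 * lg (2 + m%:R / n%:R) + n%:R ^+ 3) :> R.
Proof.
move=> m0 n0; have lg1 : 1 <= lg (2 + m%:R / n%:R) :> R.
  rewrite /lg ler_pdivlMr ?ln2_gt0// mul1r ler_ln ?posrE ?ltr_wpDr ?divr_ge0//.
  by rewrite lerDl divr_ge0.
rewrite natrM ler_wpM2l// !natrM natrD.
have : m%:R * n%:R ^+ 2 <= m%:R * n%:R ^+ 2 * lg (2 + m%:R / n%:R) :> R.
  by rewrite ler_peMr// mulr_ge0// exprn_ge0.
by rewrite !exprS expr0; lra.
Qed.

Theorem theorem1 (R : realType) :
  exists (p : program) (d : nat) (C1 C2 : R),
    [/\ 0 < C1, 0 < C2 &
    forall (m n : nat) (A : 'M[R]_(m, n)), (0 < m)%N -> (0 < n)%N ->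
      let W := ((m + n) ^ d.+1)%N in
      let start := (p, input A) in
      (forall cs : seq bool, halts_at W start cs ->
         exists2 b : {ffun 'I_n -> bool},
           output n (run W start cs).2 = coloring b &
           (1 < m)%N -> (1 < n)%N ->
             linfty (A *m coloring b)
               <= C1 * (lg n%:R * lg m%:R `^ (3 / 2) * herdisc A))
      /\ (expected_time W start
            <= (C2 * (m%:R * n%:R ^+ 2 * lg (2 + m%:R / n%:R)
                      + n%:R ^+ 3))%:E)%E].
Proof.
(* In [C1], 64 comes from the discrepancy of one phase, and 12 = 4 * 3 from at most 4 lg n phases
   and the factor 3 of [ln_4m_le]. *)
exists main_prog, 9%N, (64 * 12), (4 * 4000)%:R; split.
- by rewrite mulr_gt0.
- by rewrite ltr0n muln_gt0.
move=> m n A m0 n0 W start.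
have [t [s [b [e [tc hrun he hb hlin]]]]] := main_progP A m0 n0.
have ff : all flip_free start.1 by exact: main_prog_flip_free.
have ht : halted (run W start (nseq t false)) by rewrite hrun.
split=> [cs|]; last first.
  apply: le_trans (expected_time_flip_free ff ht) _; rewrite lee_fin.
  by apply: le_trans (cost_le R (4 * 4000) m0 n0); rewrite ler_nat.
move=> hcs; have run_cs : run W start cs = ([::], s).
  by rewrite (run_halts_at ff ht hcs) hrun.
exists b; first by rewrite run_cs.
move=> m1 n1; apply: le_trans hlin _.
have h0 := herdisc_ge0 A; have ln_le := ln_4m_le R m1.
have e_le := phases_le R n1 he; have lgn := lg_ge1 R n1.
have -> : 64 * 12 * (lg n%:R * lg m%:R `^ (3 / 2) * herdisc A) =
    4 * lg n%:R * (64 * herdisc A * (3 * lg m%:R `^ (3 / 2))) by ring.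
have ln0 : 0 <= ln (4 * m%:R) :> R.
  by rewrite ln_ge0// -natrM ler1n muln_gt0 m0.
by apply: ler_pM => //; rewrite ?mulr_ge0// ler_wpM2l// mulr_ge0.
Qed.
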